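(* Let $n\ge 3$ be an integer or $n=\infty$. For every element $\hat\eta_\star\in T_n\cdot GL(\Omega_n)$, with $\eta_\star\in\Omega_n\otimes_{max}\Omega_n$ the corresponding (maximally entangled) bipartite state, there exist indices $i_\star,j_\star,k_\star,l_\star\in\{0,1,\ldots,n-1\}$ (for $n=\infty$: angles $i_\star,j_\star,k_\star,l_\star\in[0,2\pi)$) such that $$|C[\eta;\mathsf A_0,\mathsf A_1;\mathsf B_0,\mathsf B_1]|\le |C[\eta_\star;\mathsf E_n(i_\star),\mathsf E_n(j_\star);\mathsf E_n(k_\star),\mathsf E_n(l_\star)]|$$ holds for every bipartite state $\eta\in\Omega_n\otimes_{max}\Omega_n$ and all pairs of binary observables $(\mathsf A_0,\mathsf A_1)$ and $(\mathsf B_0,\mathsf B_1)$ on $\Omega_n$.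
   Context: All inner products $\langle\cdot,\cdot\rangle$ are the standard ones on $\mathbb R^3$ and on $\mathbb R^3\otimes\mathbb R^3$. Regular polygon theory. For an integer $n\ge3$ put $r_n=\sqrt{1/\cos(\pi/n)}$ and let the state space $\Omega_n\subset\mathbb R^3$ be the convex hull of $\omega_n(i)=(r_n\cos\frac{2\pi i}{n},\,r_n\sin\frac{2\pi i}{n},\,1)^T$, $i=0,\ldots,n-1$. For $n=\infty$, $\Omega_\infty$ is the convex hull of $\omega_\infty(\theta)=(\cos\theta,\sin\theta,1)^T$, $\theta\in[0,2\pi)$. The unit effect is $u=(0,0,1)^T$. The effect space is $\mathcal E_n=\{e\in\mathbb R^3: \langle e,\omega\rangle\in[0,1]\ \forall\omega\in\Omega_n\}$. A binary observable is a pair $\mathsf A=\{\mathsf A^0,\mathsf A^1\}$ of elements of $\mathcal E_n$ with $\mathsf A^0+\mathsf A^1=u$. Define $e_n(i)=\frac12(r_n\cos\frac{(2i+1)\pi}{n},\,r_n\sin\frac{(2i+1)\pi}{n},\,1)^T$ for even $n$; $e_n(i)=\frac{1}{1+r_n^2}(r_n\cos\frac{2i\pi}{n},\,r_n\sin\frac{2i\pi}{n},\,1)^T$ for odd $n$; $e_\infty(\theta)=\frac12(\cos\theta,\sin\theta,1)^T$. Put $\overline{e_n(i)}=u-e_n(i)$, and let $\mathsf E_n(i)$ be the binary observable with $\mathsf E_n(i)^0=e_n(i)$, $\mathsf E_n(i)^1=\overline{e_n(i)}$ (similarly $\mathsf E_\infty(\theta)$). Bipartite states. $\Omega_n\otimes_{max}\Omega_n=\{\mu\in\mathbb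 R^3\otimes\mathbb R^3:\langle u\otimes u,\mu\rangle=1,\ \langle e\otimes f,\mu\rangle\ge0\ \forall e,f\in\mathcal E_n\}$. Each $\eta$ in this set corresponds to a linear map $\hat\eta:\mathbb R^3\to\mathbb R^3$ determined by $\langle f,\hat\eta(e)\rangle=\langle e\otimes f,\eta\rangle$ for all $e,f\in\mathbb R^3$; this gives a bijection between $\Omega_n\otimes_{max}\Omega_n$ and the linear maps $\hat\eta$ with $\langle u,\hat\eta(u)\rangle=1$ that map the cone generated by $\mathcal E_n$ into the cone generated by $\Omega_n$. Maximally entangled states. $GL(\Omega_n)$ is the set of linear bijections $T:\mathbb R^3\to\mathbb R^3$ with $T(\Omega_n)=\Omega_n$. $T_n$ is the identity if $n$ is odd or $n=\infty$, and for even $n$ $$T_n=\begin{pmatrix}\cos\frac{\pi}{n}&\sin\frac{\pi}{n}&0\\-\sin\frac{\pi}{n}&\cos\frac{\pi}{n}&0\\0&0&1\end{pmatrix}.$$ $T_n\cdot GL(\Omega_n)=\{T_n\circ T: T\in GL(\Omega_n)\}$; a state $\eta$ is called maximally entangled if $\hat\eta\in T_n\cdot GL(\Omega_n)$. CHSH value. For $\eta\in\Omega_n\otimes_{max}\Omega_n$ and binary observables $\mathsf A_0,\mathsf A_1,\mathsf B_0,\mathsf B_1$, $$C[\eta;\mathsf A_0,\mathsf A_1;\mathsf B_0,\mathsf B_1]=E(00)+E(01)+E(10)-E(11),\qquad E(st)=\sum_{a,b\in\{0,1\}}(-1)^{a+b}\langle \mathsf A_s^a\otimes\mathsf B_t^b,\eta\rangle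 .$$ *)

(* Defs.v *)
From HB Require Import structures.
From mathcomp Require Import all_boot all_order all_algebra.
From mathcomp Require Import all_classical all_reals all_analysis.

Set Implicit Arguments.
Unset Strict Implicit.
Unset Printing Implicit Defensive.

Import Order.TTheory GRing.Theory Num.Theory.
Import numFieldNormedType.Exports.

Local Open Scope classical_set_scope.
Local Open Scope ring_scope.

Section Geometry.
Context {R : realType}.

Definition vec3 (a b c : R) : 'cV[R]_3 := \col_(i < 3) [:: a; b; c]`_i.

(* R^3 ⊗ R^3 is represented by 'M[R]_3: the coordinate of a tensor on the
   basis vector (i-th) ⊗ (j-th) is the (i, j) entry of the matrix. *)
Definition tens (e f : 'cV[R]_3) : 'M[R]_3 := e *m f^T.

(* With n = 1 this is the inner product of R^3, with n = 3 the one of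
   R^3 ⊗ R^3. *)
Definition inner n (x y : 'M[R]_(3, n)) : R := \sum_i \sum_j x i j * y i j.

Definition hull (S : set 'cV[R]_3) : set 'cV[R]_3 :=
  smallest (@convex_set R ('cV[R]_3 : lmodType R)) S.

End Geometry.

(* [Ngon n] is the theory of the regular n-gon, [Disc] the case n = infinity. *)
Variant polygon := Ngon of nat | Disc.

Definition at_least_3 (n : polygon) : bool :=
  if n is Ngon m then (3 <= m)%N else true.

Definition label (R : realType) (n : polygon) : Type :=
  match n with
  | Ngon m => 'I_m
  | Disc => {theta : R | 0 <= theta < 2 * pi}
  end.

Section PolygonTheory.
Context {R : realType}.

Definition radius (m : nat) : R := Num.sqrt (1 / cos (pi / m%:R)).

Definition omega (n : polygon) : label R n -> 'cV[R]_3 :=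
  match n with
  | Ngon m => fun i : 'I_m =>
      vec3 (radius m * cos (2 * pi * i%:R / m%:R))
           (radius m * sin (2 * pi * i%:R / m%:R)) 1
  | Disc => fun theta => vec3 (cos (val theta)) (sin (val theta)) 1
  end.

Definition Omega (n : polygon) : set 'cV[R]_3 := hull (range (@omega n)).

Definition unit_eff : 'cV[R]_3 := vec3 0 0 1.

Definition effects (n : polygon) : set 'cV[R]_3 :=
  [set e | forall w, Omega n w -> 0 <= inner e w <= 1].

Definition eff (n : polygon) : label R n -> 'cV[R]_3 :=
  match n with
  | Ngon m => fun i : 'I_m =>
      if odd m then
        (1 / (1 + radius m ^+ 2)) *:
          vec3 (radius m * cos (2 * i%:R * pi / m%:R))
               (radius m * sin (2 * i%:R * pi / m%:R)) 1
      else
        (1 / 2) *: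
          vec3 (radius m * cos ((2 * i%:R + 1) * pi / m%:R))
               (radius m * sin ((2 * i%:R + 1) * pi / m%:R)) 1
  | Disc => fun theta =>
      (1 / 2) *: vec3 (cos (val theta)) (sin (val theta)) 1
  end.

Definition observable (n : polygon) (A : 'I_2 -> 'cV[R]_3) : Prop :=
  (forall a, effects n (A a)) /\ A 0 + A 1 = unit_eff.

Definition eff_obs (n : polygon) (i : label R n) (a : 'I_2) : 'cV[R]_3 :=
  if a == 0 then eff i else unit_eff - eff i.

Definition max_tensor (n : polygon) : set 'M[R]_3 :=
  [set mu | inner (tens unit_eff unit_eff) mu = 1 /\
            forall e f, effects n e -> effects n f -> 0 <= inner (tens e f) mu].

(* Linear maps R^3 -> R^3 are represented by 'M[R]_3 acting on column vectors
   by left multiplication; [is_hat eta M] says that M is the linear map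
   associated with the tensor eta. *)
Definition is_hat (eta M : 'M[R]_3) : Prop :=
  forall e f : 'cV[R]_3, inner f (M *m e) = inner (tens e f) eta.

Definition GL (n : polygon) : set 'M[R]_3 :=
  [set T | T \in unitmx /\ (fun w : 'cV[R]_3 => T *m w) @` Omega n = Omega n].

Definition twist (n : polygon) : 'M[R]_3 :=
  match n with
  | Ngon m =>
      if odd m then 1%:M else
        let c : R := cos (pi / m%:R) in
        let s : R := sin (pi / m%:R) in
        \matrix_(i < 3, j < 3)
          (nth [::] [:: [:: c; s; 0]; [:: - s; c; 0]; [:: 0; 0; 1]] i)`_j
  | Disc => 1%:M
  end.

Definition twisted_GL (n : polygon) : set 'M[R]_3 :=
  [set twist n *m T | T in GL n].

Definition corr (eta : 'M[R]_3) (A B : 'I_2 -> 'cV[R]_3) : R :=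
  \sum_(a < 2) \sum_(b < 2) (-1) ^+ (a + b) * inner (tens (A a) (B b)) eta.

Definition CHSH (eta : 'M[R]_3) (A0 A1 B0 B1 : 'I_2 -> 'cV[R]_3) : R :=
  corr eta A0 B0 + corr eta A0 B1 + corr eta A1 B0 - corr eta A1 B1.

End PolygonTheory.

(* Main.v *)
(* By convexity the supremum of |CHSH| over observables is reached at extreme
   ones, that is at u, - u and the differences e - (u - e) of the extreme effects;
   whenever u or - u occurs the value is at most 2. For even n the correlations of
   an arbitrary state are simulated on the maximally entangled one, and for the
   disc the bound is Tsirelson's 2 sqrt 2.

   For odd n write the two directions of each party as a mid direction plus or
   minus d pi / n. If d is not the integer d0 nearest to n / 4 for one of the parties,
   b0 + b1 and b0 - b1 are dominated by two positive elements whose sum is a multiple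
   of u, which bounds CHSH for every choice on the other side. If d = d0 for both,
   the bound is a linear inequality in the state, and it is certified by integrating
   the positive form of the state along families of pairs of vertices against a
   positive trigonometric density of degree two. The triangle and the pentagon are
   too small for these estimates and have explicit certificates. *)

(* What separates even from odd n is the unit component of an observable. For even n the differences
   e - (u - e) lie in the plane orthogonal to u, so correlations with them ignore the unit component
   of what the state assigns to the other party. For odd n they have unit component - tan(pi / (2
   n))^2; the local terms of a state then enter CHSH, a biased state might profit from them, and
   every estimate has to control them.

   Values up to 2 are harmless because every maximally entangled state reaches 2: one of its
   correlations has modulus at least 1, and repeating both settings doubles it.

   In a certificate the slack is a nonnegative combination of values of the state on pairs of
   vertices. Comparing coefficients of the state fixes the weights of the families and the harmonics
   of the densities; what remains is nonnegativity of the densities, a numerical condition that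
   holds for n >= 7. At the direction d0 the terms other than the main one carry a factor of order 1
   / n, which leaves room for it. *)
Require Import Defs.
From mathcomp Require Import all_boot all_order all_algebra.
From mathcomp Require Import all_classical all_reals all_analysis.
From mathcomp Require Import ring lra zify.

Set Implicit Arguments.
Unset Strict Implicit.
Unset Printing Implicit Defensive.

Import Order.TTheory GRing.Theory Num.Theory.
Import numFieldNormedType.Exports.

Local Open Scope classical_set_scope.
Local Open Scope ring_scope.

(** * Cosines at lattice angles *)

Section Lattice.
Context {R : realType}.
Implicit Types (x t : R) (n k m : nat).

Lemma cosDn2pi x k : cos (x + k%:R * (2 * pi)) = cos x :> R.
Proof.
have -> : k%:R * (2 * pi) = pi *+ 2 *+ k :> R by rewrite !mulr_natl.
by rewrite periodicn //; exact: cosD2pi.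
Qed.

Lemma sinDn2pi x k : sin (x + k%:R * (2 * pi)) = sin x :> R.
Proof.
have -> : k%:R * (2 * pi) = pi *+ 2 *+ k :> R by rewrite !mulr_natl.
by rewrite periodicn //; exact: sinD2pi.
Qed.

Lemma cos_sum0 n k x : (0 < k < n)%N ->
  \sum_(j < n) cos (x + j%:R * (2 * k%:R * pi / n%:R)) = 0 :> R.
Proof.
move=> /andP[k0 kn]; have n0 : (0 : R) < n%:R by rewrite ltr0n (leq_trans _ kn).
have nz : n%:R != 0 :> R by rewrite gt_eqF.
set t : R := k%:R * pi / n%:R.
have st : 0 < sin t.
  apply: sin_gt0_pi; apply/andP; split.
    by rewrite divr_gt0 // mulr_gt0 ?pi_gt0 ?ltr0n.
  by rewrite ltr_pdivrMr // mulrC ltr_pM2l ?pi_gt0 // ltr_nat.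
pose F (j : nat) := sin (x - t + j%:R * (2 * t)).
suff : 2 * sin t * (\sum_(j < n) cos (x + j%:R * (2 * k%:R * pi / n%:R))) = 0.
  by move/eqP; rewrite !mulf_eq0 pnatr_eq0 (gt_eqF st) /= => /eqP.
rewrite mulr_sumr; transitivity (\sum_(0 <= j < n) (F j.+1 - F j)); last first.
  rewrite telescope_sumr // /F mul0r addr0.
  have -> : x - t + n%:R * (2 * t) = x - t + k%:R * (2 * pi) by rewrite /t; field.
  by rewrite sinDn2pi subrr.
rewrite big_mkord; apply: eq_bigr => j _; rewrite /F.
have -> : x + j%:R * (2 * k%:R * pi / n%:R) = x + j%:R * (2 * t) by rewrite /t; field.
rewrite -(natr1 j); set y := x + _.
have -> : x - t + (j%:R + 1) * (2 * t) = y + t by rewrite /y; ring.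
have -> : x - t + j%:R * (2 * t) = y - t by rewrite /y; ring.
by rewrite sinD sinB; ring.
Qed.

(** An odd multiple of pi / n is at distance at least pi / n from every multiple of 2 pi. Reduction
    modulo 2 n and the reflection r -> 2 n - r bring it into [0, pi], where cos decreases. *)
Lemma cos_oddn_le n m : (0 < n)%N -> odd m ->
  cos (m%:R * pi / n%:R) <= cos (pi / n%:R) :> R.
Proof.
move=> n0 om; have nz : (0 : R) < n%:R by rewrite ltr0n.
have nz' : n%:R != 0 :> R by rewrite gt_eqF.
have small k : odd k -> (k <= n)%N -> cos (k%:R * pi / n%:R) <= cos (pi / n%:R) :> R.
  move=> ok kn.
  have [k0 k1] : 0 <= k%:R * pi / n%:R :> R /\ k%:R * pi / n%:R <= pi :> R.
    split; first by rewrite divr_ge0 ?mulr_ge0 ?pi_ge0.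
    by rewrite ler_pdivrMr // mulrC ler_pM2l ?pi_gt0 // ler_nat.
  have [l0 l1] : 0 <= pi / n%:R :> R /\ pi / n%:R <= pi :> R.
    split; first by rewrite divr_ge0 ?pi_ge0.
    by rewrite ler_pdivrMr // ler_peMr ?pi_ge0 // ler1n.
  rewrite leNgt ltr_cos ?in_itv /= ?k0 ?k1 ?l0 ?l1 //.
  rewrite -leNgt ler_pM2r ?invr_gt0 // ler_peMl ?pi_ge0 //.
  by rewrite ler1n; case: k ok {kn k0 k1}.
have -> : m%:R * pi / n%:R = (m %% (2 * n))%:R * pi / n%:R + (m %/ (2 * n))%:R * (2 * pi) :> R.
  by rewrite {1}(divn_eq m (2 * n)) natrD !natrM; field.
rewrite cosDn2pi; set r := (m %% _)%N.
have r2 : (r < 2 * n)%N by rewrite ltn_mod; lia.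
have ro : odd r by move: om; rewrite {1}(divn_eq m (2 * n)) -/r; lia.
have [rn|rn] := leqP r n; first exact: small.
have h1 : odd (2 * n - r) by lia.
have h2 : (2 * n - r <= n)%N by lia.
have := small _ h1 h2; rewrite natrB 1?ltnW //.
have -> : ((2 * n)%:R - r%:R) * pi / n%:R = - (r%:R * pi / n%:R) + 1%:R * (2 * pi) :> R.
  by rewrite natrM; field.
by rewrite cosDn2pi cosN.
Qed.

Lemma cos_odd_le n (z : int) : (0 < n)%N -> odd `|z| ->
  cos (z%:~R * pi / n%:R) <= cos (pi / n%:R) :> R.
Proof.
move=> n0; case: (intP z) => [|k|k]; first by rewrite absz0 /=.
  by rewrite absz_nat -pmulrn; exact: cos_oddn_le.
by rewrite abszN absz_nat mulrNz -pmulrn !mulNr cosN; exact: cos_oddn_le.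
Qed.

(** This is the previous bound after a half turn, since [z + n] is odd. Together the two bounds give
    the range of an extreme effect on the vertices. *)
Lemma cos_parity_le n (z : int) : (0 < n)%N -> odd `|z| != odd n ->
  - cos (pi / n%:R) <= cos (z%:~R * pi / n%:R) :> R.
Proof.
move=> n0 oz; rewrite lerNl; have nz : n%:R != 0 :> R by rewrite pnatr_eq0 -lt0n.
have := @cos_odd_le n (z + n%:Z) n0.
have -> : (z + n%:Z)%:~R * pi / n%:R = z%:~R * pi / n%:R + pi :> R.
  by rewrite intrD -pmulrn; field.
rewrite cosDpi; apply.
by case: z oz => z; lia.
Qed.

End Lattice.

(** * States as bilinear forms, observables as elements of a unit ball *)

Section Bilinear.
Context {R : realType}.
Implicit Types (x y a b w : 'cV[R]_3) (eta : 'M[R]_3).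

Definition o0 : 'I_3 := ord0.
Definition o1 : 'I_3 := lift ord0 ord0.
Definition o2 : 'I_3 := lift ord0 (lift ord0 ord0).

Lemma vec3_eta x : x = vec3 (x o0 0) (x o1 0) (x o2 0).
Proof.
apply/colP => i; rewrite mxE.
by case: i => [[|[|[|//]]] ?] /=; congr (x _ _); apply/val_inj.
Qed.

Lemma sum3 (F : 'I_3 -> R) : \sum_i F i = F o0 + F o1 + F o2.
Proof. by rewrite !big_ord_recl big_ord0 addr0 addrA. Qed.

Lemma inner_dot x y : inner x y = (x^T *m y) 0 0.
Proof. by rewrite /inner mxE; apply: eq_bigr => i _; rewrite big_ord1 mxE. Qed.

Lemma innerE x y : inner x y = x o0 0 * y o0 0 + x o1 0 * y o1 0 + x o2 0 * y o2 0.
Proof. by rewrite /inner sum3 !big_ord1. Qed.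

Lemma inner_vec3 (p q r p' q' r' : R) :
  inner (vec3 p q r) (vec3 p' q' r') = p * p' + q * q' + r * r'.
Proof. by rewrite innerE !mxE. Qed.

Lemma innerC x y : inner x y = inner y x.
Proof. by rewrite !innerE; ring. Qed.

Lemma innerDl x y w : inner (x + y) w = inner x w + inner y w.
Proof. by rewrite !inner_dot linearD mulmxDl mxE. Qed.

Lemma innerNl x w : inner (- x) w = - inner x w.
Proof. by rewrite !inner_dot linearN mulNmx mxE. Qed.

Lemma innerBl x y w : inner (x - y) w = inner x w - inner y w.
Proof. by rewrite innerDl innerNl. Qed.

Lemma innerZl (k : R) x w : inner (k *: x) w = k * inner x w.
Proof. by rewrite !inner_dot linearZ -scalemxAl mxE. Qed.

Lemma innerDr x y w : inner w (x + y) = inner w x + inner w y.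
Proof. by rewrite innerC innerDl !(innerC w). Qed.

Lemma innerBr x y w : inner w (x - y) = inner w x - inner w y.
Proof. by rewrite innerC innerBl !(innerC w). Qed.

Lemma innerZr (k : R) x w : inner w (k *: x) = k * inner w x.
Proof. by rewrite innerC innerZl (innerC w). Qed.

Lemma inner_mul (M : 'M[R]_3) x y : inner x (M *m y) = inner (M^T *m x) y.
Proof. by rewrite !inner_dot trmx_mul trmxK mulmxA. Qed.

Definition bil eta x y : R := inner (tens x y) eta.

Lemma bilE eta x y : bil eta x y = inner x (eta *m y).
Proof.
rewrite /bil /tens /inner; apply: eq_bigr => i _.
rewrite big_ord1 mxE mulr_sumr; apply: eq_bigr => j _.
by rewrite mxE big_ord1 mxE mulrAC mulrA.
Qed.

Lemma bilDl eta x x' y : bil eta (x + x') y = bil eta x y + bil eta x' y.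
Proof. by rewrite !bilE innerDl. Qed.
Lemma bilNl eta x y : bil eta (- x) y = - bil eta x y.
Proof. by rewrite !bilE innerNl. Qed.
Lemma bilBl eta x x' y : bil eta (x - x') y = bil eta x y - bil eta x' y.
Proof. by rewrite bilDl bilNl. Qed.
Lemma bilZl eta k x y : bil eta (k *: x) y = k * bil eta x y.
Proof. by rewrite !bilE innerZl. Qed.
Lemma bil_tr eta x y : bil eta x y = bil eta^T y x.
Proof. by rewrite !bilE inner_mul innerC. Qed.
Lemma bilDr eta x y y' : bil eta x (y + y') = bil eta x y + bil eta x y'.
Proof. by rewrite !(bil_tr eta) bilDl. Qed.
Lemma bilNr eta x y : bil eta x (- y) = - bil eta x y.
Proof. by rewrite !(bil_tr eta) bilNl. Qed.
Lemma bilBr eta x y y' : bil eta x (y - y') = bil eta x y - bil eta x y'.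
Proof. by rewrite bilDr bilNr. Qed.
Lemma bilZr eta k x y : bil eta x (k *: y) = k * bil eta x y.
Proof. by rewrite !(bil_tr eta) bilZl. Qed.

Definition bilin := (bilDl, bilDr, bilNl, bilNr, bilZl, bilZr).

(** Grouped by the first party, because the bounds treat [b0 + b1] and [b0 - b1] separately. *)
Definition chsh eta a0 a1 b0 b1 : R := bil eta a0 (b0 + b1) + bil eta a1 (b0 - b1).

Lemma chshE eta a0 a1 b0 b1 : chsh eta a0 a1 b0 b1 =
  bil eta a0 b0 + bil eta a0 b1 + bil eta a1 b0 - bil eta a1 b1.
Proof. by rewrite /chsh !bilin; ring. Qed.

Lemma chsh_tr eta a0 a1 b0 b1 : chsh eta a0 a1 b0 b1 = chsh eta^T b0 b1 a0 a1.
Proof. by rewrite !chshE !(bil_tr eta); ring. Qed.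

Lemma CHSH_chsh eta (A0 A1 B0 B1 : 'I_2 -> 'cV[R]_3) :
  CHSH eta A0 A1 B0 B1 = chsh eta (A0 0 - A0 1) (A1 0 - A1 1) (B0 0 - B0 1) (B1 0 - B1 1).
Proof.
rewrite /CHSH chshE.
have corrE A B : corr eta A B = bil eta (A 0 - A 1) (B 0 - B 1).
  rewrite /corr !big_ord_recl !big_ord0 /= !bilBl !bilBr.
  have -> : lift ord0 ord0 = 1 :> 'I_2 by apply/val_inj.
  by rewrite -!/(bil _ _ _) /bump /= addn0 addn1 !expr0 !expr1 expr2; ring.
by rewrite !corrE.
Qed.

Lemma hull_ind (S : set 'cV[R]_3) (P : set 'cV[R]_3) : S `<=` P ->
  (forall x y (k : R), 0 <= k -> k <= 1 -> P x -> P y -> P (k *: x + (1 - k) *: y)) ->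
  hull S `<=` P.
Proof.
move=> SP Pc; apply: smallest_sub => // x y l; rewrite !inE => Px Py.
by apply: Pc => //; exact: ge0 || exact: le1.
Qed.

Lemma sub_hull (S : set 'cV[R]_3) : S `<=` hull S.
Proof. exact: sub_smallest. Qed.

End Bilinear.

(** * The ball of observables and the reduction to extreme ones *)

Section Effects.
Context {R : realType} (n : polygon).
Implicit Types (x y a b w e f : 'cV[R]_3) (eta : 'M[R]_3).
Local Notation u := (@unit_eff R).

Lemma Omega_omega (i : label R n) : Omega n (omega i).
Proof. by apply: sub_hull; exists i. Qed.

Lemma Omega_le (r : R) x : (forall i : label R n, inner x (omega i) <= r) ->
  forall w, Omega n w -> inner x w <= r.
Proof.
move=> xr; apply: hull_ind => [_ [i _ <-]//|y z k k0 k1 /= ky kz].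
rewrite innerDr !innerZr.
have h : 0 <= 1 - k by lra.
have := ler_wpM2l k0 ky; have := ler_wpM2l h kz; lra.
Qed.

Lemma Omega_ge (r : R) x : (forall i : label R n, r <= inner x (omega i)) ->
  forall w, Omega n w -> r <= inner x w.
Proof.
move=> xr w Ow; rewrite -lerN2 -innerNl; apply: Omega_le Ow => i.
by rewrite innerNl lerN2.
Qed.

Lemma omega_u (i : label R n) : inner u (omega i) = 1.
Proof. by rewrite /unit_eff; case: n i => [m|] i /=; rewrite inner_vec3; ring. Qed.

Lemma Omega_u w : Omega n w -> inner u w = 1.
Proof.
move=> Ow; apply: le_anti; apply/andP; split.
  by apply: Omega_le Ow => i; rewrite omega_u.
by apply: Omega_ge Ow => i; rewrite omega_u.
Qed.

(* A binary observable is determined by the difference A^0 - A^1, which ranges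
   over the unit ball of the order unit norm. *)
Definition pos x := forall w, Omega n w -> 0 <= inner x w.
Definition ball a := pos (u + a) /\ pos (u - a).

Lemma effectsP e : effects n e <-> pos e /\ pos (u - e).
Proof.
split=> [h|[h1 h2] w Ow]; last first.
  by have := h2 w Ow; rewrite innerBl Omega_u // h1 //=; lra.
by split=> w Ow; have /andP[h1 h2] := h w Ow => //; rewrite innerBl Omega_u //; lra.
Qed.

Lemma ball_effect a : ball a <-> effects n (2^-1 *: (u + a)).
Proof.
rewrite effectsP.
have -> : u - 2^-1 *: (u + a) = 2^-1 *: (u - a).
  by apply/matrixP => i j; rewrite !mxE; field.
by split=> -[h1 h2]; split=> w Ow; have := h1 w Ow; have := h2 w Ow;
  rewrite ?innerZl; lra.
Qed.

Lemma effect_ball e : effects n e -> ball (2 *: e - u).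
Proof.
move=> he; apply/ball_effect.
by have -> : 2^-1 *: (u + (2 *: e - u)) = e by
  apply/matrixP => i j; rewrite !mxE; field.
Qed.

Lemma ballN a : ball a -> ball (- a).
Proof. by case=> h1 h2; split; rewrite ?opprK. Qed.

Lemma pos_omega x : (forall i : label R n, 0 <= inner x (omega i)) -> pos x.
Proof. by move=> h w; apply: Omega_ge. Qed.

Lemma ball_u : ball u.
Proof. by split=> w Ow; rewrite ?innerDl ?innerNl !Omega_u //; lra. Qed.

Lemma observable_ball (A : 'I_2 -> 'cV[R]_3) : observable n A -> ball (A 0 - A 1).
Proof.
case=> hA hu; have -> : A 0 - A 1 = 2 *: A 0 - u.
  by rewrite -hu; apply/matrixP => i j; rewrite !mxE; ring.
exact/effect_ball/hA.
Qed.

Definition bounded x := exists r : R, forall w, Omega n w -> inner x w <= r.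

(** [max_tensor] tests effects only; a bounded positive element becomes an effect once scaled
    down. *)
Lemma bil_pos eta x y : max_tensor n eta -> pos x -> bounded x -> pos y -> bounded y ->
  0 <= bil eta x y.
Proof.
move=> [_ he].
have scale z : pos z -> bounded z -> exists2 k : R, 0 < k & effects n (k *: z).
  move=> pz [r hr]; exists (`|r| + 1)^-1; first by rewrite invr_gt0 ltr_wpDl.
  move=> w Ow; have h1 := pz w Ow; have h2 := hr w Ow; have h3 := ler_norm r.
  have k0 : 0 < `|r| + 1 by rewrite ltr_wpDl.
  rewrite innerZl mulrC; apply/andP; split; first by rewrite divr_ge0 // ltW.
  by rewrite ler_pdivrMr // mul1r; lra.
move=> px bx py bY; have [k k0 hk] := scale _ px bx; have [l l0 hl] := scale _ py bY.
have := he _ _ hk hl; rewrite -/(bil _ _ _) bilZl bilZr.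
by rewrite pmulr_rge0 // pmulr_rge0.
Qed.

Lemma ball_posD a : ball a -> pos (u + a) /\ bounded (u + a).
Proof.
case=> h1 h2; split=> //; exists 2 => w Ow.
by have := h2 w Ow; rewrite !innerDl innerNl Omega_u //; lra.
Qed.

Lemma ball_posB a : ball a -> pos (u - a) /\ bounded (u - a).
Proof. by move/ballN/ball_posD. Qed.

Lemma bil_uu eta : max_tensor n eta -> bil eta u u = 1. Proof. by case. Qed.

Lemma bil_ball_le1 eta a b : max_tensor n eta -> ball a -> ball b -> bil eta a b <= 1.
Proof.
move=> he ha hb.
have [p1 p2] := ball_posD ha; have [p3 p4] := ball_posB ha.
have [p5 p6] := ball_posD hb; have [p7 p8] := ball_posB hb.
have := bil_pos he p1 p2 p7 p8; have := bil_pos he p3 p4 p5 p6.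
by rewrite !bilin bil_uu //; lra.
Qed.

Lemma bil_ball_norm eta a b : max_tensor n eta -> ball a -> ball b -> `|bil eta a b| <= 1.
Proof.
move=> he ha hb; rewrite ler_norml bil_ball_le1 // andbT lerNl -bilNl.
by apply: bil_ball_le1 => //; apply: ballN.
Qed.

(** The values at (u + a, u - b0) and (u - a, u - b1) are nonnegative, and their sum is 2 minus the
    left-hand side. *)
Lemma chsh_u eta a b0 b1 : max_tensor n eta -> ball a -> ball b0 -> ball b1 ->
  bil eta u (b0 + b1) + bil eta a (b0 - b1) <= 2.
Proof.
move=> he ha hb0 hb1.
have [p1 p2] := ball_posD ha; have [p3 p4] := ball_posB ha.
have [p5 p6] := ball_posB hb0; have [p7 p8] := ball_posB hb1.
have := bil_pos he p1 p2 p5 p6; have := bil_pos he p3 p4 p7 p8.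
by rewrite !bilin bil_uu //; lra.
Qed.

Definition obs (i : label R n) : 'cV[R]_3 := 2 *: eff i - u.

Lemma eff_obsE (i : label R n) : eff_obs i 0 - eff_obs i 1 = obs i.
Proof. by rewrite /eff_obs /= /obs; apply/matrixP => k l; rewrite !mxE; ring. Qed.

Definition extremal x := x = u \/ x = - u \/ exists i, x = obs i \/ x = - obs i.

Lemma max_tensor_tr eta : max_tensor n eta -> max_tensor n eta^T.
Proof.
case=> h1 h2; split; first by rewrite -/(bil _ _ _) -bil_tr.
by move=> e f he hf; rewrite -/(bil _ _ _) -bil_tr; apply: h2.
Qed.

Hypothesis eff_effect : forall i : label R n, effects n (eff i).
(** Domination of linear functionals is all that extremality has to provide; no description of the
    extreme points is required. *)
Hypothesis extremal_max : forall w a, ball a ->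
  exists2 x, extremal x & inner a w <= inner x w.

Lemma obs_ball i : ball (obs i). Proof. exact/effect_ball. Qed.

Lemma extremal_ball x : extremal x -> ball x.
Proof.
case=> [->|[->|[i [->|->]]]]; [exact: ball_u|exact/ballN/ball_u|exact: obs_ball|].
exact/ballN/obs_ball.
Qed.

Lemma chsh_extremal eta (V : R) : max_tensor n eta -> 2 <= V ->
  (forall i j k l, `|chsh eta (obs i) (obs j) (obs k) (obs l)| <= V) ->
  forall x0 x1 y0 y1, extremal x0 -> extremal x1 -> extremal y0 -> extremal y1 ->
  chsh eta x0 x1 y0 y1 <= V.
Proof.
move=> he V2 hV x0 x1 y0 y1 e0 e1 f0 f1.
have [a0 a1 b0 b1] : [/\ ball x0, ball x1, ball y0 & ball y1].
  by split; apply: extremal_ball.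
have uN a b c : ball a -> ball b -> ball c ->
    bil eta a (b - c) - bil eta u (b + c) <= 2.
  move=> ha /ballN hb /ballN hc; have := chsh_u he ha hc hb.
  by rewrite !bilin; lra.
have het := max_tensor_tr he.
have uNt a b c : ball a -> ball b -> ball c ->
    bil eta^T a (b - c) - bil eta^T u (b + c) <= 2.
  move=> ha /ballN hb /ballN hc; have := chsh_u het ha hc hb.
  by rewrite !bilin; lra.
case: e0 => [->|[->|[i ei]]].
- by have := chsh_u he a1 b0 b1; rewrite /chsh; lra.
- by have := uN _ _ _ a1 b0 b1; rewrite /chsh !bilNl; lra.
case: e1 => [->|[->|[j ej]]].
- have := chsh_u he a0 b0 (ballN b1); rewrite /chsh opprK; lra.
- have := uN _ _ _ a0 b0 (ballN b1); rewrite /chsh opprK bilNl; lra.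
case: f0 => [->|[->|[k ek]]].
- by have := chsh_u het b1 a0 a1; rewrite chsh_tr /chsh; lra.
- by have := uNt _ _ _ b1 a0 a1; rewrite chsh_tr /chsh !bilNl; lra.
case: f1 => [->|[->|[l el]]].
- have := chsh_u het b0 a0 (ballN a1); rewrite chsh_tr /chsh opprK; lra.
- have := uNt _ _ _ b0 a0 (ballN a1); rewrite chsh_tr /chsh opprK bilNl; lra.
(* Up to an overall sign, negating one observable exchanges the two observables of the other party,
   so these four relabellings cover all sign patterns. *)
have := hV i j k l; have := hV j i l k; have := hV j i k l; have := hV i j l k.
rewrite !ler_norml !chshE.
case: ei ej ek el => -> [->|->] [->|->] [->|->]; rewrite ?bilNl ?bilNr;
  by move: (bil _ _ _) (bil _ _ _) (bil _ _ _) (bil _ _ _) => p q r t; lra.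
Qed.

(** CHSH is linear in each argument: first [a0] and [a1] are replaced by extremal elements, then
    [b0] and [b1] with the new first arguments in place. *)
Lemma chsh_le eta (V : R) : max_tensor n eta -> 2 <= V ->
  (forall i j k l, `|chsh eta (obs i) (obs j) (obs k) (obs l)| <= V) ->
  forall a0 a1 b0 b1, ball a0 -> ball a1 -> ball b0 -> ball b1 ->
  `|chsh eta a0 a1 b0 b1| <= V.
Proof.
move=> he V2 hV.
suff H a0 a1 b0 b1 : ball a0 -> ball a1 -> ball b0 -> ball b1 -> chsh eta a0 a1 b0 b1 <= V.
  move=> a0 a1 b0 b1 h0 h1 k0 k1; rewrite ler_norml H // andbT.
  have := H _ _ _ _ (ballN h0) (ballN h1) k0 k1.
  by rewrite /chsh !bilNl; lra.
move=> h0 h1 k0 k1.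
have [x0 ex0 l0] := extremal_max (eta *m (b0 + b1)) h0.
have [x1 ex1 l1] := extremal_max (eta *m (b0 - b1)) h1.
have [y0 ey0 m0] := extremal_max (eta^T *m (x0 + x1)) k0.
have [y1 ey1 m1] := extremal_max (eta^T *m (x0 - x1)) k1.
have := chsh_extremal he V2 hV ex0 ex1 ey0 ey1.
move: l0 l1 m0 m1; rewrite -!bilE -!bil_tr /chsh !bilBl !bilBr !bilDl !bilDr; lra.
Qed.

End Effects.

Section Periodicity.
Context {R : realType}.

Lemma cosDz2pi (x : R) (z : int) : cos (x + z%:~R * (2 * pi)) = cos x.
Proof.
case: (intP z) => [|k|k]; first by rewrite mul0r addr0.
  by rewrite -pmulrn cosDn2pi.
by rewrite mulrNz -pmulrn -[LHS](cosDn2pi _ k.+1) mulNr subrK.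
Qed.

Lemma sinDz2pi (x : R) (z : int) : sin (x + z%:~R * (2 * pi)) = sin x.
Proof.
case: (intP z) => [|k|k]; first by rewrite mul0r addr0.
  by rewrite -pmulrn sinDn2pi.
by rewrite mulrNz -pmulrn -[LHS](sinDn2pi _ k.+1) mulNr subrK.
Qed.

(** Serves to pass from an observable written as a convex combination of extremal elements to one of
    them that does at least as well. *)
Lemma conv4_max (p1 p2 p3 p4 v1 v2 v3 v4 M : R) :
  0 <= p1 -> 0 <= p2 -> 0 <= p3 -> 0 <= p4 -> p1 + p2 + p3 + p4 = 1 ->
  p1 * v1 + p2 * v2 + p3 * v3 + p4 * v4 = M ->
  [\/ M <= v1, M <= v2, M <= v3 | M <= v4].
Proof.
move=> h1 h2 h3 h4 hs hM.
have [?|l1] := leP M v1; first by constructor 1.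
have [?|l2] := leP M v2; first by constructor 2.
have [?|l3] := leP M v3; first by constructor 3.
have [?|l4] := leP M v4; first by constructor 4.
exfalso; have := ler_wpM2l h1 (ltW l1); have := ler_wpM2l h2 (ltW l2).
have := ler_wpM2l h3 (ltW l3); have := ler_wpM2l h4 (ltW l4) => k4 k3 k2 k1.
have : (p1 + p2 + p3 + p4) * M = M by rewrite hs mul1r.
rewrite !mulrDl => kM.
have [e1 e2 e3 e4] : [/\ p1 * (M - v1) = 0, p2 * (M - v2) = 0,
   p3 * (M - v3) = 0 & p4 * (M - v4) = 0] by split; lra.
have aux p v : v < M -> p * (M - v) = 0 -> p = 0.
  move=> lv /eqP; rewrite mulf_eq0 => /orP[/eqP //|]; rewrite subr_eq0 => /eqP e.
  by rewrite e ltxx in lv.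
by move: hs; rewrite (aux _ _ l1 e1) (aux _ _ l2 e2) (aux _ _ l3 e3) (aux _ _ l4 e4); lra.
Qed.

End Periodicity.

(** * Vertices and extreme effects of the polygons *)

Section Ngon.
Context {R : realType} (m : nat) (m3 : (3 <= m)%N).
Local Notation r := (@Defs.radius R m).
Local Notation c := (cos (pi / m%:R) : R).
Local Notation s := (sin (pi / m%:R) : R).
Local Notation theta i := (2 * pi * i%:R / m%:R : R).
Implicit Types (t : R) (w a e : 'cV[R]_3).

Lemma m_gt0 : 0 < m%:R :> R. Proof. by rewrite ltr0n; lia. Qed.
Lemma m_neq0 : m%:R != 0 :> R. Proof. by rewrite gt_eqF // m_gt0. Qed.

Lemma pim_bounds : 0 < pi / m%:R :> R /\ pi / m%:R < pi / 2 :> R.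
Proof.
split; first by rewrite divr_gt0 ?pi_gt0 ?m_gt0.
by rewrite ltr_pM2l ?pi_gt0 // ltf_pV2 ?posrE ?m_gt0 // ltr_nat.
Qed.

Lemma c_gt0 : 0 < c.
Proof. by have [h1 h2] := pim_bounds; apply: cos_gt0_pihalf; rewrite h2 andbT; lra. Qed.

Lemma s_gt0 : 0 < s.
Proof. by have [h1 h2] := pim_bounds; apply: sin_gt0_pihalf; rewrite h1. Qed.

Lemma c_lt1 : c < 1.
Proof.
rewrite lt_neqAle cos_le1 andbT; apply/eqP => c1; have := cos2Dsin2 (pi / m%:R : R).
by have := s_gt0; rewrite c1; nra.
Qed.

Lemma radius_sqr : r ^+ 2 * c = 1.
Proof.
have c0 := c_gt0; rewrite sqr_sqrtr ?divr_ge0 ?ltW //.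
by rewrite mulrAC mul1r divff // gt_eqF.
Qed.

Lemma radius_gt0 : 0 < r.
Proof. by rewrite sqrtr_gt0 divr_gt0 ?c_gt0. Qed.

Lemma label_angle (z : int) : exists i : 'I_m,
  forall x, cos (x + z%:~R * (2 * pi / m%:R)) = cos (x + theta i) /\
            sin (x + z%:~R * (2 * pi / m%:R)) = sin (x + theta i).
Proof.
have m0 : (m%:Z != 0)%R by rewrite eqz_nat; lia.
have lt : (`|(z %% m%:Z)%Z| < m)%N.
  by have := ltz_pmod z (_ : 0 < m%:Z); have := modz_ge0 z m0; lia.
exists (Ordinal lt) => x /=.
have -> : x + z%:~R * (2 * pi / m%:R) =
    x + theta `|(z %% m%:Z)%Z| + (z %/ m%:Z)%Z%:~R * (2 * pi).
  rewrite natr_absz ger0_norm ?modz_ge0 // {1}(divz_eq z m%:Z) intrD intrM -pmulrn.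
  by have := m_neq0 => ?; field.
by rewrite cosDz2pi sinDz2pi.
Qed.

Definition omv t : 'cV[R]_3 := vec3 (r * cos t) (r * sin t) 1.

Lemma omega_omv (i : 'I_m) : @omega R (Ngon m) i = omv (theta i).
Proof. by []. Qed.

Lemma omv_omega (i : 'I_m) (z : int) : exists j : 'I_m,
  omv (theta i + z%:~R * (2 * pi / m%:R)) = @omega R (Ngon m) j.
Proof.
have [j hj] := label_angle (i%:Z + z); exists j; rewrite omega_omv /omv.
have -> : theta i + z%:~R * (2 * pi / m%:R) = 0 + (i%:Z + z)%:~R * (2 * pi / m%:R).
  by rewrite intrD -pmulrn add0r; ring.
by have [-> ->] := hj 0; rewrite add0r.
Qed.

Definition eff_gain : R := if odd m then 1 / (1 + r ^+ 2) else 1 / 2.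
Definition eff_shift : R := if odd m then 0 else pi / m%:R.

Definition efv t : 'cV[R]_3 :=
  eff_gain *: vec3 (r * cos (t + eff_shift)) (r * sin (t + eff_shift)) 1.

Lemma eff_efv (i : 'I_m) : @eff R (Ngon m) i = efv (theta i).
Proof.
rewrite /= /efv /eff_gain /eff_shift; case: ifP => _.
  by rewrite addr0; congr (_ *: vec3 (_ * cos _) (_ * sin _) _); ring.
by congr (_ *: vec3 (_ * cos _) (_ * sin _) _); have := m_neq0 => ?; field.
Qed.

Lemma efv_eff (i : 'I_m) (z : int) : exists j : 'I_m,
  efv (theta i + z%:~R * (2 * pi / m%:R)) = @eff R (Ngon m) j.
Proof.
have [j hj] := label_angle (i%:Z + z); exists j; rewrite eff_efv /efv.
have -> : theta i + z%:~R * (2 * pi / m%:R) + eff_shift =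
   eff_shift + (i%:Z + z)%:~R * (2 * pi / m%:R).
  by rewrite intrD -pmulrn; ring.
by have [-> ->] := hj eff_shift; rewrite addrC.
Qed.

Lemma efv_omv t t' : inner (efv t) (omv t') =
  eff_gain * (r ^+ 2 * cos (t + eff_shift - t') + 1).
Proof. by rewrite innerZl inner_vec3 cosB; ring. Qed.

Lemma eff_gain_gt0 : 0 < eff_gain.
Proof.
by rewrite /eff_gain; case: ifP => _; rewrite divr_gt0 // ltr_pwDl // sqr_ge0.
Qed.

Lemma eff_gain_odd : odd m -> eff_gain = c / (1 + c).
Proof.
move=> om; rewrite /eff_gain om; have := c_gt0 => c0.
have -> : r ^+ 2 = c^-1.
  by apply: (mulIf (lt0r_neq0 c0)); rewrite radius_sqr mulVf // lt0r_neq0.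
by field; rewrite !lt0r_neq0 ?addr_gt0.
Qed.

Lemma eff_effectN (i : 'I_m) : effects (Ngon m) (@eff R (Ngon m) i).
Proof.
have g0 := eff_gain_gt0; have rc := radius_sqr; have c0 := c_gt0; have c1 := c_lt1.
have r0 : 0 < r ^+ 2 by rewrite exprn_gt0 // radius_gt0.
rewrite eff_efv; apply/effectsP; split; apply: pos_omega => j.
  rewrite omega_omv efv_omv; apply: mulr_ge0; first exact: ltW.
  suff : - c <= cos (theta i + eff_shift - theta j).
    move/(ler_wpM2l (ltW r0)); rewrite mulrN rc; lra.
  rewrite /eff_shift; case: ifP => om.
    have -> : theta i + 0 - theta j = (2 * (i%:Z - j%:Z))%:~R * pi / m%:R.
      by rewrite intrM intrB -!pmulrn; have := m_neq0 => ?; field.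
    by apply: cos_parity_le; rewrite ?om; lia.
  have -> : theta i + pi / m%:R - theta j = (2 * (i%:Z - j%:Z) + 1)%:~R * pi / m%:R.
    by rewrite intrD intrM intrB -!pmulrn; have := m_neq0 => ?; field.
  by apply: cos_parity_le; rewrite ?om; lia.
rewrite innerBl omega_u omega_omv efv_omv /eff_shift.
have [om|om] := boolP (odd m).
  rewrite eff_gain_odd //; have := cos_le1 (theta i + 0 - theta j) => h.
  rewrite subr_ge0 mulrAC ler_pdivrMr ?addr_gt0 // mul1r.
  have -> : c * (r ^+ 2 * cos (theta i + 0 - theta j) + 1) =
            (r ^+ 2 * c) * cos (theta i + 0 - theta j) + c by ring.
  by rewrite rc mul1r lerD2r.
rewrite /eff_gain (negbTE om).
suff : cos (theta i + pi / m%:R - theta j) <= c.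
  by move/(ler_wpM2l (ltW r0)); rewrite rc; lra.
have -> : theta i + pi / m%:R - theta j = (2 * (i%:Z - j%:Z) + 1)%:~R * pi / m%:R.
  by rewrite intrD intrM intrB -!pmulrn; have := m_neq0 => ?; field.
by apply: cos_odd_le; lia.
Qed.

End Ngon.

Section NgonExtremal.
Context {R : realType} (m : nat) (m3 : (3 <= m)%N).
Local Notation r := (@Defs.radius R m).
Local Notation c := (cos (pi / m%:R) : R).
Local Notation s := (sin (pi / m%:R) : R).
Local Notation theta i := (2 * pi * i%:R / m%:R : R).
Local Notation u := (@unit_eff R).
Local Notation omv := (@omv R m).
Local Notation efv := (@efv R m).
Implicit Types (t : R) (w a e g : 'cV[R]_3).

(* An element of the dual cone that vanishes at a vertex lies in the plane
   spanned by the two extreme effects vanishing there, and its values at the two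
   neighbouring vertices give the coefficients. *)
Lemma vanishing_decomp g t (K := @eff_gain R m) : inner g (omv t) = 0 ->
  0 <= inner g (omv (t + 2 * pi / m%:R)) -> 0 <= inner g (omv (t - 2 * pi / m%:R)) ->
  exists al be : R, [/\ 0 <= al, 0 <= be &
    g = al *: efv (t + pi + pi / m%:R - eff_shift m) +
        be *: efv (t + pi - pi / m%:R - eff_shift m)].
Proof.
have K0 : 0 < K := eff_gain_gt0 m.
have r0 : 0 < r := radius_gt0 m3; have c0 : 0 < c := c_gt0 m3; have s0 : 0 < s := s_gt0 m3.
have rc : r ^+ 2 * c = 1 := radius_sqr m3.
rewrite (vec3_eta g); move: (g o0 0) (g o1 0) (g o2 0) => g0 g1 g2.
rewrite !inner_vec3.
have -> : 2 * pi / m%:R = pi / m%:R + pi / m%:R :> R by field; rewrite (m_neq0 m3).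
rewrite /efv !subrK -/K.
have -> : t + pi + pi / m%:R = t + pi / m%:R + pi by ring.
have -> : t + pi - pi / m%:R = t - pi / m%:R + pi by ring.
rewrite !cosDpi !sinDpi; move: (pi / m%:R) c0 s0 rc => p c0 s0 rc.
rewrite addrA opprD addrA !(cosD (t + p)) !(sinD (t + p)) !(cosB (t - p)) !(sinB (t - p)).
rewrite !(cosB t) !(sinB t) !(cosD t) !(sinD t).
move: (cos2sin2 p) (cos2sin2 t) => h1 h2.
move: (cos t) (sin t) h2 => C S h2.
move: (cos p) (sin p) c0 s0 rc h1 => c s c0 s0 rc h1.
move: r r0 rc => r r0 rc.
(* Radial and tangential components of [g] at angle [t]; vanishing at the vertex ties the unit
   component to [A]. *)
set A := g0 * C + g1 * S; set B := g1 * C - g0 * S.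
move=> k0 k1 k2.
have eg2 : g2 = - r * A by move: k0; rewrite /A; lra.
have q1 : 0 <= - A * s + B * c.
  have : 0 <= 2 * r * s * (- A * s + B * c).
    rewrite (_ : 2 * r * s * _ = g0 * (r * ((C * c - S * s) * c - (S * c + C * s) * s)) +
       g1 * (r * ((S * c + C * s) * c + (C * c - S * s) * s)) + g2 * 1) //.
    rewrite eg2 /A /B; ring: h1.
  by rewrite pmulr_rge0 // !mulr_gt0.
have q2 : 0 <= - A * s - B * c.
  have : 0 <= 2 * r * s * (- A * s - B * c).
    rewrite (_ : 2 * r * s * _ = g0 * (r * ((C * c + S * s) * c + (S * c - C * s) * s)) +
       g1 * (r * ((S * c - C * s) * c - (C * c + S * s) * s)) + g2 * 1) //.
    by rewrite eg2 /A /B; ring: h1.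
  by rewrite pmulr_rge0 // !mulr_gt0.
have d0 : 0 < 2 * K * r * s * c by rewrite !mulr_gt0.
exists ((- A * s - B * c) / (2 * K * r * s * c)), ((- A * s + B * c) / (2 * K * r * s * c)).
split; [by rewrite divr_ge0 // ltW|by rewrite divr_ge0 // ltW|].
have nz : [/\ K != 0, r != 0, s != 0 & c != 0] by rewrite !lt0r_neq0.
case: nz => nK nr ns nc.
have e0 : g0 = A * C - B * S by rewrite /A /B; ring: h2.
have e1 : g1 = A * S + B * C by rewrite /A /B; ring: h2.
have e2 : g2 = - A / (r * c).
  by apply: (mulIf (mulf_neq0 nr nc)); rewrite eg2 divfK ?mulf_neq0 //; ring: rc.
rewrite e0 e1 e2; move: A B {eg2 q1 q2 e0 e1 e2 k0 k1 k2} => A B.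
apply/matrixP => i j; rewrite !mxE.
case: i => [[|[|[|//]]] ?] /=; field; rewrite ?nK ?nr ?ns ?nc //.
Qed.

(** Locates labels near the antipode of a vertex; [x] absorbs the parity of [m]. *)
Lemma half_label (k : nat) (x : R) : k.*2%:R = (m%:R + x) :> R ->
  forall t, t + k%:Z%:~R * (2 * pi / m%:R) = t + pi + x * (pi / m%:R).
Proof.
rewrite -mul2n natrM -pmulrn => hk t.
have -> : k%:R * (2 * pi / m%:R) = (2 * k%:R) * (pi / m%:R) :> R by ring.
by rewrite hk; field; rewrite (m_neq0 m3).
Qed.

Lemma opposite_eff (i : 'I_m) :
  (exists j : 'I_m, efv (theta i + pi + pi / m%:R - eff_shift m) = @eff R (Ngon m) j) /\
  (exists j : 'I_m, efv (theta i + pi - pi / m%:R - eff_shift m) = @eff R (Ngon m) j).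
Proof.
rewrite /eff_shift; case: ifP => om; split.
- have [j hj] := @efv_eff R m m3 i (uphalf m); exists j; rewrite -hj; congr (efv _).
  rewrite (half_label (x := 1)); last first.
  by rewrite natr1; congr (_%:R); lia.
  by ring.
- have [j hj] := @efv_eff R m m3 i m.-1./2; exists j; rewrite -hj; congr (efv _).
  rewrite (half_label (x := (- 1))); last first.
  by apply/eqP; rewrite eq_sym subr_eq natr1; apply/eqP; congr (_%:R); lia.
  by ring.
- have [j hj] := @efv_eff R m m3 i (uphalf m); exists j; rewrite -hj; congr (efv _).
  rewrite (half_label (x := 0)); last first.
  by rewrite addr0; congr (_%:R); lia.
  by ring.
- have [j hj] := @efv_eff R m m3 i m.-1./2; exists j; rewrite -hj; congr (efv _).
  rewrite (half_label (x := (- 2))); last first.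
  by apply/eqP; rewrite eq_sym subr_eq -natrD; apply/eqP; congr (_%:R); lia.
  by ring.
Qed.

Lemma opposite_omega (i : 'I_m) : if odd m then
  (exists j : 'I_m, omv (theta i + pi + pi / m%:R) = @omega R (Ngon m) j) /\
  (exists j : 'I_m, omv (theta i + pi - pi / m%:R) = @omega R (Ngon m) j)
  else exists j : 'I_m, omv (theta i + pi) = @omega R (Ngon m) j.
Proof.
case: ifP => om; first split.
- have [j hj] := @omv_omega R m m3 i (uphalf m); exists j; rewrite -hj; congr (omv _).
  rewrite (half_label (x := 1)); last first.
  by rewrite natr1; congr (_%:R); lia.
  by ring.
- have [j hj] := @omv_omega R m m3 i m.-1./2; exists j; rewrite -hj; congr (omv _).
  rewrite (half_label (x := (- 1))); last first.
  by apply/eqP; rewrite eq_sym subr_eq natr1; apply/eqP; congr (_%:R); lia.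
  by ring.
- have [j hj] := @omv_omega R m m3 i m./2; exists j; rewrite -hj; congr (omv _).
  rewrite (half_label (x := 0)); last first.
  by rewrite addr0; congr (_%:R); lia.
  by ring.
Qed.

Lemma neighbour_omega (i : 'I_m) :
  (exists j : 'I_m, omv (theta i + 2 * pi / m%:R) = @omega R (Ngon m) j) /\
  (exists j : 'I_m, omv (theta i - 2 * pi / m%:R) = @omega R (Ngon m) j).
Proof.
split.
  by have [j hj] := @omv_omega R m m3 i 1; exists j; rewrite -hj mul1r.
by have [j hj] := @omv_omega R m m3 i (- 1); exists j; rewrite -hj mulN1r.
Qed.

(** Let u + a reach its largest vertex value M at vertex k. Then g = M u - (u + a) is positive and
    vanishes at k, so it is a nonnegative combination of two extreme effects, and a = (M - 1) u - g
    turns into a convex combination of four extremal elements. *)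
Lemma extremal_maxN w a : ball (Ngon m) a ->
  exists2 x, extremal (Ngon m) x & inner a w <= inner x w.
Proof.
move=> [pa qa].
pose v (i : 'I_m) := inner (u + a) (@omega R (Ngon m) i).
have i0 : 'I_m by exists 0%N; lia.
pose k := [arg max_(i > i0) v i]%O.
have kmax i : v i <= v k by rewrite /k; case: arg_maxP => // j _; apply.
set M := v k; pose g := M *: u - (u + a).
have gv i : inner g (@omega R (Ngon m) i) = M - v i.
  by rewrite innerBl innerZl omega_u mulr1.
have gpos i : 0 <= inner g (@omega R (Ngon m) i) by rewrite gv subr_ge0 kmax.
have M0 : 0 <= M by exact: pa (Omega_omega _).
have M2 : M <= 2.
  have := qa _ (Omega_omega (k : label R (Ngon m))); rewrite /M /v innerBl innerDl omega_u; lra.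
have gM i : inner g (@omega R (Ngon m) i) <= M.
  by rewrite gv; have := pa _ (Omega_omega (i : label R (Ngon m))); rewrite -/(v i); lra.
have [[j1 n1] [j2 n2]] := neighbour_omega k.
have [al [be [al0 be0 eg]]] : exists al be : R, [/\ 0 <= al, 0 <= be &
    g = al *: efv (theta k + pi + pi / m%:R - eff_shift m) +
        be *: efv (theta k + pi - pi / m%:R - eff_shift m)].
  apply: vanishing_decomp; rewrite ?n1 ?n2 //.
  by rewrite -omega_omv gv /M subrr.
have ea : a = (M - 1) *: u - g.
  by rewrite /g; apply/matrixP => i j; rewrite !mxE; ring.
have [[p ep] [q eq]] := opposite_eff k.
have rc : r ^+ 2 * c = 1 := radius_sqr m3; have c0 : 0 < c := c_gt0 m3.
have := opposite_omega k; have [om|om] := boolP (odd m); last first.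
  have gain : eff_gain m = 1 / 2 :> R by rewrite /eff_gain (negbTE om).
  (* Both effects equal 1 at the antipodal vertex, so [al + be <= M]; this makes the weight of [u]
     nonnegative. *)
  case=> l ol; have := gM l; rewrite eg -ol innerDl (innerZl al) (innerZl be) !efv_omv !subrK gain.
  have -> : theta k + pi + pi / m%:R - (theta k + pi) = pi / m%:R by ring.
  have -> : theta k + pi - pi / m%:R - (theta k + pi) = - (pi / m%:R) by ring.
  rewrite cosN rc => abM.
  have := @conv4_max R (1 - M / 2) ((M - al - be) / 2) (al / 2) (be / 2)
    (inner (- u) w) (inner u w) (inner (- @obs R (Ngon m) p) w)
    (inner (- @obs R (Ngon m) q) w) (inner a w).
  case; [lra|lra|lra|lra|lra| | | | |].
  - rewrite ea eg ep eq /obs; move: (eff _) (eff _) => x y.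
    by rewrite !(innerBl, innerDl, innerNl, innerZl); field.
  - by exists (- u) => //; right; left.
  - by exists u => //; left.
  - by exists (- @obs R (Ngon m) p) => //; right; right; exists p; right.
  - by exists (- @obs R (Ngon m) q) => //; right; right; exists q; right.
case=> [[l1 o1] [l2 o2]].
have gain : eff_gain m = c / (1 + c) :> R by exact: eff_gain_odd.
have c1 : 0 < 1 + c by rewrite addr_gt0.
have nc1 : 1 + c != 0 by rewrite lt0r_neq0.
have cc : cos (pi / m%:R + pi / m%:R) = 2 * c ^+ 2 - 1 :> R.
  by rewrite cosD -!expr2 sin2cos2; ring.
have v1 : c / (1 + c) * (r ^+ 2 + 1) = 1.
  rewrite mulrAC -[RHS](divff nc1); congr (_ / _).
  by rewrite mulrDr mulr1 mulrC rc addrC.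
have v2 : c / (1 + c) * (r ^+ 2 * (2 * c ^+ 2 - 1) + 1) = 2 * c - 1.
  rewrite mulrAC -[RHS](mulfK nc1); congr (_ / _).
  have -> : c * (r ^+ 2 * (2 * c ^+ 2 - 1) + 1) = (r ^+ 2 * c) * (2 * c ^+ 2 - 1) + c by ring.
  by rewrite rc; ring.
have := gM l1; have := gM l2.
rewrite eg -o1 -o2 !innerDl !(innerZl al) !(innerZl be) !efv_omv !subrK gain.
have -> : theta k + pi + pi / m%:R - (theta k + pi - pi / m%:R) =
  pi / m%:R + pi / m%:R by ring.
have -> : theta k + pi - pi / m%:R - (theta k + pi + pi / m%:R) =
  - (pi / m%:R + pi / m%:R) by ring.
rewrite !subrr cosN cos0 cc mulr1 v1 v2 mulr1 => M_be M_al.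
(* For odd [m] there is no antipodal vertex. The common part of the two effects is rewritten through
   [u - eff k], and only the excess of the larger coefficient stays on a single effect. *)
have esum : efv (theta k + pi + pi / m%:R - eff_shift m) +
    efv (theta k + pi - pi / m%:R - eff_shift m) = (2 * c) *: (u - @eff R (Ngon m) k).
  rewrite (eff_efv m3) /efv /unit_eff gain /eff_shift om !subr0 !addr0.
  have -> : theta k + pi + pi / m%:R = theta k + pi / m%:R + pi by ring.
  have -> : theta k + pi - pi / m%:R = theta k - pi / m%:R + pi by ring.
  rewrite !cosDpi !sinDpi !(cosD (theta k)) !(sinD (theta k)) cosN sinN.
  apply/matrixP => i j; rewrite !mxE; by case: i => [[|[|[|//]]] ?] /=; field.
have main (A B : R) (p0 : 'I_m) : 0 <= B -> B <= A -> A + B * (2 * c - 1) <= M ->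
  g = (A - B) *: @eff R (Ngon m) p0 + (B * (2 * c)) *: (u - @eff R (Ngon m) k) ->
  exists2 x, extremal (Ngon m) x & inner a w <= inner x w.
  move=> B0 BA AB egAB.
  have := @conv4_max R (1 - M / 2) ((M - A - B * (2 * c - 1)) / 2) ((A - B) / 2) (B * c)
    (inner (- u) w) (inner u w) (inner (- @obs R (Ngon m) p0) w)
    (inner (@obs R (Ngon m) k) w) (inner a w).
  case; [lra|lra|lra| |lra| | | | |].
  - by rewrite mulr_ge0 // ltW.
  - rewrite ea egAB /obs; move: (eff _) (eff _) => x y.
    by rewrite !(innerBl, innerDl, innerNl, innerZl); field.
  - by exists (- u) => //; right; left.
  - by exists u => //; left.
  - by exists (- @obs R (Ngon m) p0) => //; right; right; exists p0; right.
  - by exists (@obs R (Ngon m) k) => //; right; right; exists k; left.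
have [ba|/ltW ab] := leP be al.
  apply: (main al be p) => //; first by lra.
  rewrite eg -ep -(scalerA be) -esum; move: (efv _) (efv _) => x y.
  by apply/matrixP => i j; rewrite !mxE; ring.
apply: (main be al q) => //; first by lra.
rewrite eg -eq -(scalerA al) -esum; move: (efv _) (efv _) => x y.
by apply/matrixP => i j; rewrite !mxE; ring.
Qed.
End NgonExtremal.

(** * Symmetries and the disc *)

Section Symmetry.
Context {R : realType} (n : polygon).
Implicit Types (x y w v : 'cV[R]_3) (T : 'M[R]_3).
Local Notation u := (@unit_eff R).

Lemma inner_ge0 x : 0 <= inner x x.
Proof. by rewrite innerE !addr_ge0 // -expr2 sqr_ge0. Qed.

Lemma inner_eq0 x : inner x x = 0 -> x = 0.
Proof.
rewrite innerE => h; have [h0 h1 h2] : [/\ x o0 0 = 0, x o1 0 = 0 & x o2 0 = 0].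
  by split; nra.
by rewrite (vec3_eta x) h0 h1 h2; apply/colP => -[[|[|[|//]]] ?]; rewrite !mxE.
Qed.

Variable rho : R.
Hypothesis omega_norm : forall i : label R n, inner (omega i) (omega i) = rho.

Lemma Omega_norm w : Omega n w -> inner w w <= rho.
Proof.
apply: (hull_ind (P := [set w | inner w w <= rho])) => [_ [i _ <-] /=|].
  by rewrite omega_norm.
move=> x y k k0 k1 /= hx hy; have k2 : 0 <= 1 - k by lra.
have := ler_wpM2l k0 hx; have := ler_wpM2l k2 hy.
have := mulr_ge0 (mulr_ge0 k0 k2) (inner_ge0 (x - y)).
rewrite !(innerBl, innerBr) !(innerDl, innerDr, innerZl, innerZr) (innerC y x); lra.
Qed.

(* A vertex of Omega is the only point where its own inner product is maximal,
   so the preimage under T of a vertex has to be a vertex. *)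
Lemma GL_preimage T (j : label R n) : GL n T -> exists i : label R n, T *m omega i = omega j.
Proof.
move=> [_ hT]; apply: contrapT => /forallNP hn.
have [z Oz Tz] : ((fun w => T *m w) @` Omega n) (omega j).
  by rewrite hT; exact: Omega_omega.
suff : inner (omega j) (T *m z) < rho by rewrite Tz omega_norm ltxx.
apply: (hull_ind (P := [set w | inner (omega j) (T *m w) < rho])) Oz => [_ [i _ <-] /=|].
  rewrite ltNge; apply/negP => h; apply: (hn i); apply/subr0_eq/inner_eq0.
  have OT : Omega n (T *m @omega R n i).
    by rewrite -hT; exists (omega i) => //; exact: Omega_omega.
  have := Omega_norm OT; have := inner_ge0 (T *m omega i - omega j).
  rewrite !(innerBl, innerBr) omega_norm (innerC (T *m _) (omega j)); lra.
move=> x y k k0 k1 /= hx hy; have k2 : 0 <= 1 - k by lra.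
rewrite mulmxDr -!scalemxAr innerDr !innerZr.
have [->|kn] := eqVneq k 0; first by lra.
have kp : 0 < k by rewrite lt_def kn.
have := ltr_pM2l kp (inner (omega j) (T *m x)) rho; rewrite hx => h1.
have := ler_wpM2l k2 (ltW hy); lra.
Qed.

Lemma GL_Omega T w : GL n T -> Omega n w -> Omega n (T *m w).
Proof. by move=> [_ hT] Ow; rewrite -hT; exists w. Qed.

End Symmetry.

(** * The disc and the bound 2 sqrt 2 *)

Section DiscTheory.
Context {R : realType}.
Implicit Types (x y w v a : 'cV[R]_3) (T eta : 'M[R]_3) (t : R).
Local Notation u := (@unit_eff R).

Lemma disc_label (x y : R) : x ^+ 2 + y ^+ 2 = 1 ->
  exists t : label R Disc, cos (val t) = x /\ sin (val t) = y.
Proof.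
move=> h; have x1 : -1 <= x <= 1 by apply/andP; split; have := sqr_ge0 y; nra.
have a0 := acos_ge0 x1; have a1 := acos_lepi x1; have p0 := @pi_gt0 R.
have ck : cos (acos x) = x by rewrite acosK // in_itv.
have sk : sin (acos x) = `|y|.
  by rewrite sin_acos // -sqrtr_sqr; congr Num.sqrt; rewrite -h; ring.
have [y0|y0] := leP 0 y.
  have ht : 0 <= acos x < 2 * pi by rewrite a0 /=; lra.
  by exists (exist (fun x : R => 0 <= x < 2 * pi) _ ht) => /=; rewrite ck sk ger0_norm.
have ht : 0 <= 2 * pi - acos x < 2 * pi.
  have : acos x != 0 by apply/eqP => e; move: sk; rewrite e sin0; have := normr_gt0 y; lra.
  by move: a0; rewrite le_eqVlt eq_sym => /orP[->//|]; lra.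
exists (exist (fun x : R => 0 <= x < 2 * pi) _ ht) => /=.
have -> : 2 * pi - acos x = - acos x + 1%:R * (2 * pi) by ring.
by rewrite cosDn2pi sinDn2pi cosN sinN ck sk ltr0_norm // opprK.
Qed.

Definition dirv t : 'cV[R]_3 := vec3 (cos t) (sin t) 0.

Lemma obs_disc (t : label R Disc) : obs t = dirv (val t).
Proof.
rewrite /obs /= /dirv /unit_eff.
by apply/colP => -[[|[|[|//]]] ?]; rewrite !mxE /=; field.
Qed.

Lemma omega_disc (t : label R Disc) : omega t = u + dirv (val t).
Proof. by rewrite /unit_eff /dirv; apply/colP => -[[|[|[|//]]] ?]; rewrite !mxE /=; ring. Qed.

Lemma dirv_ball t : ball Disc (dirv t).
Proof.
split; apply: pos_omega => i; rewrite ?innerBl ?innerDl omega_u /= inner_vec3;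
  have := cosB t (val i); have := cos_le1 (t - val i); have := cos_geN1 (t - val i); lra.
Qed.

Lemma eff_effectD (t : label R Disc) : effects Disc (eff t).
Proof.
have := dirv_ball (val t); rewrite ball_effect -obs_disc /obs.
by rewrite addrC subrK scalerA mulVf // scale1r.
Qed.

(** By [key] the ball lies in the double cone where the norm of the plane part plus the modulus of
    the unit component is at most 1. A functional there is at most the larger of N and |w2|, with N
    the norm of its plane part; the circle reaches N and one of u, - u reaches |w2|. *)
Lemma extremal_maxD w a : ball Disc a ->
  exists2 x, extremal Disc x & inner a w <= inner x w.
Proof.
move=> [pa qa].
have key (x y : R) : x ^+ 2 + y ^+ 2 = 1 -> `|a o0 0 * x + a o1 0 * y| <= 1 - `|a o2 0|.
  move=> h; have [t [ht1 ht2]] := disc_label h.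
  have h' : (- x) ^+ 2 + (- y) ^+ 2 = 1 by rewrite !sqrrN.
  have [t' [ht3 ht4]] := disc_label h'.
  have := pa _ (Omega_omega t); have := qa _ (Omega_omega t).
  have := pa _ (Omega_omega t'); have := qa _ (Omega_omega t').
  rewrite !(innerBl _ _ (omega _)) !(innerDl _ _ (omega _)) !omega_u /= !innerE !mxE /=.
  rewrite ht1 ht2 ht3 ht4 => h1 h2 h3 h4.
  rewrite ler_norml; have [?|?] := leP 0 (a o2 0); [rewrite ger0_norm|rewrite ltr0_norm] => //;
    by apply/andP; split; lra.
set W := w o0 0 ^+ 2 + w o1 0 ^+ 2; set N := Num.sqrt W.
have W0 : 0 <= W by rewrite addr_ge0 ?sqr_ge0.
have NW : N ^+ 2 = W by rewrite sqr_sqrtr.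
have N0 : 0 <= N by rewrite sqrtr_ge0.
have [N00|N1] := eqVneq N 0.
  have [e0 e1] : w o0 0 = 0 /\ w o1 0 = 0.
    by move: NW; rewrite N00 /W; split; nra.
  have h10 : (1 : R) ^+ 2 + 0 ^+ 2 = 1 by ring.
  have := key _ _ h10; rewrite mulr1 mulr0 addr0 => h.
  have a2 : `|a o2 0| <= 1 by have := normr_ge0 (a o0 0); lra.
  move: a2; rewrite ler_norml => /andP[a2 a2'].
  have [w2|w2] := leP 0 (w o2 0).
    exists u; first by left.
    by rewrite !innerE e0 e1 !mxE /= ; nra.
  exists (- u); first by right; left.
  by rewrite !innerE e0 e1 !mxE /= ; nra.
have Np : 0 < N by rewrite lt_def N1.
have hu : (w o0 0 / N) ^+ 2 + (w o1 0 / N) ^+ 2 = 1.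
  by rewrite !expr_div_n -mulrDl -/W -NW divff // expf_neq0.
have [t [tx ty]] := disc_label hu.
have := key _ _ hu; have -> : a o0 0 * (w o0 0 / N) + a o1 0 * (w o1 0 / N) =
  (a o0 0 * w o0 0 + a o1 0 * w o1 0) / N by ring.
rewrite ler_norml => /andP[_]; rewrite ler_pdivrMr // => hk.
have ot : inner (obs t) w = N.
  rewrite obs_disc innerE !mxE /= tx ty -[RHS](mulfK N1) -expr2 NW /W; field.
  exact: N1.
have a0 := normr_ge0 (a o2 0); have w0 := normr_ge0 (w o2 0).
have aw : a o2 0 * w o2 0 <= `|a o2 0| * `|w o2 0| by rewrite -normrM ler_norm.
have a1 : `|a o2 0| <= 1 by have := le_trans (normr_ge0 _) (key _ _ hu); lra.
have [wN|Nw] := leP `|w o2 0| N.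
  exists (obs t); first by right; right; exists t; left.
  by rewrite ot innerE; have := ler_wpM2l a0 wN; lra.
have a1' : 0 <= 1 - `|a o2 0| by lra.
have bound : inner a w <= `|w o2 0|.
  by rewrite innerE; have := ler_wpM2l a1' (ltW Nw); lra.
have [w2|w2] := leP 0 (w o2 0).
  exists u; first by left.
  by move: bound; rewrite ger0_norm // => /le_trans; apply; rewrite innerE !mxE /=; lra.
exists (- u); first by right; left.
by move: bound; rewrite ltr0_norm // => /le_trans; apply; rewrite innerE !mxE /=; lra.
Qed.

(** Sum and difference of two unit directions are 2 cos be and 2 sin be times orthogonal unit
    directions, and |cos be| + |sin be| <= sqrt 2. *)
Lemma chsh_disc eta t0 t1 t2 t3 : max_tensor Disc eta ->
  `|chsh eta (dirv t0) (dirv t1) (dirv t2) (dirv t3)| <= 2 * Num.sqrt 2.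
Proof.
move=> he; set al := (t2 + t3) / 2; set be := (t2 - t3) / 2.
have e2 : t2 = al + be by rewrite /al /be; field.
have e3 : t3 = al - be by rewrite /al /be; field.
have -> : chsh eta (dirv t0) (dirv t1) (dirv t2) (dirv t3) =
   2 * cos be * bil eta (dirv t0) (dirv al) +
   2 * sin be * bil eta (dirv t1) (dirv (al + pi / 2)).
  rewrite /chsh -!bilZr; congr (bil _ _ _ + bil _ _ _); rewrite e2 e3 /dirv;
  apply/colP => -[[|[|[|//]]] ?]; rewrite !mxE /= ?cosDpihalf ?sinDpihalf;
  by rewrite ?cosD ?sinD ?cosB ?sinB ?cosN ?sinN; ring.
have := bil_ball_norm he (dirv_ball t0) (dirv_ball al).
have := bil_ball_norm he (dirv_ball t1) (dirv_ball (al + pi / 2)).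
move: (bil _ _ _) (bil _ _ _) => X Y hX hY.
apply: (@le_trans _ _ (2 * (`|cos be| + `|sin be|))).
  apply: le_trans (ler_normD _ _) _; rewrite !normrM normr_nat.
  have := ler_wpM2l (normr_ge0 (cos be)) hY; have := ler_wpM2l (normr_ge0 (sin be)) hX; lra.
rewrite ler_pM2l // -[leLHS]ger0_norm ?addr_ge0 // -sqrtr_sqr ler_wsqrtr //.
have := cos2Dsin2 be; rewrite -[cos be ^+ 2]real_normK ?num_real //.
rewrite -[sin be ^+ 2]real_normK ?num_real //.
by have := sqr_ge0 (`|cos be| - `|sin be|); nra.
Qed.

(** Reflecting a vertex through T u gives the image of an antipode, again in the disc; its norm
    bounds |T u|^2 by the inner product of T u with the vertex. Adding the bounds at two antipodal
    vertices gives |T u|^2 <= 1, while the inner product of u and T u is 1. *)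
Lemma GL_unit_disc T : GL Disc T -> T *m u = u.
Proof.
move=> hT; have nrm (i : label R Disc) : inner (omega i) (omega i) = 2.
  by rewrite /= inner_vec3; have := cos2Dsin2 (val i); lra.
have anti (j : label R Disc) : exists j' : label R Disc, omega j + omega j' = 2 *: u.
  have h : (- cos (val j)) ^+ 2 + (- sin (val j)) ^+ 2 = 1 by rewrite !sqrrN cos2Dsin2.
  have [j' [h1 h2]] := disc_label h; exists j'.
  rewrite /= h1 h2 /unit_eff.
  by apply/colP => -[[|[|[|//]]] ?]; rewrite !mxE /=; ring.
have key (j : label R Disc) : inner (T *m u) (T *m u) <= inner (T *m u) (omega j) /\
    inner u (T *m u) = 1.
  have [i Ti] := GL_preimage nrm j hT; have [i' ii] := anti i.
  have Ti' : T *m omega i' = 2 *: (T *m u) - omega j.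
    by rewrite scalemxAr -ii mulmxDr Ti addrAC subrr add0r.
  have OT : Omega Disc (T *m omega i') by apply: GL_Omega hT _; exact: Omega_omega.
  split.
    have := Omega_norm nrm OT; rewrite Ti'.
    rewrite !(innerBl, innerBr) !innerZl !innerZr nrm (innerC (omega j)); lra.
  by have := Omega_u OT; rewrite Ti' innerBr innerZr omega_u; lra.
have h10 : (1 : R) ^+ 2 + 0 ^+ 2 = 1 by ring.
have [j _] := disc_label h10; have [j' jj] := anti j.
have [h1 h3] := key j; have [h2 _] := key j'.
have h4 : inner (T *m u) (omega j) + inner (T *m u) (omega j') = 2.
  by rewrite -innerDr jj innerZr innerC h3; ring.
apply/subr0_eq/inner_eq0; apply: le_anti; rewrite inner_ge0 andbT.
rewrite !(innerBl, innerBr) (innerC (T *m u) u) h3.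
have -> : inner u u = 1 by rewrite /unit_eff inner_vec3; ring.
lra.
Qed.

Lemma disc_attained T eta : GL Disc T -> is_hat eta T ->
  exists i j k l : label R Disc,
    chsh eta (obs i) (obs j) (obs k) (obs l) = 2 * Num.sqrt 2.
Proof.
move=> hT hh; have Tu := GL_unit_disc hT.
have nrm (i : label R Disc) : inner (omega i) (omega i) = 2.
  by rewrite /= inner_vec3; have := cos2Dsin2 (val i); lra.
pose q : R := Num.sqrt 2 / 2.
have q2 : Num.sqrt 2 ^+ 2 = 2 :> R by rewrite sqr_sqrtr.
have hq : q ^+ 2 + q ^+ 2 = 1 by rewrite /q expr_div_n q2; field.
have hq' : q ^+ 2 + (- q) ^+ 2 = 1 by rewrite sqrrN.
have h10 : (1 : R) ^+ 2 + 0 ^+ 2 = 1 by ring.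
have h01 : (0 : R) ^+ 2 + 1 ^+ 2 = 1 by ring.
have [i' [ix iy]] := disc_label hq; have [j' [jx jy]] := disc_label hq'.
have [k [kx ky]] := disc_label h10; have [l [lx ly]] := disc_label h01.
have [i Ti] := GL_preimage nrm i' hT; have [j Tj] := GL_preimage nrm j' hT.
exists i, j, k, l.
have oT (a b : label R Disc) : T *m omega a = omega b -> T *m obs a = dirv (val b).
  move=> h; have -> : obs a = omega a - u by rewrite obs_disc omega_disc addrAC subrr add0r.
  by rewrite mulmxBr h Tu omega_disc addrAC subrr add0r.
rewrite chshE /bil -!hh (oT _ _ Ti) (oT _ _ Tj) !obs_disc !inner_vec3.
by rewrite ix iy jx jy kx ky lx ly /q; field.
Qed.

End DiscTheory.

(** * Symmetries of the polygons and the case of even n *)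

Lemma ord3 (i : 'I_3) : [\/ i = o0, i = o1 | i = o2].
Proof.
by case: i => [[|[|[|//]]] ?]; [constructor 1|constructor 2|constructor 3]; apply/val_inj.
Qed.

Section NgonSymmetry.
Context {R : realType} (m : nat) (m3 : (3 <= m)%N).
Local Notation r := (@Defs.radius R m).
Local Notation c := (cos (pi / m%:R) : R).
Local Notation s := (sin (pi / m%:R) : R).
Local Notation theta i := (2 * pi * i%:R / m%:R : R).
Local Notation u := (@unit_eff R).
Local Notation om := (@omega R (Ngon m)).
Implicit Types (T eta : 'M[R]_3) (v a : 'cV[R]_3).

Lemma omega_normN (i : 'I_m) : inner (om i) (om i) = r ^+ 2 + 1.
Proof.
rewrite omega_omv inner_vec3; have := cos2sin2 (theta i) => h.
by ring: h.
Qed.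

Lemma sum_cosN (k : nat) (x : R) : (0 < k < m)%N ->
  \sum_(j < m) cos (k%:R * theta j + x) = 0.
Proof.
move=> hk; rewrite -[RHS](@cos_sum0 R m k x hk); apply: eq_bigr => j _.
by congr cos; ring.
Qed.

Lemma sum_sinN (k : nat) (x : R) : (0 < k < m)%N ->
  \sum_(j < m) sin (k%:R * theta j + x) = 0.
Proof.
move=> hk; rewrite -[RHS](@cos_sum0 R m k (x - pi / 2) hk); apply: eq_bigr => j _.
by rewrite -cosBpihalf; congr cos; ring.
Qed.

Lemma omega_inj : injective om.
Proof.
have main (i j : 'I_m) : (i < j)%N -> om i <> om j.
  move=> ij e; have := congr1 (fun w => inner w (om j)) e.
  rewrite omega_normN !omega_omv inner_vec3.
  have -> : r * cos (theta i) * (r * cos (theta j)) + r * sin (theta i) * (r * sin (theta j))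
    = r ^+ 2 * cos (theta j - theta i) by rewrite cosB; ring.
  have -> : theta j - theta i = ((j - i)%N%:R * pi / m%:R) *+ 2.
    by rewrite natrB ?(ltnW ij) // mulr2n; ring.
  rewrite cos_mulr2n cos2sin2; set y := sin _ => h.
  have y0 : 0 < y.
    apply: sin_gt0_pi; apply/andP; split.
      by rewrite divr_gt0 ?(m_gt0 m3) // mulr_gt0 ?pi_gt0 // ltr0n subn_gt0.
    rewrite ltr_pdivrMr ?(m_gt0 m3) // mulrC ltr_pM2l ?pi_gt0 // ltr_nat.
    by have := ltn_ord j; lia.
  have : 0 < r ^+ 2 * y ^+ 2 by rewrite mulr_gt0 // exprn_gt0 ?(radius_gt0 m3).
  by move: h; rewrite mulr1 mulr2n; nra.
move=> i j e; apply/val_inj; case: (ltngtP i j) => // h.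
- by case: (main _ _ h).
- by case: (main _ _ h).
Qed.

Lemma GL_preimageN T (j : 'I_m) : GL (Ngon m) T -> exists i : 'I_m, T *m om i = om j.
Proof. by move=> hT; have [i] := @GL_preimage R (Ngon m) _ omega_normN T j hT; exists i. Qed.

Lemma GL_permute T : GL (Ngon m) T ->
  exists f : 'I_m -> 'I_m, injective f /\ forall j, T *m om (f j) = om j.
Proof.
move=> hT; pose f j := projT1 (cid (GL_preimageN j hT)).
have fP j : T *m om (f j) = om j by rewrite /f; case: cid.
by exists f; split=> // i j e; apply/omega_inj; rewrite -(fP i) e fP.
Qed.

(** The barycentre of the vertices is [u], and [T] permutes the vertices. *)
Lemma GL_unitN T : GL (Ngon m) T -> T *m u = u.
Proof.
move=> hT; have [f [fi fP]] := GL_permute hT.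
have su : \sum_j om j = m%:R *: u.
  have h1 : (0 < 1 < m)%N by lia.
  apply/colP => i; rewrite summxE !mxE.
  under eq_bigr do rewrite omega_omv !mxE.
  case: i => [[|[|[|//]]] ?] /=.
  - rewrite mulr0 -mulr_sumr -[X in _ * X](_ : \sum_(j < m) cos (1%:R * theta j + 0) = _).
      by rewrite sum_cosN // mulr0.
    by apply: eq_bigr => j _; rewrite mul1r addr0.
  - rewrite mulr0 -mulr_sumr -[X in _ * X](_ : \sum_(j < m) sin (1%:R * theta j + 0) = _).
      by rewrite sum_sinN // mulr0.
    by apply: eq_bigr => j _; rewrite mul1r addr0.
  - by rewrite sumr_const card_ord mulr1.
have : T *m (\sum_j om j) = \sum_j om j.
  have {1}-> : \sum_j om j = \sum_j om (f j) by exact: reindex_inj.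
  by rewrite mulmx_sumr; apply: eq_bigr.
rewrite su -scalemxAr => /(congr1 (fun x => m%:R^-1 *: x)).
by rewrite !scalerA mulVf ?(m_neq0 m3) // !scale1r.
Qed.

Lemma sum_omega_omegaT : \sum_j om j *m (om j)^T =
  \matrix_(i, j) (if i == j then (if i == o2 then m%:R else m%:R * r ^+ 2 / 2) else 0).
Proof.
have h1 : (0 < 1 < m)%N by lia.
have h2 : (0 < 2 < m)%N by lia.
have c1 : \sum_(j < m) cos (theta j) = 0.
  by rewrite -[RHS](@sum_cosN 1 0) //; apply: eq_bigr => j _; rewrite mul1r addr0.
have s1 : \sum_(j < m) sin (theta j) = 0.
  by rewrite -[RHS](@sum_sinN 1 0) //; apply: eq_bigr => j _; rewrite mul1r addr0.
have c2 : \sum_(j < m) cos (theta j) ^+ 2 = m%:R / 2.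
  transitivity (\sum_(j < m) (1 / 2 + cos (2%:R * theta j + 0) / 2)).
    by apply: eq_bigr => j _; rewrite addr0 (mulr_natl (theta j)) cos_mulr2n mulr2n; field.
  by rewrite big_split /= -!mulr_suml sum_cosN // mul0r addr0 sumr_const card_ord.
have s2 : \sum_(j < m) sin (theta j) ^+ 2 = m%:R / 2.
  transitivity (\sum_(j < m) (1 - cos (theta j) ^+ 2)).
    by apply: eq_bigr => j _; rewrite sin2cos2.
  by rewrite sumrB c2 sumr_const card_ord -mulr_natl; field.
have cs : \sum_(j < m) cos (theta j) * sin (theta j) = 0.
  transitivity (\sum_(j < m) sin (2%:R * theta j + 0) / 2).
    by apply: eq_bigr => j _; rewrite addr0 (mulr_natl (theta j)) sin_mulr2n mulr2n; field.
  by rewrite -mulr_suml sum_sinN // mul0r.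
apply/matrixP => i j; rewrite summxE !mxE.
under eq_bigr do rewrite mxE big_ord1 mxE omega_omv !mxE.
have red (F : 'I_m -> R) (k x : R) : (\sum_l F l = x) ->
    forall G : 'I_m -> R, (forall l, G l = k * F l) -> \sum_l G l = k * x.
  by move=> <- G hG; rewrite mulr_sumr; apply: eq_bigr.
case: i => [[|[|[|//]]] pi'] /=; case: j => [[|[|[|//]]] pj] /=.
- by rewrite (red _ (r ^+ 2) _ c2) => [|l]; ring.
- by rewrite (red _ (r ^+ 2) _ cs) => [|l]; ring.
- by rewrite (red _ r _ c1) => [|l]; ring.
- by rewrite (red _ (r ^+ 2) _ cs) => [|l]; ring.
- by rewrite (red _ (r ^+ 2) _ s2) => [|l]; ring.
- by rewrite (red _ r _ s1) => [|l]; ring.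
- by rewrite (red _ r _ c1) => [|l]; ring.
- by rewrite (red _ r _ s1) => [|l]; ring.
- by rewrite mulr1 sumr_const card_ord.
Qed.

(** The second moment matrix G of the vertices satisfies T G T^T = G because T permutes them, and G
    is a scalar on the plane; T^T preserves the plane because T fixes [u]. *)
Lemma GL_orthogonal T v : GL (Ngon m) T -> v o2 0 = 0 -> T *m (T^T *m v) = v.
Proof.
move=> hT v0; have [f [fi fP]] := GL_permute hT; have Tu := GL_unitN hT.
set G := \sum_j om j *m (om j)^T.
have TG : T *m G *m T^T = G.
  have {1}-> : G = \sum_j om (f j) *m (om (f j))^T by exact: reindex_inj.
  rewrite mulmx_sumr mulmx_suml; apply: eq_bigr => j _.
  by rewrite -[in RHS](fP j) trmx_mul !mulmxA.
have Gv (w : 'cV[R]_3) : w o2 0 = 0 -> G *m w = (m%:R * r ^+ 2 / 2) *: w.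
  move=> w0; rewrite /G sum_omega_omegaT; apply/colP => i; rewrite !mxE sum3 !mxE.
  by case: (ord3 i) => ->; rewrite /= ?w0; ring.
have Tv0 : (T^T *m v) o2 0 = 0.
  have inu (x : 'cV[R]_3) : inner x u = x o2 0.
    by rewrite innerE /unit_eff !mxE /=; ring.
  by rewrite -inu -inner_mul Tu inu.
have nz : m%:R * r ^+ 2 / 2 != 0.
  by rewrite lt0r_neq0 // divr_gt0 // mulr_gt0 ?(m_gt0 m3) // exprn_gt0 ?(radius_gt0 m3).
apply: (scalerI nz).
by rewrite scalemxAr -(Gv _ Tv0) -(Gv _ v0) -[in RHS]TG !mulmxA.
Qed.

Lemma ngon_argmax eta : exists i j k l : 'I_m, forall i' j' k' l' : 'I_m,
  `|chsh eta (@obs R (Ngon m) i') (@obs R (Ngon m) j')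
             (@obs R (Ngon m) k') (@obs R (Ngon m) l')| <=
  `|chsh eta (@obs R (Ngon m) i) (@obs R (Ngon m) j)
             (@obs R (Ngon m) k) (@obs R (Ngon m) l)|.
Proof.
pose F (p : 'I_m * 'I_m * ('I_m * 'I_m)) :=
  `|chsh eta (@obs R (Ngon m) p.1.1) (@obs R (Ngon m) p.1.2)
             (@obs R (Ngon m) p.2.1) (@obs R (Ngon m) p.2.2)|.
have i0 : 'I_m by exists 0%N; lia.
have [p pP] : exists p, forall q, F q <= F p.
  have [p _ pP] := @Order.TotalTheory.arg_maxP _ _ _ ((i0, i0), (i0, i0)) xpredT F isT.
  by exists p => q; exact: pP.
exists p.1.1, p.1.2, p.2.1, p.2.2 => i j k l.
exact: (pP ((i, j), (k, l))).
Qed.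

Lemma twist_rotation : ~~ odd m -> forall x z t : R,
  twist (Ngon m) *m vec3 (x * cos t) (x * sin t) z =
  vec3 (x * cos (t - pi / m%:R)) (x * sin (t - pi / m%:R)) z.
Proof.
move=> /negbTE hm x z t; rewrite /= hm; apply/colP => i; rewrite !mxE sum3 !mxE.
by case: (ord3 i) => -> /=; rewrite ?cosB ?sinB; ring.
Qed.

Lemma twist_orthogonal : ~~ odd m -> forall v : 'cV[R]_3,
  twist (Ngon m) *m ((twist (Ngon m))^T *m v) = v.
Proof.
move=> /negbTE hm v; rewrite mulmxA -[RHS]mul1mx; congr (_ *m _); rewrite /= hm.
have h := cos2sin2 (pi / m%:R : R).
apply/matrixP => i j; rewrite !mxE sum3 !mxE.
by case: (ord3 i) => ->; case: (ord3 j) => -> /=; ring: h.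
Qed.

Lemma obs_even (i : 'I_m) : ~~ odd m -> @obs R (Ngon m) i =
  vec3 (r * cos (theta i + pi / m%:R)) (r * sin (theta i + pi / m%:R)) 0.
Proof.
move=> /negbTE hm; rewrite /obs eff_efv // /efv /eff_gain /eff_shift hm.
by apply/colP => j; rewrite !mxE; case: (ord3 j) => -> /=; field.
Qed.

Section Even.
Variables (T eta0 : 'M[R]_3).
Hypotheses (m_even : ~~ odd m) (hT : GL (Ngon m) T)
  (hhat : is_hat eta0 (twist (Ngon m) *m T)).

(* For even n the correlation functions of eta only see the part of an effect
   orthogonal to the unit, and this part can be transported isometrically by
   the hat of eta0; hence a measurement on eta is simulated on eta0. *)
Lemma even_transfer eta a : max_tensor (Ngon m) eta -> ball (Ngon m) a ->
  exists2 a', ball (Ngon m) a' &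
    forall i : 'I_m, bil eta a (@obs R (Ngon m) i) = bil eta0 a' (@obs R (Ngon m) i).
Proof.
move=> he ha; pose v := eta^T *m a; pose F := vec3 (v o0 0) (v o1 0) 0 : 'cV[R]_3.
have Fo (i : 'I_m) : inner F (@obs R (Ngon m) i) = bil eta a (@obs R (Ngon m) i).
  rewrite bil_tr bilE -/v obs_even // (vec3_eta v) innerC !inner_vec3.
  by rewrite !mxE /=; ring.
have o2v (x : 'cV[R]_3) : x o2 0 = inner x u.
  by rewrite innerE /unit_eff !mxE /=; ring.
have twu : twist (Ngon m) *m u = u.
  have := @twist_rotation m_even 0 1 0; rewrite !mul0r; exact.
have tF : ((twist (Ngon m))^T *m F) o2 0 = 0.
  by rewrite o2v -inner_mul twu -o2v mxE.
have twF (k : 'I_m) : exists j : 'I_m,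
    inner ((twist (Ngon m))^T *m F) (om k) = inner F (@obs R (Ngon m) j).
  have [j hj] := @label_angle R m m3 (k%:Z - 1); exists j.
  have [e1 e2] := hj (pi / m%:R).
  rewrite -inner_mul omega_omv /omv twist_rotation //.
  rewrite obs_even // !inner_vec3 !mulr0 !mul0r ![theta j + _]addrC -e1 -e2.
  have -> : pi / m%:R + (k%:Z - 1)%:~R * (2 * pi / m%:R) = theta k - pi / m%:R.
    by rewrite intrB -pmulrn; ring.
  by [].
exists (T^T *m ((twist (Ngon m))^T *m F)).
  (* By [twF] the values at the vertices are correlations of [a] on [eta], hence bounded by 1. The
     twist is what turns a vertex direction into the direction of an observable. *)
  have val1 (i : 'I_m) : -1 <= inner (T^T *m ((twist (Ngon m))^T *m F)) (om i) <= 1.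
    have OT : Omega (Ngon m) (T *m om i) by apply: (GL_Omega hT); exact: Omega_omega.
    have ob (j : 'I_m) := bil_ball_norm he ha (@obs_ball R (Ngon m) (eff_effectN m3) j).
    rewrite -inner_mul; apply/andP; split.
      apply: Omega_ge OT => k; have [j ->] := twF k.
      by rewrite Fo; have := ob j; rewrite ler_norml => /andP[].
    apply: Omega_le OT => k; have [j ->] := twF k.
    by rewrite Fo; have := ob j; rewrite ler_norml => /andP[].
  split; apply: pos_omega => i; rewrite ?innerBl ?innerDl omega_u;
    by have /andP[] := val1 i; lra.
move=> i; rewrite [RHS]/bil -hhat -mulmxA (GL_orthogonal hT tF) twist_orthogonal //.
by rewrite innerC Fo.
Qed.

(** The element [a] pulled back from the vertex direction at angle [t] has correlation exactly 1
    with [obs k]. An extremal element does at least as well; it is not [u] or [- u], which have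
    correlation 0. Repeating the settings then gives 2. *)
Lemma even_ge2 : max_tensor (Ngon m) eta0 -> exists i j k l : 'I_m,
  2 <= `|chsh eta0 (@obs R (Ngon m) i) (@obs R (Ngon m) j)
                   (@obs R (Ngon m) k) (@obs R (Ngon m) l)|.
Proof.
move=> he0; have k : 'I_m by exists 0%N; lia.
pose t := theta k; pose F : 'cV[R]_3 := vec3 (r * cos t) (r * sin t) 0.
have twu : twist (Ngon m) *m u = u.
  by have := @twist_rotation m_even 0 1 0; rewrite !mul0r; exact.
have o2v (x : 'cV[R]_3) : x o2 0 = inner x u.
  by rewrite innerE /unit_eff !mxE /=; ring.
have tF : ((twist (Ngon m))^T *m F) o2 0 = 0.
  by rewrite o2v -inner_mul twu -o2v mxE.
pose a := T^T *m ((twist (Ngon m))^T *m F).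
have rc : r ^+ 2 * c = 1 := radius_sqr m3.
have r0 : 0 < r ^+ 2 by rewrite exprn_gt0 // (radius_gt0 m3).
have oa (j : 'I_m) : bil eta0 a (@obs R (Ngon m) j) =
    r ^+ 2 * cos (theta j + pi / m%:R - t).
  rewrite /bil -hhat -mulmxA (GL_orthogonal hT tF) twist_orthogonal //.
  by rewrite obs_even // inner_vec3 cosB; ring.
have ba : ball (Ngon m) a.
  have twF (j : 'I_m) : inner ((twist (Ngon m))^T *m F) (om j) =
      r ^+ 2 * cos (theta j - pi / m%:R - t).
    by rewrite -inner_mul omega_omv /omv twist_rotation // inner_vec3 (cosB _ t); ring.
  have val1 (i : 'I_m) : -1 <= inner a (om i) <= 1.
    have OT : Omega (Ngon m) (T *m om i) by apply: (GL_Omega hT); exact: Omega_omega.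
    have odd_angle (j : 'I_m) : theta j - pi / m%:R - t =
        (2 * (j%:Z - k%:Z) - 1)%:~R * pi / m%:R.
      by rewrite /t intrB intrM intrB -!pmulrn; have := @m_neq0 R m m3 => ?; field.
    rewrite -inner_mul; apply/andP; split.
      apply: Omega_ge OT => j; rewrite twF odd_angle.
      have : - c <= cos ((2 * (j%:Z - k%:Z) - 1)%:~R * pi / m%:R).
        by apply: cos_parity_le; [lia|rewrite (negbTE m_even); lia].
      by move/(ler_wpM2l (ltW r0)); rewrite mulrN rc.
    apply: Omega_le OT => j; rewrite twF odd_angle.
    have : cos ((2 * (j%:Z - k%:Z) - 1)%:~R * pi / m%:R) <= c by apply: cos_odd_le; lia.
    by move/(ler_wpM2l (ltW r0)); rewrite rc.
  split; apply: pos_omega => i; rewrite ?innerBl ?innerDl omega_u;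
    by have /andP[] := val1 i; lra.
have ak : bil eta0 a (@obs R (Ngon m) k) = 1.
  by rewrite oa -[RHS]rc; congr (_ * cos _); rewrite /t; ring.
have [x ex] := extremal_maxN m3 (eta0 *m @obs R (Ngon m) k) ba.
rewrite -!bilE ak => hx.
have uk : bil eta0 u (@obs R (Ngon m) k) = 0.
  rewrite /bil -hhat -mulmxA (GL_unitN hT) twu obs_even // /unit_eff inner_vec3; ring.
have [i hi] : exists i : 'I_m, 1 <= `|bil eta0 (@obs R (Ngon m) i) (@obs R (Ngon m) k)|.
  case: ex hx => [->|[->|[i [->|->]]]]; rewrite ?bilNl ?uk; try lra.
    by move=> h; exists i; apply: le_trans h _; exact: ler_norm.
  by move=> h; exists i; apply: le_trans h _; rewrite -normrN; exact: ler_norm.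
exists i, i, k, k; rewrite chshE; set X := bil _ _ _.
have -> : X + X + X - X = 2 * X by ring.
by rewrite normrM normr_nat; rewrite -/X in hi; lra.
Qed.

(** Only the settings of the first party are transported. They need not stay extremal, so [chsh_le]
    is applied on [eta0] itself, with its own maximum as the bound. *)
Lemma chsh_even : max_tensor (Ngon m) eta0 -> exists i j k l : 'I_m,
  2 <= `|chsh eta0 (@obs R (Ngon m) i) (@obs R (Ngon m) j)
                   (@obs R (Ngon m) k) (@obs R (Ngon m) l)| /\
  forall eta, max_tensor (Ngon m) eta -> forall i' j' k' l' : 'I_m,
  `|chsh eta (@obs R (Ngon m) i') (@obs R (Ngon m) j')
             (@obs R (Ngon m) k') (@obs R (Ngon m) l')| <=
  `|chsh eta0 (@obs R (Ngon m) i) (@obs R (Ngon m) j)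
              (@obs R (Ngon m) k) (@obs R (Ngon m) l)|.
Proof.
move=> he0; have [i [j [k [l hmax]]]] := ngon_argmax eta0.
have ge2 : 2 <= `|chsh eta0 (@obs R (Ngon m) i) (@obs R (Ngon m) j)
                   (@obs R (Ngon m) k) (@obs R (Ngon m) l)|.
  by have [i' [j' [k' [l' h]]]] := even_ge2 he0; apply: le_trans h (hmax _ _ _ _).
exists i, j, k, l; split=> // eta he i' j' k' l'.
have ob := @obs_ball R (Ngon m) (eff_effectN m3).
have [a0 b0 e0] := even_transfer he (ob i').
have [a1 b1 e1] := even_transfer he (ob j').
have -> : chsh eta (@obs R (Ngon m) i') (@obs R (Ngon m) j')
             (@obs R (Ngon m) k') (@obs R (Ngon m) l') =
  chsh eta0 a0 a1 (@obs R (Ngon m) k') (@obs R (Ngon m) l').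
  by rewrite !chshE !e0 !e1.
have H := @chsh_le R (Ngon m) (eff_effectN m3) (extremal_maxN m3) eta0 _ he0 ge2 hmax.
by apply: H => //; exact: ob.
Qed.

End Even.

End NgonSymmetry.

(** * Certificates from averaged positivity *)

Section TrigForm.
Context {R : realType} (m : nat).
Local Notation c := (cos (pi / m%:R) : R).
Local Notation theta i := (2 * pi * i%:R / m%:R : R).
Implicit Types (al be x y t : R).

(* Fourier coefficients of the values of a state on the pairs of directions
   (al, be): the local terms of each side, and the two modes in the difference
   and in the sum of the angles. *)
Record form := Form { fP1 : R; fP2 : R; fQ1 : R; fQ2 : R;
                      fM1 : R; fM2 : R; fN1 : R; fN2 : R }.
Implicit Types f : form.

Definition fP f al := fP1 f * cos al + fP2 f * sin al.
Definition fQ f be := fQ1 f * cos be + fQ2 f * sin be.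
Definition fX f al be := fM1 f * cos (al - be) + fM2 f * sin (al - be) +
  fN1 f * cos (al + be) + fN2 f * sin (al + be).
(** Up to the factor r^2 this is the value of a state on the vertex vectors at angles [al] and [be];
    the constant [c] is r^-2 (see [bil_omv]). *)
Definition fL f al be := c + fP f al + fQ f be + fX f al be.

Definition lattice t := exists z : int, t = z%:~R * (2 * pi / m%:R).

Definition positive_form f := forall al be, lattice al -> lattice be -> 0 <= fL f al be.

Lemma lattice_theta k : lattice (theta k).
Proof. by exists k%:Z; rewrite -pmulrn; ring. Qed.

Lemma latticeD x y : lattice x -> lattice y -> lattice (x + y).
Proof. by move=> [z ->] [z' ->]; exists (z + z'); rewrite intrD; ring. Qed.

Lemma latticeN x : lattice x -> lattice (- x).
Proof. by move=> [z ->]; exists (- z); rewrite intrN; ring. Qed.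

Lemma lattice_sign (b : bool) t : lattice t -> lattice ((-1) ^+ b * t).
Proof. by case: b => lt; rewrite ?expr1 ?expr0 ?mulN1r ?mul1r //; exact: latticeN. Qed.

Definition shiftA f x := Form (fP1 f * cos x + fP2 f * sin x) (fP2 f * cos x - fP1 f * sin x)
  (fQ1 f) (fQ2 f) (fM1 f * cos x + fM2 f * sin x) (fM2 f * cos x - fM1 f * sin x)
  (fN1 f * cos x + fN2 f * sin x) (fN2 f * cos x - fN1 f * sin x).

Lemma shiftAE f x al be : [/\ fP (shiftA f x) al = fP f (x + al),
  fQ (shiftA f x) be = fQ f be & fX (shiftA f x) al be = fX f (x + al) be].
Proof.
have e1 : x + al - be = x + (al - be) by ring.
have e2 : x + al + be = x + (al + be) by ring.
by rewrite /fP /fQ /fX e1 e2 !(cosD x) !(sinD x) /=; split => //; ring.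
Qed.

Definition swap f := Form (fQ1 f) (fQ2 f) (fP1 f) (fP2 f) (fM1 f) (- fM2 f) (fN1 f) (fN2 f).

Lemma swapE f al be : [/\ fP (swap f) al = fQ f al,
  fQ (swap f) be = fP f be & fX (swap f) al be = fX f be al].
Proof.
by rewrite /fP /fQ /fX /= -(opprB be al) cosN sinN (addrC be al); split => //; ring.
Qed.

Definition reflA f := Form (fP1 f) (- fP2 f) (fQ1 f) (fQ2 f)
  (fN1 f) (- fN2 f) (fM1 f) (- fM2 f).

Lemma reflAE f al be : [/\ fP (reflA f) al = fP f (- al),
  fQ (reflA f) be = fQ f be & fX (reflA f) al be = fX f (- al) be].
Proof.
have e1 : - al - be = - (al + be) by ring.
have e2 : - al + be = - (al - be) by ring.
by rewrite /fP /fQ /fX e1 e2 !cosN !sinN /=; split => //; ring.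
Qed.

Lemma relabelA f x (b : bool) : lattice x -> positive_form f -> exists2 f',
  positive_form f' & forall al be, [/\ fP f' al = fP f (x + (-1) ^+ b * al),
  fQ f' be = fQ f be & fX f' al be = fX f (x + (-1) ^+ b * al) be].
Proof.
move=> lx pf; pose f' := if b then reflA (shiftA f x) else shiftA f x.
have f'E al be : [/\ fP f' al = fP f (x + (-1) ^+ b * al),
  fQ f' be = fQ f be & fX f' al be = fX f (x + (-1) ^+ b * al) be].
  rewrite /f'; case: (b); last by rewrite expr0 mul1r; exact: shiftAE.
  have [-> -> ->] := reflAE (shiftA f x) al be.
  by rewrite expr1 mulN1r; exact: shiftAE.
exists f' => // al be la lb; rewrite /fL; have [-> -> ->] := f'E al be.
by apply: pf => //; apply: latticeD => //; exact: lattice_sign.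
Qed.

Lemma relabel f x y (b b' : bool) : lattice x -> lattice y -> positive_form f -> exists2 f',
  positive_form f' & forall al be,
  [/\ fP f' al = fP f (x + (-1) ^+ b * al),
      fQ f' be = fQ f (y + (-1) ^+ b' * be) &
      fX f' al be = fX f (x + (-1) ^+ b * al) (y + (-1) ^+ b' * be)].
Proof.
move=> lx ly pf; have [f1 pf1 f1E] := relabelA b lx pf.
have ps g : positive_form g -> positive_form (swap g).
  move=> pg al be la lb; rewrite /fL; have [-> -> ->] := swapE g al be.
  by have := pg be al lb la; rewrite /fL; lra.
have [f2 pf2 f2E] := relabelA b' ly (ps _ pf1).
exists (swap f2); first exact: ps.
move=> al be; have [-> -> ->] := swapE f2 al be.
have [-> -> ->] := f2E be al.
have [-> -> ->] := swapE f1 (y + (-1) ^+ b' * be) al.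
by have [] := f1E al (y + (-1) ^+ b' * be).
Qed.

Hypothesis m5 : (5 <= m)%N.

Lemma mean0 (k : nat) x : (0 < k < 5)%N -> \sum_(j < m) cos (k%:R * theta j + x) = 0.
Proof. by move=> hk; apply: sum_cosN; lia. Qed.

Lemma mean0s (k : nat) x : (0 < k < 5)%N -> \sum_(j < m) sin (k%:R * theta j + x) = 0.
Proof. by move=> hk; apply: sum_sinN; lia. Qed.

(* The density w has Fourier modes of order at most two and f has modes of order
   at most two along a shifted diagonal; their product is integrated exactly by m > 4
   equidistributed points. *)
Lemma averaged_positivity f chi (W F1 F2 Z1 Z2 : R) : lattice chi -> positive_form f ->
  (forall be, 0 <= W + 2 * (F1 * cos be + F2 * sin be) +
              2 * (Z1 * cos (2 * be) + Z2 * sin (2 * be))) ->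
  0 <= W * (c + fM1 f * cos chi + fM2 f * sin chi) +
    (fP1 f * (F1 * cos chi - F2 * sin chi) + fP2 f * (F1 * sin chi + F2 * cos chi)) +
    (fQ1 f * F1 + fQ2 f * F2) +
    (fN1 f * (Z1 * cos chi - Z2 * sin chi) + fN2 f * (Z1 * sin chi + Z2 * cos chi)).
Proof.
move=> lchi pf w0; set goal := (X in 0 <= X).
suff : 0 <= m%:R * goal by rewrite pmulr_rge0 // ltr0n; lia.
pose w be := W + 2 * (F1 * cos be + F2 * sin be) + 2 * (Z1 * cos (2 * be) + Z2 * sin (2 * be)).
have -> : m%:R * goal = \sum_(j < m) w (theta j) * fL f (theta j + chi) (theta j); last first.
  apply: sumr_ge0 => j _; apply: mulr_ge0; first exact: w0.
  by apply: pf; [apply: latticeD|]; rewrite ?lattice_theta //; exact: lattice_theta.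
(* Fourier coefficients of [fL] along the diagonal of pairs (be + chi, be). *)
set A1 := fP1 f * cos chi + fP2 f * sin chi + fQ1 f.
set B1 := fP2 f * cos chi - fP1 f * sin chi + fQ2 f.
set A2 := fN1 f * cos chi + fN2 f * sin chi.
set B2 := fN2 f * cos chi - fN1 f * sin chi.
set A0 := c + fM1 f * cos chi + fM2 f * sin chi.
have Lx x : fL f (x + chi) x = A0 + A1 * cos x + B1 * sin x + A2 * cos (2 * x) + B2 * sin (2 * x).
  rewrite /fL /fP /fQ /fX (_ : x + chi - x = chi); last by ring.
  rewrite (_ : x + chi + x = chi + 2 * x); last by ring.
  rewrite (addrC x chi).
  by rewrite !(cosD chi) !(sinD chi) /A0 /A1 /B1 /A2 /B2; ring.
have prod x : w x * fL f (x + chi) x = goal +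
   ((W * A1 + 2 * F1 * A0 + (F1 * A2 + F2 * B2) + (Z1 * A1 + Z2 * B1)) * cos (1%:R * x + 0) +
    (W * B1 + 2 * F2 * A0 + (F1 * B2 - F2 * A2) + (Z2 * A1 - Z1 * B1)) * sin (1%:R * x + 0) +
    (W * A2 + 2 * Z1 * A0 + (F1 * A1 - F2 * B1)) * cos (2%:R * x + 0) +
    (W * B2 + 2 * Z2 * A0 + (F1 * B1 + F2 * A1)) * sin (2%:R * x + 0) +
    ((F1 * A2 - F2 * B2) + (Z1 * A1 - Z2 * B1)) * cos (3%:R * x + 0) +
    ((F1 * B2 + F2 * A2) + (Z2 * A1 + Z1 * B1)) * sin (3%:R * x + 0) +
    (Z1 * A2 - Z2 * B2) * cos (4%:R * x + 0) +
    (Z2 * A2 + Z1 * B2) * sin (4%:R * x + 0)).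
  have -> : goal = W * A0 + F1 * A1 + F2 * B1 + Z1 * A2 + Z2 * B2.
    by rewrite /goal /A0 /A1 /B1 /A2 /B2; ring.
  rewrite Lx /w !addr0 mul1r.
  have -> : 4%:R * x = 2 * x + 2 * x by ring.
  have -> : 3%:R * x = 2 * x + x by ring.
  rewrite !(cosD (2 * x)) !(sinD (2 * x)) (_ : 2 * x = x + x); last by ring.
  rewrite cosD sinD; move: A0 A1 B1 A2 B2 (cos2sin2 x) {Lx goal} => A0 A1 B1 A2 B2.
  by move: (cos x) (sin x) => C S h; ring: h.
clearbody goal; under eq_bigr do rewrite prod.
rewrite !big_split /= -!mulr_sumr !mean0 // !mean0s // !mulr0 !addr0.
by rewrite sumr_const card_ord mulr_natl.
Qed.

Lemma harmonic_ge (F1 F2 B x : R) : 0 <= B -> F1 ^+ 2 + F2 ^+ 2 <= B ^+ 2 ->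
  - B <= F1 * cos x + F2 * sin x.
Proof.
move=> B0 h; rewrite lerNl; have [/ltW|l0] := ltP (- (F1 * cos x + F2 * sin x)) 0.
  by move=> /le_trans; apply.
rewrite -(@ler_pXn2r _ 2) ?nnegrE // (le_trans _ h) //.
have -> : F1 ^+ 2 + F2 ^+ 2 = (- (F1 * cos x + F2 * sin x)) ^+ 2 + (F1 * sin x - F2 * cos x) ^+ 2.
  by have := cos2sin2 x => e; ring: e.
by rewrite lerDl sqr_ge0.
Qed.

(** [B] and [B'] bound the amplitudes of the two harmonics, so the last condition keeps the density
    nonnegative. *)
Lemma averaged_positivity_bound f chi (W F1 F2 Z1 Z2 B B' : R) :
  lattice chi -> positive_form f -> 0 <= B -> 0 <= B' ->
  F1 ^+ 2 + F2 ^+ 2 <= B ^+ 2 -> Z1 ^+ 2 + Z2 ^+ 2 <= B' ^+ 2 -> 2 * B + 2 * B' <= W ->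
  0 <= W * (c + fM1 f * cos chi + fM2 f * sin chi) +
    (fP1 f * (F1 * cos chi - F2 * sin chi) + fP2 f * (F1 * sin chi + F2 * cos chi)) +
    (fQ1 f * F1 + fQ2 f * F2) +
    (fN1 f * (Z1 * cos chi - Z2 * sin chi) + fN2 f * (Z1 * sin chi + Z2 * cos chi)).
Proof.
move=> lchi pf B0 B0' hF hZ hW; apply: averaged_positivity => // be.
have := harmonic_ge be B0 hF; have := harmonic_ge (2 * be) B0' hZ; lra.
Qed.

(** CHSH of the two-sided term at the standard settings: the three pairs counted positively differ
    by s up to sign, the negative one by 3 s. *)
Definition corner f s := fX f 0 s + fX f 0 (- s) + fX f (2 * s) s - fX f (2 * s) (- s).

Lemma cornerE f s : corner f s =
  fM1 f * (3 * cos s - cos (3 * s)) + fM2 f * (sin s - sin (3 * s)) +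
  fN1 f * (cos s + cos (3 * s)) + fN2 f * (sin (3 * s) - sin s).
Proof.
rewrite /corner /fX.
have e1 : 2 * s + s = 3 * s by ring.
have e2 : 2 * s - s = s by ring.
rewrite opprK e1 e2.
by rewrite !sub0r !add0r cosN sinN; ring.
Qed.

End TrigForm.

(** Provides the common factor of the first harmonics of the densities, with the defect as [D] and
    sin p as [x]. *)
Lemma half_gain (R : realType) (D x o : R) : x != 0 -> o ^+ 2 = 1 ->
  exists2 k, k ^+ 2 * 4 = (D / x) ^+ 2 & D = 2 * k * o * x.
Proof.
move=> x0 o2; exists (o * D / (2 * x)).
  have -> : (o * D / (2 * x)) ^+ 2 * 4 = o ^+ 2 * (D / x) ^+ 2 by field.
  by rewrite o2 mul1r.
have -> : 2 * (o * D / (2 * x)) * o * x = o ^+ 2 * D by field.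
by rewrite o2 mul1r.
Qed.

(** * The two certificates at the optimal direction *)

Section Certificates.
Context {R : realType} (m : nat).
Local Notation p := (pi / m%:R : R).
Local Notation h := (pi / (2 * m%:R) : R).
Local Notation c := (cos p).
Local Notation defect := ((1 - c) / c : R).
Hypotheses (m5 : (5 <= m)%N) (m_odd : odd m).

Let m3 : (3 <= m)%N. Proof. by lia. Qed.

Lemma p_double : p = h *+ 2.
Proof. by rewrite -mulr_natl; have := @m_neq0 R m m3 => ?; field. Qed.

Lemma sin_p : sin p = 2 * sin h * cos h.
Proof. by rewrite p_double sin_mulr2n; ring. Qed.

Lemma h_bounds : 0 < h /\ h < pi / 4.
Proof.
have m0 := @m_gt0 R m m3; have p0 := @pi_gt0 R.
split; first by rewrite divr_gt0 // mulr_gt0.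
by rewrite ltr_pM2l // ltf_pV2 ?posrE ?mulr_gt0 // -natrM ltr_nat; lia.
Qed.

Lemma sin_h_gt0 : 0 < sin h.
Proof. by have [h0 h1] := h_bounds; have := @pi_gt0 R => ?; apply: sin_gt0_pihalf; lra. Qed.

Lemma cos_h_gt0 : 0 < cos h.
Proof. by have [h0 h1] := h_bounds; have := @pi_gt0 R => ?; apply: cos_gt0_pihalf; lra. Qed.

Lemma lattice_pi (o : R) : o = 1 \/ o = - 1 -> lattice m (pi + o * p).
Proof.
have mn := @m_neq0 R m m3.
have half (k : nat) : (k.*2)%:R = 2 * k%:R :> R by rewrite -mul2n natrM.
case=> ->.
- exists (uphalf m)%:Z; rewrite -pmulrn.
  have e : 2 * (uphalf m)%:R = m%:R + 1 :> R by rewrite -half natr1; congr (_%:R); lia.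
  have -> : (uphalf m)%:R * (2 * pi / m%:R) = (2 * (uphalf m)%:R) * (pi / m%:R) :> R by ring.
  by rewrite e; field.
- exists (m./2)%:Z; rewrite -pmulrn.
  have e : 2 * (m./2)%:R = m%:R - 1 :> R.
    by apply/eqP; rewrite eq_sym subr_eq -half natr1; apply/eqP; congr (_%:R); lia.
  have -> : (m./2)%:R * (2 * pi / m%:R) = (2 * (m./2)%:R) * (pi / m%:R) :> R by ring.
  by rewrite e; field.
Qed.

Lemma lattice_2p (o : R) : o = 1 \/ o = - 1 -> lattice m (o * (2 * p)).
Proof. by case=> ->; [exists 1|exists (- 1)]; rewrite ?mul1r ?mulN1r ?intrN; ring. Qed.

Lemma lattice0 : lattice m (0 : R).
Proof. by exists 0; rewrite mul0r. Qed.

Variables (s o sg : R).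
Hypotheses (ho : o = 1 \/ o = - 1) (hsg : sg = 1 \/ sg = - 1).
Hypothesis s_def : s *+ 2 = pi / 2 + o * h.

(** The value of [corner] for the identity, whose form has [fM1] equal to 1 and all other
    coefficients 0. *)
Definition steps : R := 3 * cos s - cos (3 * s).

Let osq : o ^+ 2 = 1. Proof. by case: ho => ->; ring. Qed.
Let sgsq : sg ^+ 2 = 1. Proof. by case: hsg => ->; ring. Qed.

Lemma sin_sign x : sin (o * x) = o * sin x.
Proof. by case: ho => ->; rewrite ?mul1r // !mulN1r sinN. Qed.

Lemma cos_sign x : cos (o * x) = cos x.
Proof. by case: ho => ->; rewrite ?mul1r // mulN1r cosN. Qed.

Lemma cos2s : cos (s *+ 2) = - (o * sin h).
Proof. by rewrite s_def addrC cosDpihalf sin_sign. Qed.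

Lemma sin3s : sin (3 * s) = sin s - 2 * o * sin h * sin s.
Proof.
have -> : 3 * s = s *+ 2 + s by rewrite mulr2n; ring.
rewrite sinD cos2s sin_mulr2n; have := cos2s; rewrite cos_mulr2n mulr2n => e.
have -> : (cos s * sin s) *+ 2 * cos s = (2 * cos s ^+ 2) * sin s by rewrite mulr2n; ring.
have -> : 2 * cos s ^+ 2 = 1 - o * sin h by lra.
ring.
Qed.

Lemma cos3s : cos (3 * s) = - cos s - 2 * o * sin h * cos s.
Proof.
have -> : 3 * s = s *+ 2 + s by rewrite mulr2n; ring.
rewrite cosD cos2s sin_mulr2n; have := cos2s; rewrite cos_mulr2n mulr2n => e.
have -> : (cos s * sin s) *+ 2 * sin s = (2 * sin s ^+ 2) * cos s by rewrite mulr2n; ring.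
have -> : 2 * sin s ^+ 2 = 1 + o * sin h by rewrite sin2cos2; lra.
ring.
Qed.

(** Because 2 s is a quarter turn up to h, every coefficient besides [fM1] carries the small factor
    sin h. *)
Lemma corner_steps f : corner f s = fM1 f * steps + fM2 f * (2 * o * sin h * sin s) -
  fN1 f * (2 * o * sin h * cos s) - fN2 f * (2 * o * sin h * sin s).
Proof. by rewrite cornerE /steps sin3s cos3s; ring. Qed.

Let c0 : 0 < c. Proof. exact: c_gt0. Qed.
Let sp0 : 0 < sin p. Proof. exact: s_gt0. Qed.

Lemma defect_ge0 : 0 <= defect.
Proof. by rewrite divr_ge0 ?subr_ge0 ?cos_le1 // ltW. Qed.

(* Optimality of the identity: at the identity the pairs at angle [pi + p] and
   [pi - p] are the ones where the form vanishes, so the certificate is carried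
   by these two families. *)
Lemma aligned_bound f : positive_form m f ->
  2 * (defect / sin p) + 2 * (2 * sin h) <= (steps / c + sin s / cos h) / 2 ->
  2 * (defect / sin p) <= (steps / c - sin s / cos h) / 2 ->
  corner f s - defect * (sg * fP f 0 + fQ f s) <= steps.
Proof.
move=> pf hW1 hW2.
have D0 := defect_ge0; have sh0 := sin_h_gt0; have ch0 := cos_h_gt0.
set D := defect in hW1 hW2 D0 *.
(* The constant term and [fM1] force c (W1 + W2) = steps; [fM2] forces sin p (W1 - W2) = 2 sin h sin
   s. *)
set W1 := _ / 2 in hW1; set W2 := _ / 2 in hW2.
have [k kk eD] := half_gain D (lt0r_neq0 sp0) osq.
have ho' : - o = 1 \/ - o = - 1 by case: ho => ->; rewrite ?opprK; [right|left].
have B0 : 0 <= D / sin p by rewrite divr_ge0 // ltW.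
have circ t : (k * sin t) ^+ 2 + (k * (sg + cos t)) ^+ 2 <= (D / sin p) ^+ 2.
  rewrite -kk !exprMn -mulrDr; apply: ler_wpM2l; first exact: sqr_ge0.
  have := cos2Dsin2 t; have := cos_le1 t; have := cos_geN1 t.
  by case: hsg => -> h1 h2 h3; nra.
have F1b : (- (k * sin (s - o * p))) ^+ 2 + (k * (sg + cos (s - o * p))) ^+ 2 <= (D / sin p) ^+ 2.
  by rewrite sqrrN.
have F2b : (k * sin (s + o * p)) ^+ 2 + (- (k * (sg + cos (s + o * p)))) ^+ 2 <= (D / sin p) ^+ 2.
  by rewrite sqrrN.
pose chi := pi + o * p.
(* The second harmonic, which matches the terms in [fN1] and [fN2], is put entirely on the family
   [chi]; the first harmonics of both families together match the local terms. *)
have Zb : (2 * o * sin h * cos (s - chi)) ^+ 2 + (2 * o * sin h * sin (s - chi)) ^+ 2 <=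
    (2 * sin h) ^+ 2.
  move: (s - chi) => t; rewrite (_ : _ + _ = o ^+ 2 * (2 * sin h) ^+ 2 *
    (cos t ^+ 2 + sin t ^+ 2)); last by ring.
  by rewrite osq cos2Dsin2 mul1r mulr1.
have s2 : 0 <= 2 * sin h by lra.
have Z0b : (0 : R) ^+ 2 + 0 ^+ 2 <= 0 ^+ 2 by rewrite expr0n /= addr0.
have hW2' : 2 * (D / sin p) + 2 * 0 <= W2 by rewrite mulr0 addr0.
have q1 := averaged_positivity_bound m5 (lattice_pi ho) pf B0 s2 F1b Zb hW1.
have q2 := averaged_positivity_bound m5 (lattice_pi ho') pf B0 (lexx 0) F2b Z0b hW2'.
have eS : steps = c * (W1 + W2) by rewrite /W1 /W2; field; rewrite !lt0r_neq0.
have eW : sin p * W1 = sin p * W2 + 2 * sin h * sin s.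
  by rewrite sin_p /W1 /W2; field; rewrite !lt0r_neq0.
rewrite -subr_ge0 corner_steps /fP /fQ cos0 sin0 eD eS.
move: (addr_ge0 q1 q2) => {q1 q2}.
have cchi : cos chi = - c by rewrite /chi addrC cosDpi cos_sign.
have schi : sin chi = - (o * sin p) by rewrite /chi addrC sinDpi sin_sign.
have cchi' : cos (pi + - o * p) = - c by rewrite addrC mulNr cosDpi cosN cos_sign.
have schi' : sin (pi + - o * p) = o * sin p.
  by rewrite addrC mulNr sinDpi sinN sin_sign opprK.
rewrite -/chi cchi' schi' !(cosB s) !(sinB s) !(cosD s) !(sinD s) cchi schi.
rewrite !cos_sign !sin_sign.
have := cos2sin2 p => hc.
congr (0 <= _); ring: hc eW osq.
Qed.

(** For the families at angles 0 and 2 o p, comparing [fM2] fixes the weight at 2 o p, and comparing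
    [fM1] then fixes the weight at 0. *)
Definition far_weight : R := sin h * sin s / (sin p * c).
Definition near_weight : R := steps - far_weight * (1 - 2 * sin p ^+ 2).

(* Minus the form is maximal at the two rotations by [0] and [2 * p], where the
   families of pairs at angles [0] and [2 * p] play the role of the families in
   [aligned_bound]. *)
Lemma opposed_bound f B : positive_form m f -> 0 <= B ->
  (defect / sin p) ^+ 2 * (1 - sg * cos s) <= 2 * B ^+ 2 ->
  2 * B <= far_weight -> 2 * (defect / sin p) + 2 * (2 * sin h) <= near_weight ->
  defect * (sg * fP f 0 + fQ f s) - corner f s <= c * (near_weight + far_weight).
Proof.
move=> pf B0 hB hW1 hW0.
have D0 := defect_ge0; have sh0 := sin_h_gt0.
set D := defect in hB hW0 D0 *.
have [k kk eD] := half_gain D (lt0r_neq0 sp0) osq.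
have B1 : 0 <= D / sin p by rewrite divr_ge0 // ltW.
have circ t t' : (sin t + sg * sin t') ^+ 2 + (cos t - sg * cos t') ^+ 2 =
    2 * (1 - sg * cos (t + t')).
  rewrite cosD; have := cos2sin2 t => h1; have := cos2sin2 t' => h2.
  by ring: h1 h2 sgsq.
have F1b : (k * (sin (s - o * p) + sg * sin (o * p))) ^+ 2 +
    (- (k * (cos (s - o * p) - sg * cos (o * p)))) ^+ 2 <= B ^+ 2.
  rewrite sqrrN !exprMn -mulrDr circ subrK mulrA.
  have -> : k ^+ 2 * 2 = (D / sin p) ^+ 2 / 2 by rewrite -kk; field.
  by lra.
have F0b : (- (k * (sin (s + o * p) + sg * sin (o * p)))) ^+ 2 +
    (k * (cos (s + o * p) - sg * cos (o * p))) ^+ 2 <= (D / sin p) ^+ 2.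
  rewrite sqrrN -kk !exprMn -mulrDr circ; apply: ler_wpM2l; first exact: sqr_ge0.
  have := cos_le1 (s + o * p + o * p); have := cos_geN1 (s + o * p + o * p).
  by case: hsg => -> h1 h2; lra.
have Zb : (- (2 * o * sin h * cos s)) ^+ 2 + (- (2 * o * sin h * sin s)) ^+ 2 <= (2 * sin h) ^+ 2.
  rewrite (_ : _ + _ = o ^+ 2 * (2 * sin h) ^+ 2 * (cos s ^+ 2 + sin s ^+ 2)); last by ring.
  by rewrite osq cos2Dsin2 mul1r mulr1.
have s2 : 0 <= 2 * sin h by lra.
have Z0b : (0 : R) ^+ 2 + 0 ^+ 2 <= 0 ^+ 2 by rewrite expr0n /= addr0.
have hW1' : 2 * B + 2 * 0 <= far_weight by rewrite mulr0 addr0.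
have q0 := averaged_positivity_bound m5 lattice0 pf B1 s2 F0b Zb hW0.
have q1 := averaged_positivity_bound m5 (lattice_2p ho) pf B0 (lexx 0) F1b Z0b hW1'.
have eW : far_weight * sin p * c = sin h * sin s.
  by rewrite /far_weight; field; rewrite !lt0r_neq0.
rewrite -subr_ge0 corner_steps /fP /fQ cos0 sin0 eD.
have := addr_ge0 q0 q1; rewrite !cos0 !sin0 => {q0 q1}.
have c2p : cos (o * (2 * p)) = 1 - 2 * sin p ^+ 2.
  by rewrite cos_sign (mulr_natl p 2) cos_mulr2n cos2sin2 mulr2n; ring.
have s2p : sin (o * (2 * p)) = o * (2 * sin p * c).
  by rewrite sin_sign (mulr_natl p 2) sin_mulr2n mulr2n; ring.
rewrite c2p s2p !(cosB s) !(sinB s) !(cosD s) !(sinD s).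
rewrite !cos_sign !sin_sign /near_weight.
have := cos2sin2 p => hc.
congr (0 <= _); ring: hc eW osq.
Qed.

End Certificates.

(** * Numerical estimates *)

Section TrigBounds.
Context {R : realType}.
Implicit Types x : R.

(** Iterated below, starting from cos <= 1, this yields the Taylor bounds one degree at a time. *)
Lemma deriv_ge0 (f df : R -> R) : (forall x, is_derive x 1 f (df x)) -> f 0 = 0 ->
  (forall x, 0 <= x -> 0 <= df x) -> forall x, 0 <= x -> 0 <= f x.
Proof.
move=> hf f0 df0 x x0.
have cf : {within `[0, x], continuous f}.
  apply: continuous_subspaceT => y; apply: differentiable_continuous.
  by apply/derivable1_diffP; have [] := hf y.
have [y] := MVT_segment x0 (fun y _ => hf y) cf.
rewrite in_itv /= f0 !subr0 => /andP[y0 _] ->.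
by rewrite mulr_ge0 // df0.
Qed.

Lemma sin_le_id x : 0 <= x -> sin x <= x.
Proof.
move=> x0; rewrite -subr_ge0.
apply: (@deriv_ge0 (fun x => x - sin x) (fun x => 1 - cos x)) => //.
by rewrite sin0 subrr.
Qed.

Lemma cos_ge2 x : 0 <= x -> 1 - x ^+ 2 / 2 <= cos x.
Proof.
move=> x0; rewrite -subr_ge0.
apply: (@deriv_ge0 (fun x => cos x - (1 - x ^+ 2 / 2)) (fun x => x - sin x)) => //.
- move=> y; apply: is_derive_eq; rewrite /GRing.scale /= ?mulr1; by field.
- by rewrite cos0; field.
- by move=> y y0; rewrite subr_ge0 sin_le_id.
Qed.

Lemma sin_ge3 x : 0 <= x -> x - x ^+ 3 / 6 <= sin x.
Proof.
move=> x0; rewrite -subr_ge0.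
apply: (@deriv_ge0 (fun x => sin x - (x - x ^+ 3 / 6)) (fun x => cos x - (1 - x ^+ 2 / 2))) => //.
- move=> y; apply: is_derive_eq; rewrite /GRing.scale /= ?mulr1; by field.
- by rewrite sin0; field.
- by move=> y y0; rewrite subr_ge0 cos_ge2.
Qed.

Lemma cos_le4 x : 0 <= x -> cos x <= 1 - x ^+ 2 / 2 + x ^+ 4 / 24.
Proof.
move=> x0; rewrite -subr_ge0.
apply: (@deriv_ge0 (fun x => 1 - x ^+ 2 / 2 + x ^+ 4 / 24 - cos x)
  (fun x => sin x - (x - x ^+ 3 / 6))) => //.
- move=> y; apply: is_derive_eq; rewrite /GRing.scale /= ?mulr1; by field.
- by rewrite cos0; field.
- by move=> y y0; rewrite subr_ge0 sin_ge3.
Qed.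

(** The Taylor upper bound of cos is already negative at 8 / 5. *)
Lemma pi_lt : pi < 16 / 5 :> R.
Proof.
rewrite ltNge; apply/negP => h.
have : 0 <= cos (8 / 5 : R) by apply: cos_ge0_pihalf; apply/andP; split; lra.
have h0 : 0 <= 8 / 5 :> R by lra.
by have := cos_le4 h0; lra.
Qed.

End TrigBounds.

(** * Polynomial estimates in b = sin(pi / (4 m)), a = cos(pi / (4 m)); b <= 4 / 35 stands for m >=
    7 and b <= 4 / 45 for m >= 9 *)

Section Numeric.
Context {R : realType}.
Implicit Types a b x tau : R.

Lemma le_of_sqr x y : 0 <= y -> x ^+ 2 <= y ^+ 2 -> x <= y.
Proof.
move=> y0 h; have [x0|/ltW x0] := leP 0 x; last exact: le_trans x0 y0.
by rewrite -(@ler_pXn2r _ 2) ?nnegrE.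
Qed.

Lemma ltrM2 x y : 0 <= x -> x <= y -> x ^+ 2 <= y ^+ 2.
Proof. by move=> x0 xy; rewrite !expr2; apply: ler_pM. Qed.

Lemma circle_bounds a b (B : R) : 0 <= b -> b <= B -> B <= 1 / 8 -> 0 <= a ->
  a ^+ 2 = 1 - b ^+ 2 -> [/\ b ^+ 2 <= B ^+ 2, a <= 1 & 1 - b ^+ 2 / 2 - b ^+ 4 / 7 <= a].
Proof.
move=> b0 bB B2 a0 ha; have hb := ltrM2 b0 bB.
have b2 : 0 <= b ^+ 2 by exact: sqr_ge0.
have q : b ^+ 2 <= 1 / 64.
  by have := ltrM2 b0 (le_trans bB B2); lra.
split=> //; first by apply: le_of_sqr => //; rewrite ha; lra.
apply: le_of_sqr => //; rewrite ha (_ : b ^+ 4 = (b ^+ 2) ^+ 2); last by ring.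
move: (b ^+ 2) b2 q => x x0 x1.
have x2 : x * x <= x * (1 / 64) by rewrite ler_wpM2l.
have x3 : x * x * x <= x * x * (1 / 64) by rewrite ler_wpM2l ?mulr_ge0.
have x4 : x * x * x * x <= x * x * x * (1 / 64) by rewrite ler_wpM2l ?mulr_ge0.
have x2' : 0 <= x * x by rewrite mulr_ge0.
lra.
Qed.

Lemma tau_facts b tau : 0 < b -> b <= 4 / 35 ->
  tau <= 4 * b ^+ 2 * (1 + 10 / 3 * b ^+ 2) -> 4 * b ^+ 2 <= tau ->
  [/\ b ^+ 2 <= 1 / 76, tau <= 21 / 5 * b ^+ 2, tau <= 1 / 18 &
      tau ^+ 2 <= 18 * b ^+ 4].
Proof.
move=> b0 b1; have := ltrM2 (ltW b0) b1.
rewrite (_ : b ^+ 4 = b ^+ 2 * b ^+ 2); last by ring.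
have : 0 < b ^+ 2 by rewrite exprn_gt0.
clear b0 b1; move: (b ^+ 2) => x x0 x1' t2 t1.
have x1 : x <= 1 / 76 by lra.
have xx : x * x <= x * (1 / 76) by rewrite ler_pM2l.
have t3 : tau <= 21 / 5 * x by lra.
have t0 : 0 <= tau by lra.
have tt := ltrM2 t0 t3.
have : 0 <= x * x by rewrite mulr_ge0 ?ltW.
clear t2 t1 x1'; split=> //; lra.
Qed.

Lemma poly_corr a b tau E : 0 < b -> b <= 4 / 35 -> 75 / 76 <= a ->
  b ^+ 2 <= 1 / 76 -> 0 <= tau -> tau <= 1 / 18 -> tau ^+ 2 <= 18 * b ^+ 4 ->
  E * (4 * a * b * (1 - 2 * b ^+ 2)) = tau ^+ 2 * (1 + tau) -> E <= 5 * b ^+ 3.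
Proof.
move=> b0 b1 a1 x1 t0 t4 tt hE.
have u1 : 37 / 38 <= 1 - 2 * b ^+ 2 by clear hE tt; lra.
rewrite -(ler_pM2r (_ : 0 < 4 * a * b * (1 - 2 * b ^+ 2))); last first.
  have u0 : 0 < 1 - 2 * b ^+ 2 by clear hE tt; lra.
  by rewrite !mulr_gt0 //; clear hE tt; lra.
have b4 : 0 < b ^+ 4 by rewrite exprn_gt0.
rewrite hE; clear hE; apply: (@le_trans _ _ (18 * b ^+ 4 * (19 / 18))).
  by apply: ler_pM => //; [exact: sqr_ge0| |]; clear tt b4; lra.
have -> : 5 * b ^+ 3 * (4 * a * b * (1 - 2 * b ^+ 2)) =
  b ^+ 4 * (5 * 4 * (a * (1 - 2 * b ^+ 2))) by ring.
rewrite -mulrA mulrCA ler_pM2l //.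
have : 75 / 76 * (37 / 38) <= a * (1 - 2 * b ^+ 2) by apply: ler_pM => //; lra.
move: (a * _) => z; clear; lra.
Qed.

(** The case of a direction below d0. The coefficients 17/6 and 17/12 become at least 4 and 2 after
    multiplication by 2 cos(pi / 4) >= 24/17, as used in [weighted_le]. The gap of order b^2 between
    the two sides absorbs terms of order b^3 and b^4. *)
Lemma poly_near_left a b tau E : 0 < b -> b <= 4 / 35 -> 0 <= a -> a ^+ 2 = 1 - b ^+ 2 ->
  4 * b ^+ 2 <= tau -> tau <= 4 * b ^+ 2 * (1 + 10 / 3 * b ^+ 2) ->
  E * (4 * a * b * (1 - 2 * b ^+ 2)) = tau ^+ 2 * (1 + tau) ->
  (2 + tau) * (a * (1 - 4 * b ^+ 2)) - tau * (b * (3 - 4 * b ^+ 2)) + 17 / 6 * E +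
     17 / 12 * tau ^+ 2 <= 2 * (1 - tau ^+ 2) * (a * (1 - b ^+ 2) - b ^+ 3).
Proof.
move=> b0 b1 a0 ha t1 t2 hE.
have x0 : 0 < b ^+ 2 by rewrite exprn_gt0.
have b4 : 0 < b ^+ 4 by rewrite exprn_gt0.
have b3 : 0 < b ^+ 3 by rewrite exprn_gt0.
have B2 : 4 / 35 <= 1 / 8 :> R by clear; lra.
have [x1' a2 a1'] := circle_bounds (ltW b0) b1 B2 a0 ha.
have [x1 t3 t4 tt] := tau_facts b0 b1 t2 t1.
have xx : b ^+ 4 <= b ^+ 2 * (1 / 76).
  by rewrite (_ : b ^+ 4 = b ^+ 2 * b ^+ 2) ?ler_pM2l //; ring.
have a1 : 75 / 76 <= a by move: a1' xx x1; clear; lra.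
have t0 : 0 < tau by move: t1 x0; clear; lra.
have hE' := poly_corr b0 b1 a1 x1 (ltW t0) t4 tt hE.
have s1 : (2 + tau) * (a * (1 - 4 * b ^+ 2)) <= a * (2 - 4 * b ^+ 2).
  rewrite mulrCA ler_wpM2l //.
  apply: (@le_trans _ _ ((2 + 4 * b ^+ 2 * (1 + 10 / 3 * b ^+ 2)) * (1 - 4 * b ^+ 2))).
    by apply: ler_wpM2r; move: x1 t2; clear; lra.
  rewrite (_ : _ * _ = 2 - 4 * b ^+ 2 - 8 / 3 * b ^+ 4 - 160 / 3 * (b ^+ 4 * b ^+ 2)).
    by have : 0 <= b ^+ 4 * b ^+ 2 by [rewrite mulr_ge0 ?ltW]; move: b4 (b ^+ 4 * _); clear; move=> *; lra.
  by field.
have s2 : 47 / 4 * b ^+ 3 <= tau * (b * (3 - 4 * b ^+ 2)).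
  apply: (@le_trans _ _ (4 * b ^+ 2 * (b * (47 / 16)))).
    by rewrite (_ : _ * (b * _) = b ^+ 3 * (4 * (47 / 16))); [move: b3; clear; lra|ring].
  apply: ler_pM => //; [by rewrite mulr_ge0 ?ltW| |].
    by rewrite mulr_ge0 ?(ltW b0) //; clear; lra.
  by rewrite ler_pM2l //; move: x1; clear; lra.
have s3 : 2 * tau ^+ 2 * (a * (1 - b ^+ 2) - b ^+ 3) <= 2 * tau ^+ 2.
  apply: ler_piMr; first by apply: mulr_ge0 => //; exact: sqr_ge0.
  have : a * (1 - b ^+ 2) <= 1 * 1.
    by apply: ler_pM => //; move: x0 x1; clear; lra.
  move: b3; clear; lra.
have key : 9 / 2 * b ^+ 3 + 62 * b ^+ 4 <= 2 * a * b ^+ 2.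
  rewrite (_ : _ + _ = b ^+ 2 * (9 / 2 * b + 62 * b ^+ 2)); last by ring.
  by rewrite mulrC ler_pM2r //; move: a1 b1 x1; clear; lra.
move: s1 s2 s3 hE' key tt b3 b4; clear; lra.
Qed.

(** The case of a direction above d0 when 4 d0 = m - 1, so that m is at least 9. *)
Lemma poly_near_right a b tau : 0 < b -> b <= 4 / 45 -> 0 <= a -> a ^+ 2 = 1 - b ^+ 2 ->
  4 * b ^+ 2 <= tau -> tau <= 4 * b ^+ 2 * (1 + 10 / 3 * b ^+ 2) ->
  (2 + tau) * (a * (1 - 4 * b ^+ 2)) + tau * (b * (3 - 4 * b ^+ 2)) +
     15 / 4 * tau ^+ 2 <= 2 * (1 - tau ^+ 2) * (a * (1 - b ^+ 2) + b ^+ 3).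
Proof.
move=> b0 b1 a0 ha t1 t2.
have b1' : b <= 4 / 35 by move: b1; clear; lra.
have x0 : 0 < b ^+ 2 by rewrite exprn_gt0.
have b4 : 0 < b ^+ 4 by rewrite exprn_gt0.
have b3 : 0 < b ^+ 3 by rewrite exprn_gt0.
have B2 : 4 / 45 <= 1 / 8 :> R by clear; lra.
have [x1' a2 a1'] := circle_bounds (ltW b0) b1 B2 a0 ha.
have [x1 t3 t4 tt] := tau_facts b0 b1' t2 t1.
have x2 : b ^+ 2 <= 1 / 120 by move: x1'; clear; lra.
have xx : b ^+ 4 <= b ^+ 2 * (1 / 76).
  by rewrite (_ : b ^+ 4 = b ^+ 2 * b ^+ 2) ?ler_pM2l //; ring.
have a1 : 75 / 76 <= a by move: a1' xx x1; clear; lra.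
have t0 : 0 < tau by move: t1 x0; clear; lra.
have s1 : (2 + tau) * (a * (1 - 4 * b ^+ 2)) <= a * (2 - 4 * b ^+ 2).
  rewrite mulrCA ler_wpM2l //.
  apply: (@le_trans _ _ ((2 + 4 * b ^+ 2 * (1 + 10 / 3 * b ^+ 2)) * (1 - 4 * b ^+ 2))).
    by apply: ler_wpM2r; move: x1 t2; clear; lra.
  rewrite (_ : _ * _ = 2 - 4 * b ^+ 2 - 8 / 3 * b ^+ 4 - 160 / 3 * (b ^+ 4 * b ^+ 2)).
    by have : 0 <= b ^+ 4 * b ^+ 2 by [rewrite mulr_ge0 ?ltW]; move: b4 (b ^+ 4 * _); clear; move=> *; lra.
  by field.
have s2 : tau * (b * (3 - 4 * b ^+ 2)) <= 63 / 5 * b ^+ 3.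
  apply: (@le_trans _ _ (21 / 5 * b ^+ 2 * (b * 3))).
    apply: ler_pM => //; [exact: ltW| |].
      by rewrite mulr_ge0 ?(ltW b0) //; move: x1; clear; lra.
    by rewrite ler_pM2l //; move: x0; clear; lra.
  by rewrite (_ : _ * (b * _) = b ^+ 3 * (3 * (21 / 5))); [move: b3; clear; lra|ring].
have s3 : 2 * tau ^+ 2 * (a * (1 - b ^+ 2) + b ^+ 3) <= 2 * tau ^+ 2 * (11 / 10).
  apply: ler_wpM2l; first by apply: mulr_ge0 => //; exact: sqr_ge0.
  have h1 : a * (1 - b ^+ 2) <= 1 * 1.
    by apply: ler_pM => //; move: x0 x1; clear; lra.
  have h2 : b * b ^+ 2 <= (4 / 45) * (1 / 120) by apply: ler_pM => //; exact: ltW.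
  by rewrite exprS; move: h1 h2; clear; lra.
have key : 53 / 5 * b ^+ 3 + 108 * b ^+ 4 <= 2 * a * b ^+ 2.
  rewrite (_ : _ + _ = b ^+ 2 * (53 / 5 * b + 108 * b ^+ 2)); last by ring.
  by rewrite mulrC ler_pM2r //; move: a1 b1 x2; clear; lra.
move: s1 s2 s3 key tt b3 b4; clear; lra.
Qed.

(** The case of a direction above d0 when 4 d0 = m + 1; then it exceeds pi / 4 by more than 4 k,
    with k = pi / (4 m). *)
Lemma poly_far_right a b tau : 0 < b -> b <= 4 / 35 -> 0 <= a -> a ^+ 2 = 1 - b ^+ 2 ->
  4 * b ^+ 2 <= tau -> tau <= 4 * b ^+ 2 * (1 + 10 / 3 * b ^+ 2) ->
  (2 + tau) * (1 - 8 * b ^+ 2 + 8 * b ^+ 4) + tau * (4 * a * b * (1 - 2 * b ^+ 2)) +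
     15 / 4 * tau ^+ 2 <= 2 * (1 - tau ^+ 2) * (a * (1 - b ^+ 2) - b ^+ 3).
Proof.
move=> b0 b1 a0 ha t1 t2.
have x0 : 0 < b ^+ 2 by rewrite exprn_gt0.
have b4 : 0 < b ^+ 4 by rewrite exprn_gt0.
have b3 : 0 < b ^+ 3 by rewrite exprn_gt0.
have B2 : 4 / 35 <= 1 / 8 :> R by clear; lra.
have [x1' a2 a1'] := circle_bounds (ltW b0) b1 B2 a0 ha.
have [x1 t3 t4 tt] := tau_facts b0 b1 t2 t1.
have xx : b ^+ 4 <= b ^+ 2 * (1 / 76).
  by rewrite (_ : b ^+ 4 = b ^+ 2 * b ^+ 2) ?ler_pM2l //; ring.
have t0 : 0 < tau by move: t1 x0; clear; lra.
have s1 : (2 + tau) * (1 - 8 * b ^+ 2 + 8 * b ^+ 4) <= 2 - 57 / 5 * b ^+ 2.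
  have h1 : tau * (1 - 8 * b ^+ 2 + 8 * b ^+ 4) <= 21 / 5 * b ^+ 2 * 1.
    by apply: ler_pM => //; [exact: ltW| |]; move: x0 x1 b4 xx; clear; lra.
  by rewrite mulrDl; move: h1 xx x0; clear; move: (tau * _) => z; lra.
have s2 : tau * (4 * a * b * (1 - 2 * b ^+ 2)) <= 84 / 5 * b ^+ 3.
  apply: (@le_trans _ _ (21 / 5 * b ^+ 2 * (4 * 1 * b * 1))).
    have u0 : 0 <= 1 - 2 * b ^+ 2 by move: x1; clear; lra.
    apply: ler_pM => //; [exact: ltW|by rewrite !mulr_ge0 // ltW|].
    apply: ler_pM => //; [by rewrite !mulr_ge0 // ltW| |by move: x0; clear; lra].
    by rewrite ler_pM2r // ler_pM2l.
  by rewrite (_ : _ * (_ * b * _) = b ^+ 3 * (4 * (21 / 5))); [move: b3; clear; lra|ring].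
have s3 : 2 * tau ^+ 2 * (a * (1 - b ^+ 2) - b ^+ 3) <= 2 * tau ^+ 2.
  apply: ler_piMr; first by apply: mulr_ge0 => //; exact: sqr_ge0.
  have : a * (1 - b ^+ 2) <= 1 * 1.
    by apply: ler_pM => //; move: x0 x1; clear; lra.
  by move: b3; clear; lra.
have s4 : 1 - 8 / 5 * b ^+ 2 <= a * (1 - b ^+ 2).
  have : a * b ^+ 2 <= b ^+ 2 by rewrite ler_piMl // ltW.
  by rewrite mulrBr mulr1; move: a1' xx x0; clear; move: (a * _) => z; lra.
have key : 19 * b ^+ 3 + 104 * b ^+ 4 <= 8 * b ^+ 2.
  rewrite (_ : _ + _ = b ^+ 2 * (19 * b + 104 * b ^+ 2)); last by ring.
  by rewrite mulrC ler_pM2r //; move: b1 x1; clear; lra.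
move: s1 s2 s3 s4 key tt b4 b3.
clear; lra.
Qed.

End Numeric.

Section AngleNumeric.
Context {R : realType}.
Implicit Types k x : R.

Lemma quarter_cos (w := cos (pi / 4) : R) : [/\ sin (pi / 4) = w, w ^+ 2 = 1 / 2, 12 / 17 <= w & w <= 29 / 41].
Proof.
have p0 := @pi_gt0 R.
have w0 : 0 < w by apply: cos_gt0_pihalf; apply/andP; split; lra.
have sw : sin (pi / 4) = w.
  by rewrite /w -cosBpihalf -cosN; congr cos; field.
have w2 : w ^+ 2 = 1 / 2 by have := cos2Dsin2 (pi / 4 : R); rewrite sw -/w; lra.
split=> //; first by apply: le_of_sqr; [exact: ltW|rewrite w2; lra].
by apply: le_of_sqr; [lra|rewrite w2; lra].
Qed.

Lemma multiple_angles k (a := cos k) (b := sin k) :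
  [/\ sin (k *+ 2) = 2 * a * b, cos (k *+ 2) = 1 - 2 * b ^+ 2,
      sin (k *+ 4) = 4 * a * b * (1 - 2 * b ^+ 2) & cos (k *+ 4) = 1 - 8 * b ^+ 2 + 8 * b ^+ 4].
Proof.
have s2 : sin (k *+ 2) = 2 * a * b by rewrite sin_mulr2n mulr2n /a /b; ring.
have c2 : cos (k *+ 2) = 1 - 2 * b ^+ 2.
  by rewrite cos_mulr2n cos2sin2 mulr2n -/b; ring.
split=> //; rewrite (mulrnA k 2 2).
  by rewrite sin_mulr2n s2 c2 mulr2n; ring.
by rewrite cos_mulr2n c2 mulr2n; ring.
Qed.

Lemma triple_angle k (a := cos k) (b := sin k) :
  sin (k *+ 3) = b * (3 - 4 * b ^+ 2) /\ cos (k *+ 3) = a * (1 - 4 * b ^+ 2).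
Proof.
have [s2 c2 _ _] := multiple_angles k; rewrite (mulrSr k 2) (sinD (k *+ 2)) (cosD (k *+ 2)) s2 c2.
have := cos2sin2 k => e; split; rewrite /a /b; ring: e.
Qed.

(** For c = cos p this is tan(p / 2)^2, minus the unit component of an observable of an odd
    polygon. *)
Definition tau_of (c : R) : R := (1 - c) / (1 + c).

Lemma tau_bounds k (b := sin k) (tau := tau_of (cos (k *+ 4))) : 0 < b -> b <= 4 / 35 ->
  4 * b ^+ 2 <= tau /\ tau <= 4 * b ^+ 2 * (1 + 10 / 3 * b ^+ 2).
Proof.
move=> b0 b1; rewrite /tau /tau_of; have [_ _ _ ->] := multiple_angles k.
have := ltrM2 (ltW b0) b1; rewrite -/b (_ : b ^+ 4 = b ^+ 2 * b ^+ 2); last by ring.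
have : 0 < b ^+ 2 by rewrite exprn_gt0.
clear b0 b1 tau; move: (b ^+ 2) => x x0 x1'.
have x1 : x <= 1 / 76 by move: x1'; clear; lra.
have xx : x * x <= x * (1 / 76) by rewrite ler_pM2l.
have x2 : 0 < x * x by rewrite mulr_gt0.
have xxx : x * x * x <= x * x * (1 / 76) by rewrite ler_pM2l.
have x3 : 0 < x * x * x by rewrite !mulr_gt0.
have xxxx : x * x * x * x <= x * x * x * (1 / 76) by rewrite ler_pM2l.
have d0 : 0 < 1 + (1 - 8 * x + 8 * (x * x)) by move: x1 x2; clear; lra.
rewrite ler_pdivlMr // ler_pdivrMr //; clear d0 x1'.
have x4 : 0 < x * x * x * x by rewrite !mulr_gt0.
by split; lra.
Qed.

(** Bound for one party whose half angle between directions has cosine [C] and sine [S], [e] being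
    the parity sign of d: the constant of the majorant in [plane_bound] plus the amplitude of the
    harmonic that the second majorant has to exceed. *)
Definition assemblage (c C S e : R) : R :=
  2 * C * (1 - tau_of c ^+ 2) + 2 * e * tau_of c ^+ 2 +
  Num.sqrt ((4 * S / (1 + c)) ^+ 2 + (4 * tau_of c * (C - e) / (1 + c)) ^+ 2).

Lemma assemblage_le c C S e (t := tau_of c) : 0 < 1 + c -> 0 <= t -> 0 < S ->
  assemblage c C S e <= 2 * C + 2 * S + 2 * t * S +
    t ^+ 2 * ((1 + t) * (C - e) ^+ 2 / S - 2 * (C - e)).
Proof.
move=> c0 t0 S0; rewrite /assemblage -/t.
have cn : 1 + c != 0 by rewrite lt0r_neq0.
have ec : 2 / (1 + c) = 1 + t by rewrite /t /tau_of; field.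
have -> : 4 * S / (1 + c) = 2 * S * (1 + t) by rewrite -ec; field.
have -> : 4 * t * (C - e) / (1 + c) = 2 * t * (C - e) * (1 + t) by rewrite -ec; field.
set A := 2 * S * (1 + t); set q := 2 * t * (C - e) * (1 + t).
have A0 : 0 < A by rewrite !mulr_gt0 //; lra.
have : Num.sqrt (A ^+ 2 + q ^+ 2) <= A + q ^+ 2 / (2 * A).
  have h0 : 0 <= q ^+ 2 / (2 * A) by apply: divr_ge0; [exact: sqr_ge0|rewrite mulr_ge0 // ltW].
  have hs : 0 <= A + q ^+ 2 / (2 * A) by rewrite addr_ge0 // ltW.
  rewrite -[leRHS](ger0_norm hs) -sqrtr_sqr ler_wsqrtr //.
  rewrite (_ : (A + _) ^+ 2 = A ^+ 2 + q ^+ 2 + (q ^+ 2 / (2 * A)) ^+ 2).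
    by rewrite lerDl sqr_ge0.
  by field; rewrite lt0r_neq0.
have -> : q ^+ 2 / (2 * A) = t ^+ 2 * ((1 + t) * (C - e) ^+ 2 / S).
  rewrite /q /A; field; rewrite !lt0r_neq0 //; lra.
move: (_ / S) (Num.sqrt _) => X Y; rewrite /A; clear; lra.
Qed.

End AngleNumeric.

(** * The numerical conditions of the certificates, with p = 4 k, h = 2 k, s = pi / 4 + o k *)

Section Conditions.
Context {R : realType}.
Variables (k o : R).
Hypothesis ho : o = 1 \/ o = - 1.
Local Notation w := (cos (pi / 4) : R).
Local Notation a := (cos k).
Local Notation b := (sin k).
Local Notation h := (k *+ 2).
Local Notation p := (k *+ 4).
Local Notation c := (cos p).
Local Notation tau := (tau_of c).
Local Notation s := (pi / 4 + o * k).
Hypotheses (a0 : 0 <= a) (b0 : 0 < b) (b1 : b <= 4 / 35).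

Let osq : o ^+ 2 = 1. Proof. by case: ho => ->; ring. Qed.
Let ha : a ^+ 2 = 1 - b ^+ 2. Proof. exact: cos2sin2. Qed.

Lemma sin_s : sin s = w * (a + o * b).
Proof.
have [sw _ _ _] := @quarter_cos R.
by rewrite sinD sw (cos_sign ho) (sin_sign ho); ring.
Qed.

Lemma cos_s : cos s = w * (a - o * b).
Proof.
have [sw _ _ _] := @quarter_cos R.
by rewrite cosD sw (cos_sign ho) (sin_sign ho); ring.
Qed.

Lemma steps_s : steps s = 4 * w * (a * (1 - b ^+ 2) - o * b ^+ 3).
Proof.
have [_ w2 _ _] := @quarter_cos R.
rewrite /steps (_ : 3 * s = s *+ 3); last by rewrite mulr_natl.
have [_ ->] := triple_angle s; rewrite sin2cos2 cos_s.
have -> : 3 * (w * (a - o * b)) - w * (a - o * b) * (1 - 4 * (1 - (w * (a - o * b)) ^+ 2)) =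
   w * (a - o * b) * (6 - 4 * w ^+ 2 * (a ^+ 2 - 2 * o * a * b + o ^+ 2 * b ^+ 2)) by ring.
rewrite w2 osq ha.
have -> : w * (a - o * b) * (6 - 4 * (1 / 2) * (1 - b ^+ 2 - 2 * o * a * b + 1 * b ^+ 2)) =
   4 * w * (a + o * (a ^+ 2 * b) - o * b - o ^+ 2 * (a * b ^+ 2)) by field.
by rewrite osq ha; ring.
Qed.

Lemma angle_facts :
  [/\ 75 / 76 <= a, a <= 1, b ^+ 2 <= 1 / 76, 37 / 38 <= cos h & cos h <= 1] /\
  [/\ 17 / 19 <= c, c <= 1, 0 < sin h, sin h <= 8 / 35 & 0 < sin p] /\
  sin p = 2 * sin h * cos h.
Proof.
have B2 : 4 / 35 <= 1 / 8 :> R by lra.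
have [x1 a1 a2] := circle_bounds (ltW b0) b1 B2 a0 ha.
have [-> -> -> ->] := multiple_angles k.
have x0 : 0 < b ^+ 2 by rewrite exprn_gt0.
have x2 : b ^+ 2 <= 1 / 76 by move: x1; lra.
have b4 : 0 < b ^+ 4 by rewrite exprn_gt0.
have xx : b ^+ 4 <= b ^+ 2 * (1 / 76).
  by rewrite (_ : b ^+ 4 = b ^+ 2 * b ^+ 2) ?ler_pM2l //; ring.
have a3 : 75 / 76 <= a by move: a2 xx x2; lra.
have a4 : 0 < a by move: a3; lra.
have ch : 0 < 1 - 2 * b ^+ 2 by move: x2; lra.
split; first by split=> //; move: x2 x0; lra.
split; last by ring.
split; try by move: x2 x0 b4 xx; lra.
- by rewrite !mulr_gt0.
- have : a * b <= 1 * (4 / 35) by apply: ler_pM => //; exact: ltW.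
  by lra.
- by rewrite !mulr_gt0.
Qed.

Lemma cos_double : c = 2 * cos h ^+ 2 - 1.
Proof.
rewrite (mulrnA k 2 2) (cos_mulr2n h); move: (cos _ ^+ 2) => X.
by rewrite mulr2n; ring.
Qed.

(** In other words the gain is tan h / c, small of order b. *)
Lemma gain_def : (1 - c) / c / sin p * (cos h * c) = sin h.
Proof.
have [[_ _ _ h1 _] [[h2 _ h3 _ h4] e]] := angle_facts.
have c0 : c != 0 by rewrite lt0r_neq0 //; move: h2; lra.
have p0 : sin p != 0 by rewrite lt0r_neq0.
have -> : (1 - c) / c / sin p * (cos h * c) = (1 - c) * cos h / sin p by field; rewrite ?c0 ?p0.
apply: (canLR (mulfK p0)); rewrite e (_ : c = 2 * cos h ^+ 2 - 1).
  by have := sin2cos2 h => e2; ring: e2.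
exact: cos_double.
Qed.

Lemma gain_bounds : 0 <= (1 - c) / c / sin p /\ (1 - c) / c / sin p <= 47 / 20 * b.
Proof.
have [[h0 a1 _ h1 _] [[h2 c1 h3 _ h4] e]] := angle_facts.
have := gain_def; set G := _ / sin p => hG.
have d0 : 37 / 38 * (17 / 19) <= cos h * c by apply: ler_pM; move: h1 h2; lra.
have d1 : 0 < cos h * c by move: d0; lra.
have G0 : 0 <= G by rewrite -(pmulr_lge0 _ d1) hG ltW.
split=> //.
have sb : sin h <= 2 * b.
  have [-> _ _ _] := multiple_angles k.
  have : a * b <= 1 * b by rewrite ler_pM2r.
  by lra.
have : G * (37 / 38 * (17 / 19)) <= 2 * b.
  by apply: le_trans sb; rewrite -hG; apply: ler_wpM2l.
by move: b0; lra.
Qed.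

Lemma trig_s_bounds : [/\ 3 / 5 <= sin s, sin s <= 4 / 5, 1 / 2 <= cos s, 0 < sin s & 27 / 10 <= steps s].
Proof.
have [[h0 a1 x1 _ _] _] := angle_facts.
have [_ _ w1 w2] := @quarter_cos R.
rewrite sin_s cos_s steps_s.
have ob : - (4 / 35) <= o * b /\ o * b <= 4 / 35.
  by case: ho => ->; rewrite ?mul1r ?mulN1r; split; move: b0 b1; lra.
have sb1 : 12 / 17 * (75 / 76 - 4 / 35) <= w * (a + o * b).
  by apply: ler_pM; move: ob h0 w1 => []; lra.
have sb2 : w * (a + o * b) <= 29 / 41 * (1 + 4 / 35).
  by apply: ler_pM; move: ob h0 w1 a1 w2 => []; lra.
have cb1 : 12 / 17 * (75 / 76 - 4 / 35) <= w * (a - o * b).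
  by apply: ler_pM; move: ob h0 w1 => []; lra.
have ab : 75 / 76 * (1 - 1 / 76) <= a * (1 - b ^+ 2).
  by apply: ler_pM; move: h0 x1; lra.
have b3 : o * b ^+ 3 <= 1 / 76 * (4 / 35).
  have h3 : b ^+ 3 <= 1 / 76 * (4 / 35).
    by rewrite exprSr; apply: ler_pM => //; [exact: sqr_ge0|exact: ltW].
  have h4 : 0 < b ^+ 3 by rewrite exprn_gt0.
  by case: ho => ->; move: h3 h4; lra.
have st : 12 / 17 * (24 / 25) <= w * (a * (1 - b ^+ 2) - o * b ^+ 3).
  by apply: ler_pM => //; move: ab b3; lra.
by split; move: sb1 sb2 cb1 st; lra.
Qed.

Lemma aligned_conditions (G := (1 - c) / c / sin p) :
  2 * G + 2 * (2 * sin h) <= (steps s / c + sin s / cos h) / 2 /\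
  2 * G <= (steps s / c - sin s / cos h) / 2.
Proof.
have [[h0 a1 _ h1 h1'] [[h2 c1 h3 h5 h4] e]] := angle_facts.
have [G0 G1] := gain_bounds; rewrite -/G in G0 G1.
have [s1 s2 _ s0 st] := trig_s_bounds.
have ch0 : 0 < cos h by move: h1; lra.
have c0 : 0 < c by move: h2; lra.
have st' : steps s <= steps s / c.
  by rewrite ler_pdivlMr // ler_piMr //; move: st; lra.
have s3 : sin s <= sin s / cos h by rewrite ler_pdivlMr // ler_piMr // ltW.
have s4 : sin s / cos h <= 5 / 6.
  by rewrite ler_pdivrMr //; move: s2 h1; lra.
by split; move: G1 b1 h5 st' st s1 s3 s4; lra.
Qed.

(** Serves the sign sg = -1, that is odd d, where m is at least 11. *)
Lemma gain_sharp : b <= 4 / 55 -> 2 * ((1 - c) / c / sin p) <= sin s / 2.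
Proof.
move=> b2; have [_ _ w1 _] := @quarter_cos R.
have [[a2 a1 _ _ _] _] := angle_facts; have [G0 _] := gain_bounds.
have y0 : 0 <= b ^+ 4 by rewrite exprn_ge0 // ltW.
have y1 : b ^+ 2 <= 4 / 55 * (4 / 55) by rewrite -expr2; exact: ltrM2 (ltW b0) b2.
have ob : - (4 / 55) <= o * b.
  by case: ho => ->; rewrite ?mul1r ?mulN1r; move: b0 b2; lra.
have s5 : 12 / 17 * (75 / 76 - 4 / 55) <= sin s.
  by rewrite sin_s; apply: ler_pM => //; lra.
have [m1 m2 _ m4] := multiple_angles k.
have hc : 35 / 36 * (19 / 20) <= cos h * c by rewrite m2 m4; apply: ler_pM; lra.
have := ler_wpM2l G0 hc; rewrite gain_def m1.
have : a * b <= 1 * b by rewrite ler_pM2r.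
by move: (_ / sin p) => G; lra.
Qed.

Lemma opposed_conditions (G := (1 - c) / c / sin p) (far := sin h * sin s / (sin p * c))
    (near := steps s - far * (1 - 2 * sin p ^+ 2)) :
  [/\ G <= far, b <= 4 / 55 -> 2 * G <= far, 2 * G + 2 * (2 * sin h) <= near &
   c * (near + far) = c * steps s + 4 * sin s * sin h ^+ 2 * cos h].
Proof.
have [[h0 a1 x1 h1 h1'] [[h2 c1 h3 h5 h4] e]] := angle_facts.
have [G0 G1] := gain_bounds; rewrite -/G in G0 G1.
have [s1 s2 _ s0 st] := trig_s_bounds.
have ch0 : 0 < cos h by move: h1; lra.
have c0 : 0 < c by move: h2; lra.
have far_def : far * (2 * cos h * c) = sin s.
  by rewrite /far e; field; rewrite !lt0r_neq0.
have far0 : 0 < far by rewrite /far divr_gt0 // mulr_gt0.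
have cc0 : 0 < 2 * cos h * c by rewrite !mulr_gt0.
have cc1 : 2 * cos h * c <= 2.
  have : cos h * c <= 1 * 1 by apply: ler_pM => //; exact: ltW.
  by lra.
have cc2 : 37 / 38 * (17 / 19) <= cos h * c.
  by apply: ler_pM => //; lra.
have far1 : sin s / 2 <= far.
  have : far * (2 * cos h * c) <= far * 2 by rewrite ler_pM2l.
  by rewrite far_def; lra.
have far2 : far <= 1 / 2.
  have : far * (2 * (37 / 38 * (17 / 19))) <= far * (2 * cos h * c).
    by rewrite ler_pM2l //; move: cc2; lra.
  by rewrite far_def; move: s2; lra.
have near1 : steps s - far <= near.
  rewrite /near lerD2l lerN2 ler_piMr ?(ltW far0) //.
  by have := sqr_ge0 (sin p); lra.
split.
- by move: G1 b1 far1 s1; lra.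
- by move=> b2; apply: le_trans far1; exact: gain_sharp.
- by move: G1 b1 h5 near1 far2 st; lra.
- rewrite /near (_ : c * _ = c * steps s + far * (2 * cos h * c) * (sin p ^+ 2 / cos h)).
    by rewrite far_def e; field; rewrite lt0r_neq0.
  by field; rewrite lt0r_neq0.
Qed.

Lemma tau_small : [/\ 0 < tau, tau <= 1 / 18 & tau * cos h ^+ 2 = sin h ^+ 2].
Proof.
have [t1 t2] := tau_bounds b0 b1; have [x1 t3 t4 _] := tau_facts b0 b1 t2 t1.
have x0 : 0 < b ^+ 2 by rewrite exprn_gt0.
split=> //; first by move: t1 x0; lra.
have [[_ _ _ h1 _] [[h2 _ _ _ _] _]] := angle_facts.
have c0 : 1 + c != 0 by rewrite lt0r_neq0 //; move: h2; lra.
rewrite /tau_of mulrAC; apply: (canLR (mulfK c0)).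
rewrite (_ : c = 2 * cos h ^+ 2 - 1); first by rewrite sin2cos2; ring.
exact: cos_double.
Qed.

(** The bound for the opposite sign stays below the optimum: it loses a multiple of 1 - c, of order
    b^2, whereas the parity terms are only of order tau^2. *)
Lemma opposed_value sg : sg = 1 \/ sg = - 1 ->
  (1 - tau ^+ 2) * (c * steps s + 4 * sin s * sin h ^+ 2 * cos h) - 2 * sg * tau ^+ 2 <=
  (1 - tau ^+ 2) * steps s + 2 * sg * tau ^+ 2.
Proof.
move=> hsg; have [t0 t1 t2] := tau_small.
have [[_ _ _ h1 h1'] [[h2 c1 h3 h5 h4] e]] := angle_facts.
have [s1 s2 _ s0 st] := trig_s_bounds.
have tt : tau ^+ 2 <= tau * (1 / 18) by rewrite expr2 ler_pM2l.
have ec : 1 - c = 2 * sin h ^+ 2.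
  by rewrite cos_double sin2cos2; ring.
have sh0 : 0 < sin h ^+ 2 by rewrite exprn_gt0.
have tsh : tau * (37 / 38 * (37 / 38)) <= sin h ^+ 2.
  by rewrite -t2 ler_pM2l // expr2; apply: ler_pM => //; lra.
have sc : sin s * cos h <= 4 / 5.
  have : sin s * cos h <= 4 / 5 * 1 by apply: ler_pM => //; [exact: ltW|move: h1; lra].
  by lra.
have t4 : tau ^+ 2 <= 1 / 18 * (1 / 18) by rewrite expr2; apply: ler_pM => //; exact: ltW.
have d1 : 1 <= steps s - 2 * (sin s * cos h) by move: st sc; lra.
have k1 : 17 / 18 * (2 * sin h ^+ 2 * 1) <=
    (1 - tau ^+ 2) * (2 * sin h ^+ 2 * (steps s - 2 * (sin s * cos h))).
  have k0 : 0 <= 2 * sin h ^+ 2 by move: sh0; lra.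
  apply: ler_pM; [by lra|by rewrite mulr1|by move: t4; lra|].
  by apply: ler_wpM2l.
have k2 : (1 - tau ^+ 2) * (2 * sin h ^+ 2 * (steps s - 2 * (sin s * cos h))) =
   (1 - tau ^+ 2) * (steps s - (c * steps s + 4 * sin s * sin h ^+ 2 * cos h)).
  have -> : steps s - (c * steps s + 4 * sin s * sin h ^+ 2 * cos h) =
    (1 - c) * steps s - 4 * sin s * sin h ^+ 2 * cos h by ring.
  by rewrite ec; ring.
have k3 : - (4 * tau ^+ 2) <= 4 * sg * tau ^+ 2.
  by have := sqr_ge0 tau; case: hsg => ->; lra.
move: k1; rewrite k2; move: k3 tsh tt sh0.
by lra.
Qed.

End Conditions.

(** * Directions other than the optimal one *)

Section AssemblageNumeric.
Context {R : realType}.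
Local Notation w := (cos (pi / 4) : R).
Implicit Types (k o x t C S e : R).

(** Below pi / 4 the sine may be as small as sin p, so the quotient by [x] is kept; above pi / 4 it
    is at least cos(pi / 4), and [corr_right] gets a plain multiple of t^2. *)
Lemma corr_left C S e t x : e = 1 \/ e = - 1 -> 0 <= C -> C <= 1 -> S <= 1 -> 0 < x -> x <= S ->
  0 <= t -> t ^+ 2 * ((1 + t) * (C - e) ^+ 2 / S - 2 * (C - e)) <= 4 * (t ^+ 2 * (1 + t) / x).
Proof.
move=> he C0 C1 S1 x0 xS t0.
have S0 : 0 < S by lra.
have h1 : (1 + t) * (C - e) ^+ 2 / S - 2 * (C - e) <= 4 * (1 + t) / S.
  rewrite ler_pdivlMr // mulrBl divfK ?lt0r_neq0 //.
  case: he => ->.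
    have h2 : (1 - C) ^+ 2 <= 1 by rewrite expr_le1 //; lra.
    have h3 : (1 - C) * S <= 1 * 1 by apply: ler_pM; lra.
    have h4 : (1 + t) * (1 - C) ^+ 2 <= (1 + t) * 1 by apply: ler_wpM2l; lra.
    by rewrite (_ : (C - 1) ^+ 2 = (1 - C) ^+ 2); [lra|ring].
  have h2 : (1 + C) ^+ 2 <= 4 by have := ltrM2 (_ : 0 <= 1 + C) (_ : 1 + C <= 2); lra.
  have h3 : 0 <= (1 + C) * S by apply: mulr_ge0; lra.
  have h4 : (1 + t) * (1 + C) ^+ 2 <= (1 + t) * 4 by apply: ler_wpM2l; lra.
  by rewrite opprK (addrC C); lra.
have h2 : 4 * (1 + t) / S <= 4 * (1 + t) / x.
  by apply: ler_wpM2l; [lra|rewrite lef_pV2 ?posrE].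
have -> : 4 * (t ^+ 2 * (1 + t) / x) = t ^+ 2 * (4 * (1 + t) / x) by ring.
by apply: ler_wpM2l; [exact: sqr_ge0|exact: le_trans h1 h2].
Qed.

Lemma corr_right C S e t : e = 1 \/ e = - 1 -> 0 <= C -> C <= w -> w <= S -> S <= 1 ->
  1 <= C + S -> 0 <= t -> t <= 1 / 18 ->
  t ^+ 2 * ((1 + t) * (C - e) ^+ 2 / S - 2 * (C - e)) <= 16 / 5 * t ^+ 2.
Proof.
move=> he C0 C1 wS S1 CS t0 t1; have [_ w2 w3 w4] := @quarter_cos R.
rewrite [leRHS]mulrC; apply: ler_wpM2l; first exact: sqr_ge0.
have S0 : 0 < S by lra.
rewrite -(ler_pM2r S0) mulrBl divfK ?lt0r_neq0 //.
case: he => ->.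
  have h1 : (1 - C) * (1 - C) <= S * 1 by apply: ler_pM; lra.
  have h2 : (1 + t) * ((1 - C) * (1 - C)) <= 19 / 18 * (S * 1).
    by apply: ler_pM; rewrite ?mulr_ge0 //; lra.
  have h3 : 0 <= C * S by rewrite mulr_ge0 // ltW.
  by rewrite (_ : (C - 1) ^+ 2 = (1 - C) * (1 - C)); [lra|ring].
have h1 : (1 + C) * (1 + C) <= 70 / 41 * (70 / 41) by apply: ler_pM; lra.
have h2 : (1 + t) * ((1 + C) * (1 + C)) <= 19 / 18 * (70 / 41 * (70 / 41)).
  by apply: ler_pM => //; [lra|rewrite mulr_ge0 //; lra|lra].
have h3 : 0 <= C * S by rewrite mulr_ge0 // ltW.
by rewrite opprK (_ : (C + 1) ^+ 2 = (1 + C) * (1 + C)); [lra|ring].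
Qed.

Lemma weighted_le E t X Y : 12 / 17 <= w -> 0 <= E -> 0 <= t ->
  17 / 6 * E + 17 / 12 * t + X <= Y -> 4 * E + 2 * t + 2 * w * X <= 2 * w * Y.
Proof.
move=> w3 E0 t0 h; have w0 : 0 <= 2 * w by lra.
have := ler_wpM2l w0 h; rewrite !mulrDr.
have : 24 / 17 * (17 / 6 * E) <= 2 * w * (17 / 6 * E) by apply: ler_wpM2r; lra.
have : 24 / 17 * (17 / 12 * t) <= 2 * w * (17 / 12 * t) by apply: ler_wpM2r; lra.
lra.
Qed.

(** The first sign condition says that x lies past the maximum of the harmonic, so a further advance
    by at most a quarter turn cannot increase it. *)
Lemma tilt_decreasing K t x y : 0 <= t -> 0 <= y -> y <= pi / 2 ->
  t * cos x <= K * sin x -> 0 <= K * cos x + t * sin x ->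
  K * cos (x + y) + t * sin (x + y) <= K * cos x + t * sin x.
Proof.
move=> t0 y0 y1 h1 h2; rewrite cosD sinD.
have s0 : 0 <= sin y by apply: sin_ge0_pi; have := @pi_gt0 R; lra.
have := ler_wpM2l h2 (cos_le1 y).
have h3 : 0 <= K * sin x - t * cos x by lra.
by have := mulr_ge0 h3 s0; lra.
Qed.

Variables (k o : R).
Hypothesis ho : o = 1 \/ o = - 1.
Local Notation a := (cos k).
Local Notation b := (sin k).
Local Notation p := (k *+ 4).
Local Notation c := (cos p).
Local Notation tau := (tau_of c).
Local Notation s := (pi / 4 + o * k).
Hypotheses (a0 : 0 <= a) (b0 : 0 < b) (b1 : b <= 4 / 35).

Let ha : a ^+ 2 = 1 - b ^+ 2. Proof. exact: cos2sin2. Qed.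
Let t12 := tau_bounds b0 b1.
Let c1 : 0 < 1 + c.
Proof. by have [_ [[h _ _ _ _] _]] := angle_facts a0 b0 b1; lra. Qed.
Let tau0 : 0 <= tau. Proof. by have [/ltW] := tau_small a0 b0 b1. Qed.
Let tau1 : tau <= 1 / 18. Proof. by have [_] := tau_small a0 b0 b1. Qed.

Let gap0 : 0 <= 2 * (1 - tau ^+ 2).
Proof.
have t0 := tau0; have t18 := tau1.
by have : tau ^+ 2 <= 1; [rewrite expr_le1 //; lra|lra].
Qed.

(* For k = pi / (4 m) the angle s = pi / 4 + o k is the multiple of pi / m that is
   closest to pi / 4, and [optimum] is the value attained there by a maximally
   entangled state. *)
Definition optimum (sg : R) : R := (1 - tau ^+ 2) * steps s + 2 * sg * tau ^+ 2.

Lemma optimum_ge sg : sg = 1 \/ sg = - 1 ->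
  2 * w * (2 * (1 - tau ^+ 2) * (a * (1 - b ^+ 2) - o * b ^+ 3)) - 2 * tau ^+ 2 <= optimum sg.
Proof.
move=> hsg; rewrite /optimum steps_s //; have := sqr_ge0 tau.
by case: hsg => ->; lra.
Qed.

Section Direction.
Variables (eps C S e sg : R).
Hypotheses (hC : C = w * (cos eps - sin eps)) (hS : S = w * (cos eps + sin eps)).
Hypotheses (he : e = 1 \/ e = - 1) (hsg : sg = 1 \/ sg = - 1) (C0 : 0 <= C).

Let main : 0 < S -> assemblage c C S e <=
  2 * w * ((2 + tau) * cos eps + tau * sin eps) +
    tau ^+ 2 * ((1 + tau) * (C - e) ^+ 2 / S - 2 * (C - e)).
Proof.
move=> S0; apply: le_trans (assemblage_le C e c1 tau0 S0) _.
by rewrite lerD2r hC hS; lra.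
Qed.

Lemma assemblage_left : cos eps <= cos (k *+ 3) -> sin eps <= - sin (k *+ 3) ->
  C <= 1 -> S <= 1 -> sin p <= S -> assemblage c C S e <= optimum sg.
Proof.
move=> h1 h2 C1 S1 pS; have t0 := tau0; have t18 := tau1; have bp := b0.
have [_ [[_ _ _ _ p0] _]] := angle_facts a0 b0 b1.
have S0 : 0 < S by lra.
have [_ w2 w3 w4] := @quarter_cos R.
apply: le_trans (main S0) _; apply: le_trans (optimum_ge hsg).
have := corr_left he C0 C1 S1 p0 pS tau0; set E := _ / sin p => hcorr.
have [t1 t2] := t12.
have hE : E * (4 * a * b * (1 - 2 * b ^+ 2)) = tau ^+ 2 * (1 + tau).
  have [_ _ e4 _] := multiple_angles k.
  by rewrite -e4 /E divfK // lt0r_neq0.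
have E0 : 0 <= E.
  by apply: divr_ge0; [apply: mulr_ge0; [exact: sqr_ge0|lra]|exact: ltW].
have := poly_near_left b0 b1 a0 ha t1 t2 hE.
have [s3 c3] := triple_angle k.
rewrite -s3 -c3 => hp.
have q1 : (2 + tau) * cos eps <= (2 + tau) * cos (k *+ 3) by apply: ler_wpM2l => //; lra.
have q2 : tau * sin eps <= tau * - sin (k *+ 3) by apply: ler_wpM2l.
have q3 : 2 * (1 - tau ^+ 2) * (a * (1 - b ^+ 2) - b ^+ 3) <=
   2 * (1 - tau ^+ 2) * (a * (1 - b ^+ 2) - o * b ^+ 3).
  apply: (ler_wpM2l gap0).
  have : 0 < b ^+ 3 by rewrite exprn_gt0.
  by case: ho => ->; lra.
have t2' : 0 <= tau ^+ 2 by exact: sqr_ge0.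
have q4 : 17 / 6 * E + 17 / 12 * tau ^+ 2 + ((2 + tau) * cos eps + tau * sin eps) <=
  2 * (1 - tau ^+ 2) * (a * (1 - b ^+ 2) - o * b ^+ 3) by lra.
by have := weighted_le w3 E0 t2' q4; move: hcorr; lra.
Qed.

(** The coefficient 15/4 is large enough because 24/17 * 15/4 exceeds 16/5 + 2, the correction of
    [corr_right] plus the loss in [optimum_ge]. *)
Let right_reduce Z : C <= w -> w <= S -> S <= 1 -> 1 <= C + S ->
  (2 + tau) * cos eps + tau * sin eps <= Z ->
  Z + 15 / 4 * tau ^+ 2 <= 2 * (1 - tau ^+ 2) * (a * (1 - b ^+ 2) - o * b ^+ 3) ->
  assemblage c C S e <= optimum sg.
Proof.
move=> C1 wS S1 CS hZ hp; have t0 := tau0; have t18 := tau1; have bp := b0.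
have [_ w2 w3 w4] := @quarter_cos R.
have S0 : 0 < S by lra.
apply: le_trans (main S0) _; apply: le_trans (optimum_ge hsg).
have := corr_right he C0 C1 wS S1 CS tau0 tau1 => hcorr.
have t2' : 0 <= tau ^+ 2 by exact: sqr_ge0.
have w0 : 0 <= 2 * w by lra.
have := ler_wpM2l w0 hp; have := ler_wpM2l w0 hZ.
have r1 : 24 / 17 * (15 / 4 * tau ^+ 2) <= 2 * w * (15 / 4 * tau ^+ 2).
  by apply: ler_wpM2r; lra.
by rewrite !mulrDr; lra.
Qed.

Lemma assemblage_right_near : o = - 1 -> b <= 4 / 45 -> k *+ 3 <= eps -> eps <= k *+ 3 + pi / 2 ->
  C <= w -> w <= S -> S <= 1 -> 1 <= C + S -> assemblage c C S e <= optimum sg.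
Proof.
move=> o1 b2 e1 e2 C1 wS S1 CS; have [t1 t2] := t12; have t0 := tau0; have bp := b0.
have [s3 c3] := triple_angle k.
have [[a1 a2 x1 _ _] _] := angle_facts a0 b0 b1.
have [_ t3 _ _] := tau_facts b0 b1 t2 t1.
have cc0 : 0 <= cos (k *+ 3) by rewrite c3 mulr_ge0 //; lra.
have cc1 : cos (k *+ 3) <= 1 by exact: cos_le1.
have ss0 : b * 2 <= sin (k *+ 3) by rewrite s3 ler_pM2l //; lra.
apply: (right_reduce (Z := (2 + tau) * cos (k *+ 3) + tau * sin (k *+ 3))) => //.
  have -> : eps = k *+ 3 + (eps - k *+ 3) by ring.
  apply: tilt_decreasing => //; [lra|lra| |].
    have h1 : tau * cos (k *+ 3) <= tau * 1 by apply: ler_wpM2l.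
    have h2 : 2 * (b * 2) <= (2 + tau) * sin (k *+ 3).
      by apply: ler_pM => //; [rewrite mulr_ge0 // ltW|lra].
    have h3 : b ^+ 2 <= b * (4 / 35) by rewrite expr2 ler_pM2l.
    by lra.
  by apply: addr_ge0; apply: mulr_ge0 => //; lra.
by rewrite s3 c3 o1 mulN1r opprK; apply: poly_near_right.
Qed.

Lemma assemblage_right_far : k *+ 4 <= eps -> eps <= k *+ 4 + pi / 2 ->
  C <= w -> w <= S -> S <= 1 -> 1 <= C + S -> assemblage c C S e <= optimum sg.
Proof.
move=> e1 e2 C1 wS S1 CS; have [t1 t2] := t12; have t0 := tau0; have t18 := tau1; have bp := b0.
have [_ _ s4 c4] := multiple_angles k.
have [[a1 a2 x1 _ _] [[d1 d2 _ _ d3] _]] := angle_facts a0 b0 b1.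
have [_ t3 _ _] := tau_facts b0 b1 t2 t1.
have ss0 : 2 * b <= sin p.
  rewrite s4.
  have -> : 4 * a * b * (1 - 2 * b ^+ 2) = 4 * (a * (1 - 2 * b ^+ 2)) * b by ring.
  rewrite ler_pM2r //; have : 75 / 76 * (37 / 38) <= a * (1 - 2 * b ^+ 2).
    by apply: ler_pM; lra.
  by lra.
apply: (right_reduce (Z := (2 + tau) * cos p + tau * sin p)) => //.
  have -> : eps = p + (eps - p) by ring.
  apply: tilt_decreasing => //; [lra|lra| |].
    have h1 : tau * cos p <= tau * 1 by apply: ler_wpM2l.
    have h2 : 2 * (2 * b) <= (2 + tau) * sin p by apply: ler_pM => //; lra.
    have h3 : b ^+ 2 <= b * (4 / 35) by rewrite expr2 ler_pM2l.
    by lra.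
  by apply: addr_ge0; apply: mulr_ge0 => //; lra.
have := poly_far_right b0 b1 a0 ha t1 t2; rewrite -s4 -c4 => /le_trans; apply.
apply: (ler_wpM2l gap0).
have : 0 < b ^+ 3 by rewrite exprn_gt0.
by case: ho => ->; lra.
Qed.

End Direction.
End AssemblageNumeric.

(** * Odd polygons *)

Section OddGeometry.
Context {R : realType} (m : nat) (m3 : (3 <= m)%N) (m_odd : odd m).
Local Notation r := (@Defs.radius R m).
Local Notation c := (cos (pi / m%:R) : R).
Local Notation theta i := (2 * pi * i%:R / m%:R : R).
Local Notation u := (@unit_eff R).
Local Notation tau := (tau_of c).
Local Notation ob i := (@obs R (Ngon m) i).
Implicit Types (a b x y X : 'cV[R]_3) (eta : 'M[R]_3) (t : R).

Definition obv t : 'cV[R]_3 :=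
  vec3 (2 * (r * cos t) * (c / (1 + c))) (2 * (r * sin t) * (c / (1 + c))) (- tau).

Let c0 : 0 < c. Proof. exact: c_gt0. Qed.
Let nc1 : 1 + c != 0. Proof. by rewrite lt0r_neq0 // addr_gt0. Qed.

Lemma obs_obv (i : 'I_m) : ob i = obv (theta i).
Proof.
rewrite /obs (eff_efv m3) /efv (eff_gain_odd m3 m_odd) /eff_shift m_odd addr0 /obv /tau_of.
by apply/colP => j; rewrite !mxE; case: (ord3 j) => -> /=; field.
Qed.

Lemma obv_omv t t' : inner (obv t) (omv m t') = 2 / (1 + c) * cos (t - t') - tau.
Proof.
rewrite inner_vec3 cosB.
transitivity (2 * (r ^+ 2 * c) / (1 + c) * (cos t * cos t' + sin t * sin t') - tau).
  by field.
by rewrite (radius_sqr m3) mulr1.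
Qed.

Lemma boundedN x : bounded (Ngon m) x.
Proof.
exists (\sum_(i : 'I_m) `|inner x (@omega R (Ngon m) i)|); apply: Omega_le => i.
rewrite (bigD1 i) //=; apply: le_trans (ler_norm _) _.
by rewrite lerDl sumr_ge0.
Qed.

(** Half the sum of the nonnegative values at (u + a, X - y) and (u - a, X + y) is the difference of
    the two sides. *)
Lemma bil_dominated eta a X y : max_tensor (Ngon m) eta -> ball (Ngon m) a ->
  pos (Ngon m) (X + y) -> pos (Ngon m) (X - y) -> bil eta a y <= bil eta u X.
Proof.
move=> he [h1 h2] h3 h4.
have := bil_pos he h1 (boundedN _) h4 (boundedN _).
have := bil_pos he h2 (boundedN _) h3 (boundedN _).
by rewrite !bilin; lra.
Qed.

(* X0 and X1 below dominate both signs of b0 + b1 and of b0 - b1 on the cone,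
   and they add up to a multiple of the unit effect. *)
Lemma chsh_assemblage eta a0 a1 mid s (P Q P1 : R) : max_tensor (Ngon m) eta ->
  ball (Ngon m) a0 -> ball (Ngon m) a1 ->
  (forall i : 'I_m, `|4 * cos s / (1 + c) * cos (mid - theta i) - 2 * tau| <=
                    P + Q * cos (mid - theta i)) ->
  (forall i : 'I_m, `|4 * sin s / (1 + c) * sin (mid - theta i)| <=
                    P1 - Q * cos (mid - theta i)) ->
  chsh eta a0 a1 (obv (mid + s)) (obv (mid - s)) <= P + P1.
Proof.
move=> he ha0 ha1 h0 h1; have r0 : r != 0 :> R by rewrite lt0r_neq0 // radius_gt0.
pose X0 : 'cV[R]_3 := vec3 (Q * cos mid / r) (Q * sin mid / r) P.
pose X1 : 'cV[R]_3 := vec3 (- (Q * cos mid / r)) (- (Q * sin mid / r)) P1.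
have X0w t : inner X0 (omv m t) = P + Q * cos (mid - t).
  by rewrite inner_vec3 cosB; field.
have X1w t : inner X1 (omv m t) = P1 - Q * cos (mid - t).
  by rewrite inner_vec3 cosB; field.
have y0w t : inner (obv (mid + s) + obv (mid - s)) (omv m t) =
    4 * cos s / (1 + c) * cos (mid - t) - 2 * tau.
  rewrite innerDl !obv_omv (addrAC mid s) (addrAC mid (- s)) !(cosD (mid - t)) cosN sinN.
  by field.
have y1w t : inner (obv (mid + s) - obv (mid - s)) (omv m t) =
    - (4 * sin s / (1 + c) * sin (mid - t)).
  rewrite innerBl !obv_omv (addrAC mid s) (addrAC mid (- s)) !(cosD (mid - t)) cosN sinN.
  by field.
have b0 : bil eta a0 (obv (mid + s) + obv (mid - s)) <= bil eta u X0.
  apply: bil_dominated => //; apply: pos_omega => i; rewrite ?innerBl ?(innerDl X0);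
    rewrite omega_omv X0w y0w; have := h0 i; rewrite ler_norml => /andP[]; lra.
have b1 : bil eta a1 (obv (mid + s) - obv (mid - s)) <= bil eta u X1.
  apply: bil_dominated => //; apply: pos_omega => i; rewrite ?(innerBl X1) ?(innerDl X1);
    rewrite omega_omv X1w y1w; have := h1 i; rewrite ler_norml => /andP[]; lra.
have X01 : X0 + X1 = (P + P1) *: u.
  by apply/colP => j; rewrite /unit_eff !mxE; case: (ord3 j) => -> /=; ring.
have : bil eta u X0 + bil eta u X1 = P + P1.
  by rewrite -bilDr X01 bilZr (bil_uu he) mulr1.
rewrite /chsh; lra.
Qed.

Lemma linear_ge0 (A B z : R) : - c <= z -> z <= 1 -> 0 <= A - B * c -> 0 <= A + B -> 0 <= A + B * z.
Proof.
move=> z0 z1 h1 h2; have cc := c0.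
have : 0 <= (1 + c) * (A + B * z).
  have -> : (1 + c) * (A + B * z) = (A - B * c) * (1 - z) + (A + B) * (z + c) by ring.
  by rewrite addr_ge0 // mulr_ge0 //; lra.
by rewrite pmulr_rge0 // addr_gt0.
Qed.

(* The parity of d confines e * z to [- c, 1], and the affine majorant on the
   right is chosen to touch the left side at one of the end points. *)
Lemma plane_bound (C e z : R) : e = 1 \/ e = - 1 -> 1 - c <= 2 * C * c -> - c <= e * z -> e * z <= 1 ->
  `|4 * C / (1 + c) * z - 2 * tau| <=
    (2 * C * (1 - tau ^+ 2) + 2 * e * tau ^+ 2) + e * (4 * tau * (C - e) / (1 + c)) * z.
Proof.
move=> he hC z0 z1; have c1 : 0 < 1 + c by rewrite addr_gt0.
have cle : c <= 1 := cos_le1 _.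
have C1 : 1 - c <= 2 * C.
  have C0 : 0 <= C.
    have : 0 <= 2 * C * c by lra.
    by rewrite pmulr_lge0 //; lra.
  have : 2 * C * c <= 2 * C * 1 by apply: ler_wpM2l; lra.
  by lra.
have i0 : 0 < (1 + c)^-1 by rewrite invr_gt0.
have g1 : 0 <= (2 * C * c - (1 - c)) / (1 + c) by rewrite mulr_ge0 ?(ltW i0) //; lra.
have g2 : 0 <= (2 * C - (1 - c)) / (1 + c) by rewrite mulr_ge0 ?(ltW i0) //; lra.
have g3 : 0 <= (2 * C * c + (1 - c)) / (1 + c) by rewrite mulr_ge0 ?(ltW i0) //; lra.
have g4 : 0 <= (2 * C + (1 - c)) / (1 + c) by rewrite mulr_ge0 ?(ltW i0) //; lra.
have -> : z = e * (e * z) by case: he => ->; ring.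
have zee : e * e = 1 by case: he => ->; ring.
move: (e * z) z0 z1 => y y0 y1.
set A := 2 * C * (1 - tau ^+ 2) + 2 * e * tau ^+ 2.
set q := 4 * tau * (C - e) / (1 + c).
have -> : e * q * (e * y) = (e * e) * (q * y) by ring.
rewrite zee mul1r ler_norml; apply/andP; split.
- rewrite -subr_ge0 (_ : _ - - _ = (A - 2 * tau) + (q + 4 * C / (1 + c) * e) * y); last by ring.
  apply: linear_ge0 => //.
    rewrite /A /q; case: he => ->.
      by rewrite [X in 0 <= X](_ : _ = 0) // /tau_of; field.
    rewrite [X in 0 <= X](_ : _ = 4 * ((2 * C * c - (1 - c)) / (1 + c))); last by rewrite /tau_of; field.
    by lra.
  rewrite /A /q; case: he => ->.
    rewrite [X in 0 <= X](_ : _ = 4 * ((2 * C - (1 - c)) / (1 + c))); last by rewrite /tau_of; field.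
    by lra.
  by rewrite [X in 0 <= X](_ : _ = 0) // /tau_of; field.
- rewrite -subr_ge0 (_ : _ - _ = (A + 2 * tau) + (q - 4 * C / (1 + c) * e) * y); last by ring.
  apply: linear_ge0 => //.
    rewrite /A /q; case: he => ->.
      rewrite [X in 0 <= X](_ : _ = 4 * ((2 * C * c + (1 - c)) / (1 + c))); last by rewrite /tau_of; field.
      by lra.
    by rewrite [X in 0 <= X](_ : _ = 0) // /tau_of; field.
  rewrite /A /q; case: he => ->.
    by rewrite [X in 0 <= X](_ : _ = 0) // /tau_of; field.
  rewrite [X in 0 <= X](_ : _ = 4 * ((2 * C + (1 - c)) / (1 + c))); last by rewrite /tau_of; field.
  by lra.
Qed.

End OddGeometry.

Section OddDirections.
Context {R : realType} (m : nat) (m3 : (3 <= m)%N) (m_odd : odd m).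
Local Notation c := (cos (pi / m%:R) : R).
Local Notation theta i := (2 * pi * i%:R / m%:R : R).
Local Notation tau := (tau_of c).
Local Notation ball := (@ball R (Ngon m)).
Implicit Types (a b x y X : 'cV[R]_3) (eta : 'M[R]_3) (t : R).

Lemma obv_period t (z : int) : obv m (t + z%:~R * (2 * pi)) = obv m t.
Proof. by rewrite /obv cosDz2pi sinDz2pi. Qed.

(** The shorter way round from one label to the other: [s] is its orientation and [z] counts full
    turns. *)
Lemma label_difference (i j : 'I_m) : exists (d : nat) (s : bool) (z : int),
  (2 * d < m)%N /\ theta j = theta i + (-1) ^+ s * (2 * (pi * d%:R / m%:R)) + z%:~R * (2 * pi).
Proof.
have main (x y : 'I_m) : (x <= y)%N -> exists (d : nat) (s : bool) (z : int),
    (2 * d < m)%N /\ theta y = theta x + (-1) ^+ s * (2 * (pi * d%:R / m%:R)) + z%:~R * (2 * pi).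
  move=> xy; have mn := @m_neq0 R m m3; have ym := ltn_ord y.
  have [small|big] := ltnP (2 * (y - x)) m.
    exists (y - x)%N, false, 0; split=> //.
    by rewrite natrB // expr0 mul1r mul0r; field.
  exists (m - (y - x))%N, true, 1; split; first by have := odd_double_half m; rewrite m_odd; lia.
  by rewrite natrB ?natrB //; [rewrite expr1; field|lia].
have [ij|/ltnW ji] := leqP i j; first exact: main.
have [d [s [z [hd e]]]] := main _ _ ji; exists d, (~~ s), (- z); split=> //.
by rewrite e intrN signrN; ring.
Qed.

Section Pair.
Variables (d : nat) (s : bool) (k : 'I_m).
Local Notation e := ((-1) ^+ odd d : R).
Local Notation C := (cos (pi * d%:R / m%:R) : R).
Local Notation S := (sin (pi * d%:R / m%:R) : R).
Local Notation pair_angle := (theta k + (-1) ^+ s * (2 * (pi * d%:R / m%:R))).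
Hypothesis hC : 1 - c <= 2 * C * c.

(** [P1] is left free and tested on lattice angles of the right parity only: large polygons use the
    amplitude over all angles, the triangle and the pentagon the exact finite list. *)
Lemma pair_bound eta a0 a1 P1 : max_tensor (Ngon m) eta -> ball a0 -> ball a1 ->
  (forall z : int, odd `|z| = odd d ->
    `|4 * S / (1 + c) * sin (z%:~R * pi / m%:R)| <=
    P1 - e * (4 * tau * (C - e) / (1 + c)) * cos (z%:~R * pi / m%:R)) ->
  `|chsh eta a0 a1 (obv m (theta k)) (obv m pair_angle)| <=
    2 * C * (1 - tau ^+ 2) + 2 * e * tau ^+ 2 + P1.
Proof.
move=> he ha0 ha1 h1.
have he' : e = 1 \/ e = - 1 by case: (odd d); [right|left]; rewrite ?expr1.
pose x : R := - ((-1) ^+ s * (pi * d%:R / m%:R)); pose mid := theta k - x.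
have cx : cos x = C by rewrite /x cosN; case: (s); rewrite ?expr1 ?mulN1r ?cosN ?expr0 ?mul1r.
have sx : `|sin x| = `|S|.
  by rewrite /x sinN normrN; case: (s); rewrite ?expr1 ?mulN1r ?sinN ?normrN ?expr0 ?mul1r.
have -> : theta k = mid + x by rewrite /mid subrK.
have -> : mid + x + (-1) ^+ s * (2 * (pi * d%:R / m%:R)) = mid - x.
  by rewrite /x; ring.
(* In units of pi / m the angle from a vertex to the mid direction has the parity of [d]. *)
pose zi (i : 'I_m) : int := 2 * (k%:Z - i%:Z) + (-1) ^+ s * d%:Z.
have zE (i : 'I_m) : mid - theta i = (zi i)%:~R * pi / m%:R.
  rewrite /mid /x /zi intrD intrM intrB intrM -!pmulrn.
  by case: (s); rewrite ?expr1 ?expr0; field; exact: m_neq0.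
have zodd (i : 'I_m) : odd `|zi i| = odd d.
  by rewrite /zi; case: (s); rewrite ?expr1 ?expr0; lia.
have H a0' a1' : ball a0' -> ball a1' ->
    chsh eta a0' a1' (obv m (mid + x)) (obv m (mid - x)) <=
    2 * C * (1 - tau ^+ 2) + 2 * e * tau ^+ 2 + P1.
  move=> b0 b1; apply: (@chsh_assemblage R m m3 eta a0' a1' mid x _
     (e * (4 * tau * (C - e) / (1 + c))) P1) => // i.
    rewrite cx; apply: plane_bound => //; rewrite zE.
      have := zodd i; case: (odd d) => hz.
        by rewrite expr1 mulN1r lerN2; apply: cos_odd_le; lia.
      by rewrite expr0 mul1r; apply: cos_parity_le; [lia|rewrite hz m_odd].
    have := cos_le1 ((zi i)%:~R * pi / m%:R : R).
    have := cos_geN1 ((zi i)%:~R * pi / m%:R : R).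
    by case: he' => ->; lra.
  apply: le_trans (_ : _ <= _); last by rewrite zE; apply: h1; exact: zodd.
  by rewrite -zE !normrM sx.
rewrite ler_norml H // andbT; set V := _ + P1.
have : chsh eta (- a0) (- a1) (obv m (mid + x)) (obv m (mid - x)) <= V by apply: H; exact: ballN.
by rewrite /chsh !bilNl; lra.
Qed.

Lemma pair_assemblage eta a0 a1 : max_tensor (Ngon m) eta -> ball a0 -> ball a1 ->
  `|chsh eta a0 a1 (obv m (theta k)) (obv m pair_angle)| <= assemblage c C S e.
Proof.
move=> he ha0 ha1; apply: pair_bound => // z _.
set A := 4 * S / (1 + c); set q := 4 * tau * (C - e) / (1 + c).
set x := z%:~R * pi / m%:R.
have ee : e * e = 1 by case: (odd d); rewrite ?expr1; ring.
have B0 : 0 <= Num.sqrt (A ^+ 2 + q ^+ 2) by exact: sqrtr_ge0.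
have B2 : Num.sqrt (A ^+ 2 + q ^+ 2) ^+ 2 = A ^+ 2 + q ^+ 2.
  by rewrite sqr_sqrtr // addr_ge0 ?sqr_ge0.
have h1 : (- (e * q)) ^+ 2 + A ^+ 2 <= Num.sqrt (A ^+ 2 + q ^+ 2) ^+ 2.
  by rewrite B2 (_ : (- (e * q)) ^+ 2 = e * e * q ^+ 2); [rewrite ee; lra|ring].
have h2 : (- (e * q)) ^+ 2 + (- A) ^+ 2 <= Num.sqrt (A ^+ 2 + q ^+ 2) ^+ 2 by rewrite (sqrrN A).
have := harmonic_ge x B0 h1; have := harmonic_ge x B0 h2.
rewrite !mulNr ler_norml; move: (e * q * cos x) (A * sin x) => X Y.
by move=> q1 q2; apply/andP; split; lra.
Qed.

End Pair.

End OddDirections.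

Lemma octant_lt (m d d' : nat) : (4 * d = m + 1)%N \/ (4 * d + 1 = m)%N -> (d' < d)%N ->
  (4 * d' + 3 <= m)%N.
Proof. by case; lia. Qed.

Section Directions.
Context {R : realType}.
Implicit Types (x y : R).

Lemma cos_anti x y : 0 <= x -> x <= y -> y <= pi -> cos y <= cos x.
Proof.
move=> x0; rewrite le_eqVlt => /predU1P[->//|xy yp]; apply: ltW.
by rewrite ltr_cos // in_itv /=; apply/andP; split; lra.
Qed.

Lemma sin_mono x y : - (pi / 2) <= x -> x <= y -> y <= pi / 2 -> sin x <= sin y.
Proof.
move=> x0; rewrite le_eqVlt => /predU1P[->//|xy yp]; apply: ltW.
by rewrite ltr_sin // in_itv /=; apply/andP; split; lra.
Qed.

Variables (m : nat).
Hypotheses (m3 : (3 <= m)%N) (m_odd : odd m).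
Local Notation c := (cos (pi / m%:R) : R).
Local Notation angle d := (pi * d%:R / m%:R : R).

Let mp : 0 < m%:R :> R. Proof. exact: m_gt0. Qed.
Let mn : m%:R != 0 :> R. Proof. exact: m_neq0. Qed.

Lemma angle_le (d d' : nat) : (d <= d')%N -> angle d <= angle d'.
Proof.
by move=> h; rewrite ler_pM2r ?invr_gt0 // ler_pM2l ?pi_gt0 // ler_nat.
Qed.

Lemma angle_ge0 (d : nat) : 0 <= angle d.
Proof. by rewrite divr_ge0 ?mulr_ge0 ?pi_ge0. Qed.

(** With h = pi / (2 m), 1 - c is 2 (sin h)^2, and both cosines on the right are at least sin h
    since the angles stay below pi / 2 - h. *)
Lemma direction_bound (d : nat) : (2 * d < m)%N -> 1 - c <= 2 * cos (angle d) * c.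
Proof.
move=> hd; have p0 := @pi_gt0 R; have [h hE] : exists h : R, h = pi / (2 * m%:R) by exists (pi / (2 * m%:R)).
have h0 : 0 < h by rewrite hE divr_gt0 // mulr_gt0.
have h6 : h <= pi / 6.
  rewrite hE ler_pM2l // lef_pV2 ?posrE ?mulr_gt0 //.
  by have : (3%:R : R) <= m%:R; [rewrite ler_nat|lra].
have ch : c = cos (h + h) by congr cos; rewrite hE; field.
have sc : sin h <= c.
  rewrite ch -cosBpihalf -cosN; apply: cos_anti; lra.
have sC : sin h <= cos (angle d).
  rewrite -cosBpihalf -cosN; apply: cos_anti.
  - exact: angle_ge0.
  - have -> : - (h - pi / 2) = pi * (m%:R - 1) / (2 * m%:R) by rewrite hE; field.
    have -> : angle d = pi * (2 * d%:R) / (2 * m%:R) by field.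
    rewrite ler_pM2r ?invr_gt0 ?mulr_gt0 // ler_pM2l // -natrM.
    have : ((2 * d).+1%:R : R) <= m%:R by rewrite ler_nat.
    by rewrite -natr1; lra.
  - lra.
have s0 : 0 <= sin h by apply: sin_ge0_pi; lra.
have -> : 1 - c = 2 * (sin h * sin h).
  by have h1 := cos2sin2 h; rewrite ch cosD; ring: h1.
by have := ler_pM s0 s0 sC sc; lra.
Qed.

Section Generic.
Variables (d : nat) (o : R).
Hypotheses (m7 : (7 <= m)%N) (ho : ((4 * d = m + 1)%N /\ o = 1) \/ ((4 * d + 1 = m)%N /\ o = - 1)).
Local Notation k := (pi / (4 * m%:R) : R).

Let p0 : 0 < pi :> R. Proof. exact: pi_gt0. Qed.

Lemma orientation : o = 1 \/ o = - 1. Proof. by case: ho => -[_]; [left|right]. Qed.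

Lemma k_gt0 : 0 < k. Proof. by rewrite divr_gt0 // mulr_gt0. Qed.

Lemma k_le (N : nat) : (0 < N <= m)%N -> k <= pi / 4 / N%:R.
Proof.
move=> /andP[N0 Nm]; have NR : (0 : R) < N%:R by rewrite ltr0n.
have -> : k = pi / 4 / m%:R by field.
by apply: ler_wpM2l; [rewrite divr_ge0 // ltW|rewrite lef_pV2 ?posrE // ler_nat].
Qed.

Lemma sin_k_le (N : nat) : (0 < N <= m)%N -> sin k <= 4 / 5 / N%:R.
Proof.
move=> hN; have /andP[N0 _] := hN; have NR : (0 : R) < N%:R by rewrite ltr0n.
apply: le_trans (sin_le_id (ltW k_gt0)) _; apply: le_trans (k_le hN) _.
by apply: ler_wpM2r; [rewrite invr_ge0 ltW|have := @pi_lt R; lra].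
Qed.

Lemma quarter_facts : [/\ 0 <= cos k, 0 < sin k, sin k <= 4 / 35 & k <= pi / 28].
Proof.
have kp := k_gt0; have k7 : k <= pi / 4 / 7%:R by apply: k_le.
split; [|by apply: sin_gt0_pi; lra| |by lra].
  by apply/ltW/cos_gt0_pihalf; lra.
by have : sin k <= 4 / 5 / 7%:R; [exact: sin_k_le|lra].
Qed.

Lemma four_k : k *+ 4 = pi / m%:R. Proof. by rewrite -mulr_natl; field. Qed.

(** For m = 7 and m = 9 the nearest integer is 2, so odd [d] leaves m >= 11. *)
Lemma sin_k_le_of_odd : odd d -> sin k <= 4 / 55.
Proof.
move=> od; have h : (0 < 11 <= m)%N by move: ho od m7; clear; lia.
by apply: le_trans (sin_k_le h) _; lra.
Qed.

Lemma off_direction (d' : nat) (e sg : R) : d' != d -> (0 < d')%N -> (2 * d' < m)%N ->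
  e = 1 \/ e = - 1 -> sg = 1 \/ sg = - 1 ->
  assemblage c (cos (angle d')) (sin (angle d')) e <= optimum k o sg.
Proof.
move=> dd d0 dm he hsg; have [a0 b0 b1 k28] := quarter_facts; have kp := k_gt0.
have [sw w2 w3 w4] := @quarter_cos R; have ho' := orientation.
have [eps eps_def] : exists eps : R, eps = angle d' - pi / 4 by exists (angle d' - pi / 4).
have a_gt0 := angle_ge0 d'.
have a_lt : angle d' <= pi / 2.
  have em : angle m = pi by rewrite mulfK.
  have : angle (2 * d') <= angle m by apply: angle_le; exact: ltnW.
  by rewrite em natrM; lra.
have eps_a : angle d' = pi / 4 + eps by rewrite eps_def; ring.
have epsE : eps = (4 * d'%:R - m%:R) * k by rewrite eps_def; field.
have hC : cos (angle d') = cos (pi / 4) * (cos eps - sin eps) by rewrite eps_a cosD sw; ring.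
have hS : sin (angle d') = cos (pi / 4) * (cos eps + sin eps) by rewrite eps_a sinD sw; ring.
have C0 : 0 <= cos (angle d') by apply: cos_ge0_pihalf; lra.
have S0 : 0 <= sin (angle d') by apply: sin_ge0_pi; lra.
have C1 := cos_le1 (angle d'); have S1 := sin_le1 (angle d').
have [lt|gt] := ltnP d' d.
  have he3 : eps <= - (k *+ 3).
    rewrite epsE -(mulr_natl k) -mulNr ler_pM2r //.
    have : (4 * d' + 3 <= m)%N by apply: octant_lt lt; case: ho => -[]; [left|right].
    by rewrite -(ler_nat R) natrD natrM; lra.
  rewrite -four_k; apply: (assemblage_left ho' a0 b0 b1 hC hS he hsg C0) => //.
  - by rewrite -(cosN eps); apply: cos_anti; [by rewrite mulrn_wge0 // ltW|lra|rewrite eps_def; lra].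
  - rewrite -sinN; apply: sin_mono => //; first by rewrite eps_def; lra.
    have : 0 <= k *+ 3 by rewrite mulrn_wge0 // ltW.
    by lra.
  - rewrite four_k -[pi / m%:R](_ : angle 1 = _); last by rewrite mulr1.
    apply: sin_mono => //; last exact: angle_le.
    by have := angle_ge0 1; lra.
have {gt}dd' : (d < d')%N by rewrite ltn_neqAle eq_sym dd.
have CS1 : 1 <= cos (angle d') + sin (angle d').
  have := cos2Dsin2 (angle d'); have := mulr_ge0 C0 S0; nra.
have k0' : 0 <= k *+ 3 by rewrite mulrn_wge0 // ltW.
have k0'' : 0 <= k *+ 4 by rewrite mulrn_wge0 // ltW.
have right : 0 <= eps -> cos (angle d') <= cos (pi / 4) /\ cos (pi / 4) <= sin (angle d').
  rewrite eps_def subr_ge0 => h; split; first by apply: cos_anti => //; lra.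
  by rewrite -sw; apply: sin_mono => //; lra.
case: ho => -[hd o1].
  have e5 : k *+ 4 <= eps.
    rewrite epsE -(mulr_natl k) ler_pM2r //.
    have : (4 + m <= 4 * d')%N by move: dd' hd; clear; lia.
    by rewrite -(ler_nat R) natrD natrM; lra.
  rewrite -four_k; apply: (assemblage_right_far ho' a0 b0 b1 hC hS he hsg C0) => //.
  - by rewrite eps_def; lra.
  - by case: right => //; exact: le_trans e5.
  - by case: right => //; exact: le_trans e5.
have e3 : k *+ 3 <= eps.
  rewrite epsE -(mulr_natl k) ler_pM2r //.
  have : (3 + m <= 4 * d')%N by move: dd' hd; clear; lia.
  by rewrite -(ler_nat R) natrD natrM; lra.
have b2 : sin k <= 4 / 45.
  by have : sin k <= 4 / 5 / 9%:R; [apply: sin_k_le; move: hd m7; clear; lia|lra].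
rewrite -four_k; apply: (assemblage_right_near ho' a0 b0 b1 hC hS he hsg C0 o1 b2) => //.
- by rewrite eps_def; lra.
- by case: right => //; exact: le_trans e3.
- by case: right => //; exact: le_trans e3.
Qed.

End Generic.

End Directions.

(** * States as trigonometric forms *)

Section StateForm.
Context {R : realType} (m : nat) (m3 : (3 <= m)%N) (m_odd : odd m).
Local Notation r := (@Defs.radius R m).
Local Notation c := (cos (pi / m%:R) : R).
Local Notation theta i := (2 * pi * i%:R / m%:R : R).
Local Notation tau := (tau_of c).
Local Notation defect := ((1 - c) / c : R).
Implicit Types (eta : 'M[R]_3) (al be : R).

Let c0 : 0 < c. Proof. exact: c_gt0. Qed.
Let cn : c != 0. Proof. exact: lt0r_neq0. Qed.
Let nc1 : 1 + c != 0. Proof. by rewrite lt0r_neq0 // addr_gt0. Qed.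
Let rn : r != 0 :> R. Proof. by rewrite lt0r_neq0 // radius_gt0. Qed.
Let rc : r ^+ 2 * c = 1. Proof. exact: radius_sqr. Qed.

Definition state_form eta : form := Form (eta o0 o2 / r) (eta o1 o2 / r)
  (eta o2 o0 / r) (eta o2 o1 / r)
  ((eta o0 o0 + eta o1 o1) / 2) ((eta o1 o0 - eta o0 o1) / 2)
  ((eta o0 o0 - eta o1 o1) / 2) ((eta o1 o0 + eta o0 o1) / 2).

Lemma bil_vec3 eta x y z x' y' z' : bil eta (vec3 x y z) (vec3 x' y' z') =
  x * (eta o0 o0 * x' + eta o0 o1 * y' + eta o0 o2 * z') +
  y * (eta o1 o0 * x' + eta o1 o1 * y' + eta o1 o2 * z') +
  z * (eta o2 o0 * x' + eta o2 o1 * y' + eta o2 o2 * z').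
Proof. by rewrite bilE innerE !mxE !sum3 !mxE. Qed.

Lemma unit_entry eta : max_tensor (Ngon m) eta -> eta o2 o2 = 1.
Proof. by move=> /bil_uu; rewrite /unit_eff bil_vec3; lra. Qed.

Lemma bil_omv eta al be : max_tensor (Ngon m) eta ->
  bil eta (omv m al) (omv m be) = r ^+ 2 * fL m (state_form eta) al be.
Proof.
move=> /unit_entry e1; rewrite /fL.
rewrite [RHS](_ : _ = r ^+ 2 * c + r ^+ 2 * (fP (state_form eta) al + fQ (state_form eta) be +
  fX (state_form eta) al be)); last by ring.
rewrite rc -e1 /omv bil_vec3 /fP /fQ /fX /=.
by rewrite cosB sinB cosD sinD; field.
Qed.

(** This is where the local terms of the state enter, with the defect as weight; the identity gives
    tau^2 + (1 - tau^2) cos(al - be). *)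
Lemma bil_obv eta al be : max_tensor (Ngon m) eta ->
  bil eta (obv m al) (obv m be) = tau ^+ 2 + (1 - tau ^+ 2) *
   (fX (state_form eta) al be - defect / 2 * (fP (state_form eta) al + fQ (state_form eta) be)).
Proof.
move=> /unit_entry e1; have rE : c = (r ^+ 2)^-1 by apply: (mulfI (expf_neq0 2 rn)); rewrite rc mulfV // expf_neq0.
have n1 : 1 + r ^+ 2 != 0 by rewrite lt0r_neq0 // ltr_wpDr // sqr_ge0.
rewrite /obv bil_vec3 e1 /fP /fQ /fX /= /tau_of rE.
rewrite cosB sinB cosD sinD; field.
by rewrite rn addrC n1.
Qed.

(** Self-duality of the odd polygon: its vertices are also elements of the effect cone, so a state
    can be evaluated on pairs of them. *)
Lemma omv_pos (z : int) : @pos R (Ngon m) (omv m (z%:~R * (2 * pi / m%:R))).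
Proof.
apply: pos_omega => i; rewrite omega_omv inner_vec3.
have -> : r * cos (z%:~R * (2 * pi / m%:R)) * (r * cos (theta i)) +
  r * sin (z%:~R * (2 * pi / m%:R)) * (r * sin (theta i)) + 1 * 1 =
  r ^+ 2 * (cos (z%:~R * (2 * pi / m%:R) - theta i) + c).
  by rewrite (mulrDr (r ^+ 2)) rc cosB; ring.
apply: mulr_ge0; first exact: sqr_ge0.
have -> : z%:~R * (2 * pi / m%:R) - theta i = (2 * (z - i%:Z))%:~R * pi / m%:R.
  by rewrite intrM intrB -!pmulrn; field; exact: m_neq0.
by rewrite addrC -lerBlDl sub0r; apply: cos_parity_le; [lia|rewrite m_odd; lia].
Qed.

Lemma state_form_pos eta : max_tensor (Ngon m) eta -> positive_form m (state_form eta).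
Proof.
move=> he al be [z ->] [z' ->].
have := bil_pos he (omv_pos z) (@boundedN R m _) (omv_pos z') (@boundedN R m _).
by rewrite bil_omv // pmulr_rge0 // exprn_gt0 // radius_gt0.
Qed.

End StateForm.

(** For sg = 1 the factor 1 - cos s is at most 1/2 and half the gain suffices; for sg = -1 the full
    gain is taken, hence the stronger condition. *)
Lemma half_gain_bound (R : realType) (G s sg far : R) : sg = 1 \/ sg = - 1 -> 0 <= G ->
  1 / 2 <= cos s -> G <= far -> (sg = - 1 -> 2 * G <= far) ->
  exists B, [/\ 0 <= B, G ^+ 2 * (1 - sg * cos s) <= 2 * B ^+ 2 & 2 * B <= far].
Proof.
move=> hsg G0 s3 h1 h2; have gg : 0 <= G ^+ 2 := sqr_ge0 G.
case: hsg h2 => -> h2.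
  exists (G / 2); split; [lra| |by rewrite mulrC divfK].
  by have := ler_wpM2l gg s3; rewrite expr_div_n; lra.
exists G; split=> //; last exact: h2.
by have := ler_wpM2l gg (cos_le1 s); lra.
Qed.

Section Diagonal.
Context {R : realType} (m : nat) (m3 : (3 <= m)%N) (m_odd : odd m).
Local Notation c := (cos (pi / m%:R) : R).
Local Notation theta i := (2 * pi * i%:R / m%:R : R).
Local Notation tau := (tau_of c).
Local Notation defect := ((1 - c) / c : R).
Local Notation angle d := (pi * d%:R / m%:R : R).
Implicit Types (eta : 'M[R]_3) (al be : R).

(* The pair of directions of B is centred at the midpoint of its two labels, or
   at the antipode of the midpoint when the midpoint is not a lattice angle. *)
Lemma corner_pair eta (d : nat) (b b' : bool) (i k : 'I_m)
    (s := angle d) (sg := (-1) ^+ odd d : R) : max_tensor (Ngon m) eta ->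
  exists2 f, positive_form m f &
    sg * chsh eta (obv m (theta i)) (obv m (theta i + (-1) ^+ b * (2 * s)))
                  (obv m (theta k)) (obv m (theta k + (-1) ^+ b' * (2 * s))) =
    2 * sg * tau ^+ 2 +
    (1 - tau ^+ 2) * (corner f s - defect * (sg * fP f 0 + fQ f s)).
Proof.
(* The midpoint [s] is a lattice angle only for even [d]; since [m] is odd, adding pi repairs the
   parity and multiplies all first harmonics by [sg]. *)
move=> he; pose rho : R := if odd d then pi else 0.
have mn := @m_neq0 R m m3.
have lsr : lattice m (s + rho).
  rewrite /rho /s; case: ifP => od.
    exists ((d + m)./2)%:Z; rewrite -pmulrn.
    have e : ((d + m)./2)%:R * 2 = d%:R + m%:R :> R.
      by rewrite -natrM -natrD; congr _%:R; have := odd_double_half (d + m); rewrite oddD od m_odd; lia.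
    by transitivity ((d%:R + m%:R) * pi / m%:R : R); [field|rewrite -e; ring].
  exists (d./2)%:Z; rewrite -pmulrn addr0.
  have e : (d./2)%:R * 2 = d%:R :> R.
    by rewrite -natrM; congr _%:R; have := odd_double_half d; rewrite od; lia.
  by rewrite -e; ring.
pose y := theta k + (-1) ^+ b' * (s + rho).
have ly : lattice m y by apply: latticeD; [exact: lattice_theta|exact: lattice_sign].
have lx : lattice m (theta i) by exact: lattice_theta.
have [f pf fE] := relabel b (~~ b') lx ly (state_form_pos m3 m_odd he).
have turn (x : R) : cos (x + (-1) ^+ b' * rho) = sg * cos x /\
    sin (x + (-1) ^+ b' * rho) = sg * sin x.
  rewrite /rho /sg; case: (odd d); last by rewrite expr0 mulr0 addr0 !mul1r.
  rewrite expr1 !mulN1r; case: (b'); rewrite ?expr1 ?expr0 ?mulN1r ?mul1r.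
    by rewrite cosB sinB cospi sinpi; split; ring.
  by rewrite cosDpi sinDpi.
have turnX g x z : fX g x (z + (-1) ^+ b' * rho) = sg * fX g x z.
  have [e1 e2] := turn z; rewrite /fX !(cosB x) !(sinB x) !(cosD x) !(sinD x) e1 e2; ring.
have turnQ g z : fQ g (z + (-1) ^+ b' * rho) = sg * fQ g z.
  by have [e1 e2] := turn z; rewrite /fQ e1 e2; ring.
have y1 : y + (-1) ^+ (~~ b') * s = theta k + (-1) ^+ b' * rho by rewrite /y signrN; ring.
have y2 : y + (-1) ^+ (~~ b') * - s = theta k + (-1) ^+ b' * (2 * s) + (-1) ^+ b' * rho.
  by rewrite /y signrN; ring.
exists f => //; rewrite chshE !(bil_obv m3) // /corner.
have [-> -> ->] := fE 0 s; have [_ _ ->] := fE 0 (- s).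
have [_ _ ->] := fE (2 * s) s; have [_ _ ->] := fE (2 * s) (- s).
rewrite y1 y2 !turnX turnQ mulr0 addr0.
by field; rewrite lt0r_neq0 // c_gt0.
Qed.

Variables (d : nat) (o : R).
Hypotheses (m7 : (7 <= m)%N) (ho : ((4 * d = m + 1)%N /\ o = 1) \/ ((4 * d + 1 = m)%N /\ o = - 1)).
Local Notation k4m := (pi / (4 * m%:R) : R).

Lemma diagonal_bound eta (b b' : bool) (i k : 'I_m)
    (s := angle d) (sg := (-1) ^+ odd d : R) : max_tensor (Ngon m) eta ->
  `|chsh eta (obv m (theta i)) (obv m (theta i + (-1) ^+ b * (2 * s)))
             (obv m (theta k)) (obv m (theta k + (-1) ^+ b' * (2 * s)))| <=
  optimum k4m o sg.
Proof.
move=> he; have [f pf] := corner_pair d b b' i k he; rewrite -/s -/sg.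
set X := chsh _ _ _ _ _ => hX.
have m5 : (5 <= m)%N by lia.
have mn := @m_neq0 R m m3.
have hsg : sg = 1 \/ sg = - 1 by rewrite /sg; case: (odd d); [right|left].
have [a0 b0 b1 _] := @quarter_facts R m m3 m7; have ho' := orientation ho.
have e4 := @four_k R m m3.
have e2 : k4m *+ 2 = pi / (2 * m%:R) by rewrite -(mulr_natl k4m); field.
have sE : s = pi / 4 + o * k4m.
  have dE : d%:R = (m%:R + o) / 4.
    case: ho => -[hd ->]; have := congr1 (fun n => n%:R : R) hd; rewrite ?natrM ?natrD ?natrM; lra.
  by rewrite /s dE; field.
have s_def : s *+ 2 = pi / 2 + o * (pi / (2 * m%:R)).
  by rewrite -(mulr_natl s) sE; field.
have [s1 s2 s3 s4 s5] := trig_s_bounds ho' a0 b0 b1.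
have [al1 al2] := aligned_conditions ho' a0 b0 b1.
have [t0 t1 _] := tau_small a0 b0 b1.
have [G0 _] := gain_bounds a0 b0 b1.
have [op1 op2 op3 op4] := opposed_conditions ho' a0 b0 b1.
have sharp : sg = - 1 -> sin k4m <= 4 / 55.
  rewrite /sg; case od : (odd d); first by move=> _; exact: sin_k_le_of_odd ho od.
  by move/eqP; rewrite expr0 -subr_eq0 opprK -mulr2n pnatr_eq0.
have := opposed_value ho' a0 b0 b1 hsg.
rewrite -sE e4 e2 in s1 s2 s3 s4 s5 al1 al2 t0 t1 G0 op1 op2 op3 op4 *.
move=> opt.
have t2 : 0 <= 1 - tau ^+ 2.
  by rewrite subr_ge0 expr_le1 ?(ltW t0) // (le_trans t1) // ler_pdivrMr // mul1r ler1n.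
have up : sg * X <= optimum k4m o sg.
  rewrite hX /optimum -sE e4 addrC lerD2r; apply: (ler_wpM2l t2).
  by have := aligned_bound m5 m_odd ho' hsg s_def pf al1 al2.
have down : - (sg * X) <= optimum k4m o sg.
  rewrite hX /optimum -sE e4; apply: le_trans opt; rewrite opprD addrC lerD2r -mulrN opprB.
  apply: (ler_wpM2l t2); rewrite -op4.
  have [B [B0 hB1 hB2]] := half_gain_bound hsg G0 s3 op1 (fun e => op2 (sharp e)).
  by have := opposed_bound m5 m_odd ho' hsg s_def pf B0 hB1 hB2 op3.
have <- : `|sg * X| = `|X|.
  by rewrite normrM; case: hsg => ->; rewrite ?normrN normr1 mul1r.
by rewrite ler_norml up andbT lerNl.
Qed.

End Diagonal.

Section OddPolygon.
Context {R : realType} (m : nat) (m3 : (3 <= m)%N) (m_odd : odd m).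
Local Notation c := (cos (pi / m%:R) : R).
Local Notation theta i := (2 * pi * i%:R / m%:R : R).
Local Notation tau := (tau_of c).
Local Notation angle d := (pi * d%:R / m%:R : R).
Local Notation u := (@unit_eff R).
Local Notation ob i := (@obs R (Ngon m) i).
Local Notation om i := (@omega R (Ngon m) i).
Local Notation ball := (@ball R (Ngon m)).
Implicit Types (eta T : 'M[R]_3) (a : 'cV[R]_3) (t al be V : R).

Let oball (i : 'I_m) : ball (ob i). Proof. exact: (@obs_ball R (Ngon m) (eff_effectN m3) i). Qed.

(** Equal labels give at most 2, a distance other than [d] on either side is covered by the first
    bound (after a transpose for the first party), and the second bound treats distance [d] on both
    sides. *)
Lemma chsh_labels eta V (d : nat) : max_tensor (Ngon m) eta -> 2 <= V ->
  (forall eta' a0 a1 (d' : nat) (s : bool) (k : 'I_m), max_tensor (Ngon m) eta' ->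
    ball a0 -> ball a1 -> d' != d -> (0 < d')%N -> (2 * d' < m)%N ->
    `|chsh eta' a0 a1 (obv m (theta k)) (obv m (theta k + (-1) ^+ s * (2 * angle d')))| <= V) ->
  (forall (b b' : bool) (i k : 'I_m),
    `|chsh eta (obv m (theta i)) (obv m (theta i + (-1) ^+ b * (2 * angle d)))
               (obv m (theta k)) (obv m (theta k + (-1) ^+ b' * (2 * angle d)))| <= V) ->
  forall i j k l : 'I_m, `|chsh eta (ob i) (ob j) (ob k) (ob l)| <= V.
Proof.
move=> he V2 hoff hdiag i j k l.
have same eta' a0 a1 (x : 'I_m) : max_tensor (Ngon m) eta' -> ball a0 ->
    `|chsh eta' a0 a1 (ob x) (ob x)| <= V.
  move=> he' ha0; apply: le_trans V2; rewrite chshE addrK.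
  rewrite (_ : bil eta' a0 (ob x) + _ = 2 * bil eta' a0 (ob x)); last by ring.
  rewrite normrM normr_nat -[leRHS]mulr1 ler_pM2l //.
  exact: (bil_ball_norm he' ha0 (oball x)).
have [d1 [s1 [z1 [hd1 e1]]]] := @label_difference R m m3 m_odd k l.
have [d2 [s2 [z2 [hd2 e2]]]] := @label_difference R m m3 m_odd i j.
have el : ob l = obv m (theta k + (-1) ^+ s1 * (2 * angle d1)).
  by rewrite (obs_obv m3 m_odd) e1 obv_period.
have ej : ob j = obv m (theta i + (-1) ^+ s2 * (2 * angle d2)).
  by rewrite (obs_obv m3 m_odd) e2 obv_period.
have [d10|d10] := posnP d1.
  suff -> : ob l = ob k by exact: same he (oball i).
  by rewrite el d10 mulr0 mul0r !mulr0 addr0 -(obs_obv m3 m_odd).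
have [d1d|d1d] := eqVneq d1 d; last by rewrite el (obs_obv m3 m_odd k); apply: hoff.
have [d20|d20] := posnP d2.
  suff -> : ob j = ob i by rewrite chsh_tr; exact: same (max_tensor_tr he) (oball k).
  by rewrite ej d20 mulr0 mul0r !mulr0 addr0 -(obs_obv m3 m_odd).
have [d2d|d2d] := eqVneq d2 d; last first.
  by rewrite chsh_tr ej (obs_obv m3 m_odd i); apply: hoff => //; exact: max_tensor_tr.
by rewrite el ej (obs_obv m3 m_odd i) (obs_obv m3 m_odd k) d1d d2d; apply: hdiag.
Qed.

Lemma lattice_label t : lattice m t -> exists i : 'I_m, ob i = obv m t.
Proof.
move=> [z ->]; have [i hi] := @label_angle R m m3 z; exists i.
by rewrite (obs_obv m3 m_odd) /obv -[theta i]add0r -[z%:~R * _]add0r; have [-> ->] := hi 0.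
Qed.

Lemma obv_ball t : lattice m t -> ball (obv m t).
Proof. by move=> /lattice_label[i <-]. Qed.

Lemma lattice_shift (i : 'I_m) (b : bool) (d : nat) :
  lattice m (theta i + (-1) ^+ b * (2 * angle d)).
Proof.
apply: latticeD; [exact: lattice_theta|apply: lattice_sign].
by exists d%:Z; rewrite -pmulrn; ring.
Qed.

Lemma obv_obv al be : inner (obv m be) (obv m al) = tau ^+ 2 + (1 - tau ^+ 2) * cos (al - be).
Proof.
have rc := @radius_sqr R m m3.
have n1 : 1 + c != 0 by rewrite lt0r_neq0 // addr_gt0 // c_gt0.
rewrite cosB inner_vec3.
transitivity (4 * (Defs.radius m ^+ 2 * c) * c / (1 + c) ^+ 2 *
   (cos al * cos be + sin al * sin be) + tau ^+ 2); first by field.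
by rewrite rc /tau_of; field.
Qed.

Section Attainment.
Variables (T eta : 'M[R]_3).
Hypotheses (hT : GL (Ngon m) T) (hhat : is_hat eta T).

(** Up to relabelling the first party, the symmetry [T] behaves like the identity: [T] fixes [u] and
    permutes vertices, and an observable is a combination of [u] and one vertex. *)
Lemma attained t : lattice m t -> exists i : 'I_m, forall al,
  bil eta (ob i) (obv m al) = tau ^+ 2 + (1 - tau ^+ 2) * cos (t - al).
Proof.
move=> lt; have [j ej] := lattice_label lt; have [i Ti] := GL_preimageN j hT; exists i => al.
have Tu := GL_unitN m3 hT.
have obE (x : 'I_m) : ob x = (2 * (c / (1 + c))) *: om x - (2 * (c / (1 + c)) + tau) *: u.
  rewrite (obs_obv m3 m_odd) /obv omega_omv /unit_eff.
  by apply/colP => q; rewrite !mxE; case: (ord3 q) => -> /=; ring.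
have -> : bil eta (ob i) (obv m al) = inner (obv m al) (T *m ob i) by rewrite hhat.
by rewrite obE mulmxBr -!scalemxAr Ti Tu -obE ej obv_obv.
Qed.

Lemma attained_ge2 : exists i j k l : 'I_m, 2 <= `|chsh eta (ob i) (ob j) (ob k) (ob l)|.
Proof.
have j : 'I_m by exists 0%N; lia.
have [i hi] := attained (lattice_theta m j); exists i, i, j, j.
rewrite chshE (obs_obv m3 m_odd j) hi subrr cos0.
have -> : forall x : R, x + x + x - x = 2 * x by move=> x; ring.
rewrite (_ : _ + _ = 1); last by ring.
by rewrite mulr1 ger0_norm.
Qed.

(** The settings are those of [corner], the second party being turned by [rho] so that its angles
    are lattice angles. *)
Lemma attained_steps (d : nat) (s := angle d) (sg := (-1) ^+ odd d : R) :
  exists i j k l : 'I_m,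
    (1 - tau ^+ 2) * steps s + 2 * sg * tau ^+ 2 <= `|chsh eta (ob i) (ob j) (ob k) (ob l)|.
Proof.
have mn := @m_neq0 R m m3; pose rho : R := if odd d then pi else 0.
have lsr (n : nat) : lattice m (angle ((2 * n + odd d) * m + d)) .
  exists (((2 * n + odd d) * m + d)./2)%:Z; rewrite -pmulrn.
  have e : (((2 * n + odd d) * m + d)./2)%:R * 2 = ((2 * n + odd d) * m + d)%:R :> R.
    rewrite -natrM; congr _%:R; have := odd_double_half ((2 * n + odd d) * m + d).
    by rewrite oddD oddM oddD m_odd mul2n odd_double /=; case: (odd d) => /=; lia.
  by rewrite -e; field.
have l1 : lattice m (s + rho).
  have := lsr 0; rewrite muln0 add0n natrD natrM /s /rho; case: (odd d) => /=.
    by rewrite mul1r; congr lattice; field.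
  by rewrite mul0r add0r addr0.
have l2 : lattice m (2 * s) by exists d%:Z; rewrite -pmulrn /s; ring.
have l0 : lattice m (0 : R) by exists 0; rewrite mul0r.
have l3 : lattice m (rho - s).
  rewrite (_ : rho - s = s + rho - 2 * s); last by ring.
  by apply: latticeD l1 _; exact: latticeN.
have [i hi] := attained l0; have [j hj] := attained l2.
have [k hk] := lattice_label l1; have [l hl] := lattice_label l3.
have turn (x : R) : cos (x - rho) = sg * cos x.
  rewrite /rho /sg; case: (odd d); last by rewrite subr0 expr0 mul1r.
  by rewrite cosB cospi sinpi expr1; ring.
exists i, j, k, l; rewrite chshE hk hl !hi !hj.
have -> : 0 - (s + rho) = - s - rho by ring.
have -> : 0 - (rho - s) = s - rho by ring.
have -> : 2 * s - (s + rho) = s - rho by ring.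
have -> : 2 * s - (rho - s) = 3 * s - rho by ring.
rewrite !turn cosN; set X := (X in _ <= `|X|).
have -> : (1 - tau ^+ 2) * steps s + 2 * sg * tau ^+ 2 = sg * X.
  have ss : sg * sg = 1 by rewrite /sg; case: (odd d); ring.
  by rewrite /X /steps; move: (cos s) (cos (3 * s)) (tau ^+ 2) => x y t; ring: ss.
apply: le_trans (ler_norm _) _; rewrite normrM /sg.
by case: (odd d); rewrite ?expr1 ?expr0 ?normrN normr1 mul1r.
Qed.

End Attainment.

Lemma large_polygon_bound eta (d : nat) (o : R) V : (7 <= m)%N ->
  ((4 * d = m + 1)%N /\ o = 1) \/ ((4 * d + 1 = m)%N /\ o = - 1) ->
  max_tensor (Ngon m) eta -> 2 <= V ->
  (1 - tau ^+ 2) * steps (angle d) + 2 * (-1) ^+ odd d * tau ^+ 2 <= V ->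
  forall i j k l : 'I_m, `|chsh eta (ob i) (ob j) (ob k) (ob l)| <= V.
Proof.
move=> m7 ho he V2 hV; have mn := @m_neq0 R m m3.
have opt : optimum (pi / (4 * m%:R)) o ((-1) ^+ odd d) <= V.
  apply: le_trans hV; rewrite /optimum (four_k m3) (_ : pi / 4 + _ = angle d) //.
  have -> : d%:R = (m%:R + o) / 4.
    by case: ho => -[hd ->]; have := congr1 (fun n => n%:R : R) hd;
      rewrite ?natrM ?natrD ?natrM; lra.
  by field.
apply: (chsh_labels he V2 (d := d)) => [eta' a0 a1 d' s k he' ha0 ha1 dd d0 dm|b b' i k].
  apply: le_trans opt.
  have hC := @direction_bound R m m3 d' dm.
  apply: le_trans (pair_assemblage m3 m_odd s k hC he' ha0 ha1) _.
  by apply: (off_direction m3 m7 ho dd d0 dm); [case: (odd d')|case: (odd d)];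
    rewrite ?expr1; [right|left|right|left].
by apply: le_trans opt; exact: diagonal_bound.
Qed.

End OddPolygon.

(** * The triangle and the pentagon *)

Section SmallPolygons.
Context {R : realType}.
Implicit Types (eta : 'M[R]_3) (V x : R).

Lemma cos_mulr3n x : cos (3 * x) = cos x * (4 * cos x ^+ 2 - 3).
Proof.
rewrite (_ : 3 * x = x *+ 3); last by rewrite mulr_natl.
by have [_ ->] := triple_angle x; rewrite sin2cos2; ring.
Qed.

Lemma cos_mulr5n x : cos (5 * x) = cos x * (16 * cos x ^+ 4 - 20 * cos x ^+ 2 + 5).
Proof.
rewrite (_ : 5 * x = x *+ 3 + x *+ 2); last by rewrite -mulrnDr mulr_natl.
have [s3 c3] := triple_angle x; have [s2 c2 _ _] := multiple_angles x.
rewrite cosD s3 c3 s2 c2; have := sin2cos2 x; move: (sin x) (cos x) => S C h.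
by ring: h.
Qed.

Lemma cos_oddpi (z : int) : odd `|z| -> cos (z%:~R * pi) = - 1 :> R.
Proof.
move=> oz; have -> : z%:~R * pi = pi + ((z - 1) %/ 2)%Z%:~R * (2 * pi) :> R.
  have -> : z%:~R = (1 + ((z - 1) %/ 2)%Z * 2)%:~R :> R by congr _%:~R; lia.
  by rewrite intrD intrM; ring.
by rewrite cosDz2pi cospi.
Qed.

Lemma cos_evenpi (z : int) : ~~ odd `|z| -> cos (z%:~R * pi) = 1 :> R.
Proof.
move=> oz; have -> : z%:~R * pi = 0 + (z %/ 2)%Z%:~R * (2 * pi) :> R.
  have -> : z%:~R = ((z %/ 2)%Z * 2)%:~R :> R by congr _%:~R; lia.
  by rewrite intrM; ring.
by rewrite cosDz2pi cos0.
Qed.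

Lemma mul_norm_le (x y B : R) : x ^+ 2 + y ^+ 2 <= 2 * B -> `|x * y| <= B.
Proof.
move=> h; rewrite ler_norml; have := sqr_ge0 (x + y); have := sqr_ge0 (x - y).
by move=> h1 h2; apply/andP; split; lra.
Qed.

Section Triangle.
Local Notation c := (cos (pi / 3%:R) : R).

Lemma cos_pi3 : c = 1 / 2.
Proof.
have c0 : 0 < c by exact: c_gt0.
have := cos_mulr3n (pi / 3); rewrite (_ : 3 * (pi / 3) = pi); last by field.
rewrite cospi => h; have : (c + 1) * (2 * c - 1) ^+ 2 = 0.
  by transitivity (c * (4 * c ^+ 2 - 3) + 1); [ring|rewrite -h; ring].
by move/eqP; rewrite mulf_eq0 expf_eq0 /= => /orP[/eqP|/eqP]; lra.
Qed.

Lemma triangle_bound eta V : max_tensor (Ngon 3) eta -> 2 <= V ->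
  forall i j k l : 'I_3, `|chsh eta (@obs R (Ngon 3) i) (@obs R (Ngon 3) j)
    (@obs R (Ngon 3) k) (@obs R (Ngon 3) l)| <= V.
Proof.
move=> he V2; have c3 := cos_pi3.
have t3 : tau_of c = 1 / 3 by rewrite c3 /tau_of; field.
have main eta' a0 a1 (s : bool) (k : 'I_3) : max_tensor (Ngon 3) eta' ->
    ball (Ngon 3) a0 -> ball (Ngon 3) a1 ->
    `|chsh eta' a0 a1 (obv 3 (2 * pi * k%:R / 3%:R))
      (obv 3 (2 * pi * k%:R / 3%:R + (-1) ^+ s * (2 * (pi * 1%:R / 3%:R))))| <= V.
  move=> he' ha0 ha1; apply: le_trans V2.
  have a1E : pi * 1%:R / 3%:R = pi / 3%:R :> R by rewrite mulr1.
  have hC : 1 - c <= 2 * cos (pi * 1%:R / 3%:R) * c by rewrite a1E c3; lra.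
  (* The plane term equals 2/3, and 4/3 completes it to 2: the triangle never exceeds the classical
     value. *)
  apply: le_trans (@pair_bound R 3 isT isT 1 s k hC eta' a0 a1 (4 / 3) he' ha0 ha1 _) _; last first.
    by rewrite a1E t3 c3 /= expr1; lra.
  have i3 : (1 + 1 / 2)^-1 = 2 / 3 :> R by field.
  move=> z oz; rewrite a1E t3 c3 /= expr1 i3.
  have h : cos (3 * (z%:~R * pi / 3%:R)) = - 1 :> R.
    by rewrite -[RHS](cos_oddpi oz); congr cos; field.
  rewrite cos_mulr3n in h.
  have hs := sin2cos2 (z%:~R * pi / 3%:R : R); have hs' := sin2cos2 (pi / 3%:R : R).
  rewrite c3 in hs'; move: (cos _) (sin (pi / _)) (sin _) h hs hs' => X S Y h hs hs'.
  have : (X + 1) * (2 * X - 1) ^+ 2 = 0.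
    by transitivity (X * (4 * X ^+ 2 - 3) + 1); [ring|rewrite h; ring].
  move=> /eqP; rewrite mulf_eq0 expf_eq0 /= => /orP[/eqP|/eqP] hX.
    have Y0 : Y = 0 by apply/eqP; rewrite -sqrf_eq0 hs (_ : X = - 1); [apply/eqP; ring|lra].
    by rewrite Y0 mulr0 normr0; lra.
  rewrite (_ : X = 1 / 2) in hs *; last by lra.
  rewrite (_ : 4 * S * _ * Y = 8 / 3 * (S * Y)); last by field.
  rewrite normrM ger0_norm //; have : `|S * Y| <= 3 / 4 by apply: mul_norm_le; lra.
  by lra.
apply: (chsh_labels (isT : (2 < 3)%N) (isT : odd 3) he V2 (d := 1)) => [|b b' i k].
  by move=> eta' a0 a1 d s k _ _ _; lia.
by apply: main => //; apply: obv_ball => //; [exact: lattice_theta|exact: lattice_shift].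
Qed.

End Triangle.
End SmallPolygons.

(** * The pentagon, with exact arithmetic in the golden ratio *)

Section Pentagon.
Context {R : realType}.
Local Notation c := (cos (pi / 5%:R) : R).
Local Notation s1 := (sin (pi / 5%:R) : R).
Local Notation tau := (tau_of c).
Local Notation step z := (z%:~R * (2 * pi / 5%:R) : R).
Implicit Types (eta : 'M[R]_3) (f : @form R) (V x : R).

Lemma golden : c ^+ 2 = c / 2 + 1 / 4.
Proof.
have c0 : 0 < c by exact: c_gt0.
have h2 : cos (pi / 5%:R *+ 2) = 2 * c ^+ 2 - 1 by rewrite cos_mulr2n mulr_natl.
have h3 : cos (pi / 5%:R *+ 3) = c * (4 * c ^+ 2 - 3) by rewrite -(mulr_natl _ 3) cos_mulr3n.
have e : pi / 5%:R *+ 3 = - (pi / 5%:R *+ 2) + pi :> R.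
  by rewrite -(mulr_natl _ 3) -(mulr_natl _ 2); field.
rewrite e cosDpi cosN h2 in h3.
have : (c + 1) * (4 * c ^+ 2 - 2 * c - 1) = 0.
  by transitivity (c * (4 * c ^+ 2 - 3) + (2 * c ^+ 2 - 1)); [ring|rewrite -h3; ring].
by move=> /eqP; rewrite mulf_eq0 => /orP[/eqP|/eqP]; lra.
Qed.

Lemma golden_ratio : exists2 x, c = x / 2 & x ^+ 2 = x + 1.
Proof. by exists (2 * c); [|rewrite exprMn golden]; field. Qed.

Lemma golden_bounds : 21 / 26 < c /\ c < 82 / 100.
Proof.
have c0 : 0 < c by exact: c_gt0.
have g := golden; move: c c0 g => x x0 g.
by split; rewrite ltNge; apply/negP => h; nra.
Qed.

Lemma golden_sine : exists2 y, s1 = y / 2 & y ^+ 2 = 3 - 2 * c.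
Proof. by exists (2 * s1); [|rewrite exprMn sin2cos2 golden]; field. Qed.

Lemma golden_inv : (1 + c)^-1 = (6 - 4 * c) / 5.
Proof.
have [b0 _] := golden_bounds; have n1 : 1 + c != 0 by rewrite lt0r_neq0 //; lra.
by apply: (mulfI n1); rewrite divff //; have [x -> g] := golden_ratio; field: g.
Qed.

Lemma golden_tau : tau = (7 - 8 * c) / 5.
Proof. by rewrite /tau_of golden_inv; have [x -> g] := golden_ratio; field: g. Qed.

Lemma golden_tau2 : tau ^+ 2 = (13 - 16 * c) / 5.
Proof. by rewrite golden_tau; have [x -> g] := golden_ratio; field: g. Qed.

Lemma golden_defect : (1 - c) / c = 4 * c - 3.
Proof.
have c0 : c != 0 by rewrite lt0r_neq0 // c_gt0.
by apply: (mulIf c0); rewrite divfK //; have [x -> g] := golden_ratio; field: g.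
Qed.

Lemma fX_mul f al be : fX f al be = (fM1 f + fN1 f) * (cos al * cos be) +
  (fM1 f - fN1 f) * (sin al * sin be) + (fN2 f + fM2 f) * (sin al * cos be) +
  (fN2 f - fM2 f) * (cos al * sin be).
Proof. by rewrite /fX cosB sinB cosD sinD; ring. Qed.

Lemma step_values : [/\ cos (step 1) = c - 1 / 2, sin (step 1) = 2 * c * s1,
  cos (step 2) = - c & sin (step 2) = s1].
Proof.
have e1 : step 1 = pi / 5%:R *+ 2 by rewrite -(mulr_natl _ 2) mul1r; field.
have e2 : step 2 = - (pi / 5%:R) + pi by field.
rewrite e1 e2 cosDpi sinDpi cosN sinN opprK cos_mulr2n sin_mulr2n golden mulr2n.
by split=> //; rewrite ?mulr2n; field.
Qed.

Lemma step_neg (z : int) : cos (step (- z)) = cos (step z) /\ sin (step (- z)) = - sin (step z).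
Proof. by rewrite intrN mulNr cosN sinN. Qed.

Lemma pentagon_corner f : corner f (pi / 5%:R) =
  fM1 f * (4 * c - 1 / 2) + fM2 f * (s1 - 2 * c * s1) +
  fN1 f / 2 + fN2 f * (2 * c * s1 - s1).
Proof.
have [_ s3] := triple_angle (pi / 5%:R : R).
have e3 : 3 * (pi / 5%:R) = - (step 1) + pi :> R by rewrite mul1r; field.
have [c1 s1' _ _] := step_values.
by rewrite cornerE e3 cosDpi sinDpi cosN sinN opprK c1 s1'; ring.
Qed.

(* The weights are optimal solutions of the dual linear programs; they lie in
   Q(sqrt 5), with sqrt 5 = 4 c - 1. *)
Lemma pentagon_up f : positive_form 5 f ->
  corner f (pi / 5%:R) - (1 - c) / c * (- fP f 0 + fQ f (pi / 5%:R)) <= 4 * c - 1 / 2.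
Proof.
move=> pf; have L z z' : 0 <= fL 5 f (step z) (step z') by apply: pf; [exists z|exists z'].
have [b0 b1] := golden_bounds; have g := golden.
have [c1 s1' c2 s2] := step_values; have [c1n s1n] := step_neg 1; have [c2n s2n] := step_neg 2.
have x0 : 0 <= (3 - 2 * c) / 5 by lra.
have x1 : 0 <= (4 * c - 1) / 5 by lra.
have x2 : 0 <= (12 * c - 8) / 5 by lra.
have x3 : 0 <= (7 - 8 * c) / 5 by lra.
have h1 := mulr_ge0 x0 (L (- 2) 0).
have h2 := mulr_ge0 x0 (L (- 2) 1).
have h3 := mulr_ge0 x1 (L (- 1) 1).
have h4 := mulr_ge0 x2 (L (- 1) 2).
have h5 := mulr_ge0 x0 (L 0 (- 2)).
have h6 := mulr_ge0 x0 (L 1 (- 2)).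
have h7 := mulr_ge0 x3 (L 2 (- 1)).
have h8 := mulr_ge0 x0 (L 2 0).
(* Repeated summands are integer multiples of the weights: [h5] and [h6] count twice, [h8] three
   times. *)
rewrite -subr_ge0; have := addr_ge0 (addr_ge0 (addr_ge0 (addr_ge0 (addr_ge0 (addr_ge0 (addr_ge0 h1 h2) h3) h4)
  (addr_ge0 h5 h5)) (addr_ge0 h6 h6)) h7) (addr_ge0 (addr_ge0 h8 h8) h8).
congr (0 <= _); rewrite golden_defect pentagon_corner /fL !fX_mul /fP /fQ.
rewrite !mul0r !cos0 !sin0 c1n s1n c2n s2n c1 s1' c2 s2.
have [y -> y2] := golden_sine; have [x cx g'] := golden_ratio; rewrite cx in y2 *.
have y3 : y ^+ 2 = 3 - x by rewrite y2; field.
by field: g' y3.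
Qed.

Lemma pentagon_down f : positive_form 5 f ->
  (1 - c) / c * (- fP f 0 + fQ f (pi / 5%:R)) - corner f (pi / 5%:R) <= 3 * c.
Proof.
move=> pf; have L z z' : 0 <= fL 5 f (step z) (step z') by apply: pf; [exists z|exists z'].
have [b0 b1] := golden_bounds; have g := golden.
have [c1 s1' c2 s2] := step_values; have [c1n s1n] := step_neg 1; have [c2n s2n] := step_neg 2.
have x0 : 0 <= (3 - 2 * c) / 5 by lra.
have x1 : 0 <= (4 * c - 1) / 5 by lra.
have x2 : 0 <= 2 - 2 * c by lra.
have h1 := mulr_ge0 x1 (L (- 2) (- 2)).
have h2 := mulr_ge0 x0 (L (- 1) (- 1)).
have h3 := mulr_ge0 x1 (L 0 0).
have h4 := mulr_ge0 x0 (L 1 1).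
have h5 := mulr_ge0 x2 (L 1 2).
have h6 := mulr_ge0 x0 (L 2 2).
rewrite -subr_ge0; have := addr_ge0 (addr_ge0 (addr_ge0 (addr_ge0 (addr_ge0 (addr_ge0 h1 h1) h2) (addr_ge0 h3 h3)) h4)
  h5) h6.
congr (0 <= _); rewrite golden_defect pentagon_corner /fL !fX_mul /fP /fQ.
rewrite !mul0r !cos0 !sin0 c1n s1n c2n s2n c1 s1' c2 s2.
have [y -> y2] := golden_sine; have [x cx g'] := golden_ratio; rewrite cx in y2 *.
have y3 : y ^+ 2 = 3 - x by rewrite y2; field.
by field: g' y3.
Qed.

Lemma pentagon_bound eta V : max_tensor (Ngon 5) eta -> 2 <= V ->
  (1 - tau ^+ 2) * steps (pi * 1%:R / 5%:R) - 2 * tau ^+ 2 <= V ->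
  forall i j k l : 'I_5, `|chsh eta (@obs R (Ngon 5) i) (@obs R (Ngon 5) j)
    (@obs R (Ngon 5) k) (@obs R (Ngon 5) l)| <= V.
Proof.
move=> he V2; have g := golden; have [b0 b1] := golden_bounds.
have stE : steps (pi * 1%:R / 5%:R) = 4 * c - 1 / 2.
  have [e3 _ _ _] := step_values.
  rewrite /steps mulr1 (_ : 3 * (pi / 5%:R) = - (step 1) + pi :> R); last by rewrite mul1r; field.
  by rewrite cosDpi cosN e3; ring.
rewrite stE golden_tau2 (_ : _ - _ = (24 * c - 6) / 5); last first.
  by have [x -> g'] := golden_ratio; field: g'.
move=> hV.
apply: (chsh_labels (isT : (2 < 5)%N) (isT : odd 5) he V2 (d := 1)) => [|b b' i k].
  move=> eta' a0 a1 d s k he' ha0 ha1 d1 d0 d5.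
  have {d1 d0 d5} -> : d = 2%N by lia.
  have hC := @direction_bound R 5 isT 2 isT.
  have cc : cos (pi * 2%:R / 5%:R) = c - 1 / 2.
    have [e1 _ _ _] := step_values; rewrite -e1; congr cos; rewrite mul1r; ring.
  (* The constant is the attained value (24 c - 6) / 5 minus the plane term for d = 2, so this
     direction has to be bounded without loss against the optimum. *)
  apply: le_trans (@pair_bound R 5 isT isT 2 s k hC eta' a0 a1 ((72 * c - 48) / 5) he' ha0 ha1 _) _; last first.
    rewrite /= expr0 cc golden_tau2; apply: le_trans hV; rewrite le_eqVlt; apply/orP; left.
    by apply/eqP; have [x -> g'] := golden_ratio; field: g'.
  move=> z oz; rewrite /= expr0 cc.
  have h : cos (5 * (z%:~R * pi / 5%:R)) = 1 :> R.
    have ez : ~~ odd `|z| by rewrite oz.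
    by rewrite -[RHS](cos_evenpi ez); congr cos; field.
  rewrite cos_mulr5n in h.
  have hs := sin2cos2 (z%:~R * pi / 5%:R : R); have hS := sin2cos2 (pi * 2%:R / 5%:R : R).
  rewrite cc in hS; rewrite golden_inv golden_tau.
  rewrite (_ : 4 * ((7 - 8 * c) / 5) * (c - 1 / 2 - 1) * ((6 - 4 * c) / 5) = - (72 - 88 * c) / 5); last first.
    by have [x -> g'] := golden_ratio; field: g'.
  rewrite (_ : 4 * _ * _ * _ = 4 * (6 - 4 * c) / 5 * (sin (pi * 2%:R / 5%:R) * sin (z%:~R * pi / 5%:R))); last by ring.
  have p0 : 0 <= 4 * (6 - 4 * c) / 5 by lra.
  rewrite normrM (ger0_norm p0).
  move: (cos (_ * _ / _)) (sin (pi * _ / _)) (sin _) h hs hS => X S Y h hs hS.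
  (* The equation cos(5 x) = 1 leaves only the values 1, c - 1/2 and - c for the cosine, and the
     majorant is checked at each. *)
  have : (X - 1) * (2 * (X - (c - 1 / 2)) * (2 * (X + c))) ^+ 2 = 0.
    have -> : 2 * (X - (c - 1 / 2)) * (2 * (X + c)) = 4 * X ^+ 2 + 2 * X - 1.
      by have [x -> g'] := golden_ratio; field: g'.
    by transitivity (X * (16 * X ^+ 4 - 20 * X ^+ 2 + 5) - 1); [ring|rewrite h; ring].
  have SY (B : R) : S ^+ 2 + Y ^+ 2 <= 2 * B -> 4 * (6 - 4 * c) / 5 * `|S * Y| <= 4 * (6 - 4 * c) / 5 * B.
    by move=> hB; apply: ler_wpM2l => //; exact: mul_norm_le.
  rewrite {}hS {}hs in SY.
  have B1 : 4 * (6 - 4 * c) / 5 * (1 / 2 + c / 2) = 2 by have [x -> g'] := golden_ratio; field: g'.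
  have B3 : 4 * (6 - 4 * c) / 5 * (5 / 8) = 3 - 2 * c by field.
  have cc2 : (c - 1 / 2) ^+ 2 = 1 / 2 - c / 2 by have [x -> g'] := golden_ratio; field: g'.
  move=> /eqP; rewrite mulf_eq0 expf_eq0 /= !mulf_eq0 pnatr_eq0 /= => hX.
  have {hX} [e|[e|e]] : X = 1 \/ X = c - 1 / 2 \/ X = - c.
    by case/orP: hX => [/eqP|/orP[/eqP|/eqP]] hX; [left|right; left|right; right]; lra.
  - by rewrite e in SY *; apply: le_trans (SY (1 / 2 + c / 2) _) _; rewrite ?B1 ?cc2; lra.
  - by rewrite e in SY *; apply: le_trans (SY (1 / 2 + c / 2) _) _; rewrite ?B1 ?cc2; lra.
  - by rewrite e in SY *; apply: le_trans (SY (5 / 8) _) _; rewrite ?B3 ?cc2 ?sqrrN ?g; lra.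
have [f pf] := corner_pair (isT : (2 < 5)%N) (isT : odd 5) 1 b b' i k he.
rewrite /= expr1 mulN1r golden_tau2 mulr1 !mulN1r; set X := chsh _ _ _ _ _ => hX.
have t0 : 0 <= 1 - (13 - 16 * c) / 5 by lra.
have := ler_wpM2l t0 (pentagon_up pf); have := ler_wpM2l t0 (pentagon_down pf).
rewrite (_ : (1 - _) * (4 * c - 1 / 2) = (20 - 8 * c) / 5); last first.
  by have [x -> g'] := golden_ratio; field: g'.
rewrite (_ : (1 - _) * (3 * c) = 12 / 5); last first.
  by have [x -> g'] := golden_ratio; field: g'.
move=> h1 h2; rewrite ler_norml; apply/andP; split; lra.
Qed.

End Pentagon.

Lemma chsh_odd (R : realType) (m : nat) (T eta0 : 'M[R]_3) :
  (3 <= m)%N -> odd m -> GL (Ngon m) T -> is_hat eta0 T -> max_tensor (Ngon m) eta0 ->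
  exists i j k l : 'I_m,
  2 <= `|chsh eta0 (@obs R (Ngon m) i) (@obs R (Ngon m) j)
                   (@obs R (Ngon m) k) (@obs R (Ngon m) l)| /\
  forall eta, max_tensor (Ngon m) eta -> forall i' j' k' l' : 'I_m,
  `|chsh eta (@obs R (Ngon m) i') (@obs R (Ngon m) j')
             (@obs R (Ngon m) k') (@obs R (Ngon m) l')| <=
  `|chsh eta0 (@obs R (Ngon m) i) (@obs R (Ngon m) j)
              (@obs R (Ngon m) k) (@obs R (Ngon m) l)|.
Proof.
move=> m3 m_odd hT hhat he0; have [i [j [k [l hmax]]]] := ngon_argmax m3 eta0.
exists i, j, k, l; move: hmax; set V := `|_| => hmax.
have V2 : 2 <= V.
  by have [i' [j' [k' [l' h]]]] := attained_ge2 m3 m_odd hT hhat; apply: le_trans h (hmax _ _ _ _).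
have attain d := let: ex_intro i' (ex_intro j' (ex_intro k' (ex_intro l' h))) :=
  attained_steps m3 m_odd hT hhat d in le_trans h (hmax i' j' k' l').
clearbody V; split=> // eta he.
have [m7|m6] := leqP 7 m.
  (* For odd [m] this quotient is the integer nearest to m / 4, on either residue modulo 4. *)
  have := attain ((m + 1) %/ 4)%N.
  apply: (large_polygon_bound (o := if (m %% 4 == 3)%N then 1 else - 1) m3 m_odd m7 _ he V2).
  by case: eqP => h; [left|right]; split=> //; lia.
have [m5|m5] := eqVneq m 5%N.
  subst m; apply: pentagon_bound he V2 _.
  by have := attain 1%N; rewrite /= expr1; lra.
have m3' : m = 3%N by move: m_odd; lia.
by subst m; apply: triangle_bound he V2.
Qed.

Theorem theorem4p1 (R : realType) (n : polygon) (hn : at_least_3 n)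
    (etahat_star : 'M[R]_3) (h_star : twisted_GL n etahat_star)
    (eta_star : 'M[R]_3) (hmax_star : max_tensor n eta_star)
    (hhat_star : is_hat eta_star etahat_star) :
  exists i_star j_star k_star l_star : label R n,
    forall (eta : 'M[R]_3) (A0 A1 B0 B1 : 'I_2 -> 'cV[R]_3),
      max_tensor n eta ->
      observable n A0 -> observable n A1 ->
      observable n B0 -> observable n B1 ->
      `|CHSH eta A0 A1 B0 B1| <=
      `|CHSH eta_star (eff_obs i_star) (eff_obs j_star)
                      (eff_obs k_star) (eff_obs l_star)|.
Proof.
case: h_star => T hT hTE; rewrite -{}hTE in hhat_star.
case: n hn T hT hmax_star hhat_star => [m|] /= hn T hT hmax hhat; last first.
  rewrite mul1mx in hhat; have [i [j [k [l h]]]] := disc_attained hT hhat.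
  exists i, j, k, l => eta A0 A1 B0 B1 he hA0 hA1 hB0 hB1.
  rewrite !CHSH_chsh !(@eff_obsE R Disc) h.
  have s2 : 2 <= 2 * Num.sqrt 2 :> R.
    rewrite -[leLHS]mulr1 ler_pM2l // -[leLHS]sqrtr1 ler_wsqrtr //.
    by rewrite ler1n.
  rewrite (ger0_norm (le_trans _ s2)) //.
  apply: (@chsh_le R Disc (@eff_effectD R) (@extremal_maxD R)) => //; try exact: observable_ball.
  by move=> i' j' k' l'; rewrite !obs_disc; exact: chsh_disc.
have [i [j [k [l [V2 h]]]]] : exists i j k l : 'I_m,
  2 <= `|chsh eta_star (@obs R (Ngon m) i) (@obs R (Ngon m) j)
                   (@obs R (Ngon m) k) (@obs R (Ngon m) l)| /\
  forall eta, max_tensor (Ngon m) eta -> forall i' j' k' l' : 'I_m,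
  `|chsh eta (@obs R (Ngon m) i') (@obs R (Ngon m) j')
             (@obs R (Ngon m) k') (@obs R (Ngon m) l')| <=
  `|chsh eta_star (@obs R (Ngon m) i) (@obs R (Ngon m) j)
              (@obs R (Ngon m) k) (@obs R (Ngon m) l)|.
  case m_odd : (odd m) hhat => hhat; last first.
    apply: (chsh_even hn (negbT m_odd) hT _ hmax); move: hhat; by rewrite /= m_odd.
  by apply: (chsh_odd hn m_odd hT _ hmax); move: hhat; rewrite mul1mx.
exists i, j, k, l => eta A0 A1 B0 B1 he hA0 hA1 hB0 hB1.
rewrite !CHSH_chsh !(@eff_obsE R (Ngon m)).
apply: (@chsh_le R (Ngon m) (eff_effectN hn) (extremal_maxN hn)) => //; try exact: observable_ball.
exact: h.
Qed.
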